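(* Let $\mathbb K$ be a field and $\mathcal K=(\partial:H\to G)$ a crossed module. For every 2-representation $R$ of $\widetilde{\mathcal K}$ there exists a semimatrix $\mathcal K$-algebra $A$ such that $R$ and $\Theta_A^\circ$ are equivalent. In particular, any 2-representation is equivalent to a strict 2-representation.
   Context: 2-functors are pseudofunctors; equivalence of 2-functors means existence of a pseudonatural equivalence (natural 2-isomorphism); a 2-functor is strict if its unit and composition constraints are identities. Horizontal composition $\diamond$ is written left to right. A crossed module $\mathcal K=(\partial:H\to G)$ is a group homomorphism with a left action of $G$ on $H$ by automorphisms, $\partial({}^{\mathbf g}h)=\mathbf g\partial(h)\mathbf g^{-1}$, ${}^{\partial(h)}h'=hh'h^{-1}$. The 2-group $\widetilde{\mathcal K}$ is the 2-category with one object $\star$, 1-morphisms $\mathbf g\in G$, $\mathbf f\diamond\mathbf g=\mathbf f\mathbf g$, 2-morphisms $\mathbf g\stackrel{h}{\Rightarrow}\partial(h)\mathbf g$ ($h\in H$), vertical composition $h_2\circ h_1=h_2h_1$, and $[\mathbf f\stackrel{h}{\Rightarrow}\mathbf g]\diamond[\mathbf f_1\stackrel{h_1}{\Rightarrow}\mathbf g_1]=[\mathbf f\mathbf f_1\stackrel{h\,{}^{\mathbf f}h_1}{\Longrightarrow}\mathbf g\mathbf g_1]$. $2\text{-Vect}^{\mathbb K}$ is the bicategory with objects $n\in\mathbb N$, 1-morphisms $n\to m$ the $n\times m$ matrices of finite-dimensional vector spaces, 2-morphisms matrices of linear maps, $(V\diamond W)_{i,j}=\bigoplus_kV_{i,k}\otimes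 W_{k,j}$. It is equivalent, as a bicategory, to the 2-category $2\text{-}\mathcal Vect^{\mathbb K}$ of module categories over finite-dimensional vector spaces that are module-equivalent to finite-dimensional $\mathbb K^n$-modules for some $n$ (1-morphisms: module functors, $F\diamond F'=F'\circ F$; 2-morphisms: module natural transformations); a functor $F$ with simple objects $C_i$ (source), $D_j$ (target) corresponds to the matrix $\mathrm{Hom}(D_j,F(C_i))$. A 2-representation of $\widetilde{\mathcal K}$ is a 2-functor $\widetilde{\mathcal K}\to2\text{-Vect}^{\mathbb K}$, or, via this equivalence, $\widetilde{\mathcal K}\to2\text{-}\mathcal Vect^{\mathbb K}$ (the latter form is used for $\Theta_A^\circ$ and for strictness here). A $\mathcal K$-algebra is an associative $\mathbb K$-algebra $A$ with a homomorphism of crossed modules $\omega_A$ from $\mathcal K$ to $(A^\times\to\mathrm{Aut}(A))$, $x\mapsto(y\mapsto xyx^{-1})$. A semimatrix algebra is a finite direct sum $A=\bigoplus_i\mathrm{End}_{\mathbb K}(S_i)$ with $S_i$ vector spaces, not necessarily finite-dimensional. For $\mathbf g\in\mathrm{Aut}(A)$, $M^{[\mathbf g]}$ denotes $M$ with action $a\cdot^{[\mathbf g]}m=\mathbf g(a)m$. $A\text{-Mod}^\circ$ is the full subcategory of $A\text{-Mod}$ consisting of (finite) direct sums of modules isomorphic to $S_i^{[\mathbf g]}$, $\mathbf g\in\mathrm{Aut}(A)$. For a semimatrix $\mathcal K$-algebra $A$, $\Theta_A^\circ$ is the strict 2-representation on $A\text{-Mod}^\circ$: $\mathbf g\mapsto(M\mapsto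 M^{[\omega_A(\mathbf g)]})$, $(\mathbf g\stackrel{h}{\Rightarrow}\partial(h)\mathbf g)\mapsto(m\mapsto\omega_A(h)m)$. *)

(* Defs.v *)
From HB Require Import structures.
From mathcomp Require Import all_boot all_order all_algebra.
From mathcomp Require Import boolp.

Set Implicit Arguments.
Unset Strict Implicit.
Unset Printing Implicit Defensive.

Import GRing.Theory.
Local Open Scope ring_scope.

Declare Scope bicat_scope.
Delimit Scope bicat_scope with bicat.

(* Horizontal composition is written from left to right: for [f : x -> y] and
   [g : y -> z] one has [f <o> g : x -> z].  Vertical composition [b \v a] is
   written from right to left. *)
Record bicategory := Bicategory {
  bob :> Type;
  bhom : bob -> bob -> Type;
  bcell : forall x y, bhom x y -> bhom x y -> Type;
  bid1 : forall x, bhom x x;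
  bcomp : forall x y z, bhom x y -> bhom y z -> bhom x z;
  bid2 : forall x y (f : bhom x y), bcell f f;
  bvcomp : forall x y (f g h : bhom x y), bcell g h -> bcell f g -> bcell f h;
  bhcomp : forall x y z (f f' : bhom x y) (g g' : bhom y z),
    bcell f f' -> bcell g g' -> bcell (bcomp f g) (bcomp f' g');
  bassoc : forall x y z t (f : bhom x y) (g : bhom y z) (h : bhom z t),
    bcell (bcomp (bcomp f g) h) (bcomp f (bcomp g h));
  bassoci : forall x y z t (f : bhom x y) (g : bhom y z) (h : bhom z t),
    bcell (bcomp f (bcomp g h)) (bcomp (bcomp f g) h);
  blunit : forall x y (f : bhom x y), bcell (bcomp (bid1 x) f) f;
  bluniti : forall x y (f : bhom x y), bcell f (bcomp (bid1 x) f);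
  brunit : forall x y (f : bhom x y), bcell (bcomp f (bid1 y)) f;
  bruniti : forall x y (f : bhom x y), bcell f (bcomp f (bid1 y));
  bvcompA : forall x y (f g h k : bhom x y)
      (c : bcell h k) (b : bcell g h) (a : bcell f g),
    bvcomp c (bvcomp b a) = bvcomp (bvcomp c b) a;
  bvcomp1l : forall x y (f g : bhom x y) (a : bcell f g),
    bvcomp (bid2 g) a = a;
  bvcomp1r : forall x y (f g : bhom x y) (a : bcell f g),
    bvcomp a (bid2 f) = a;
  bhcomp1 : forall x y z (f : bhom x y) (g : bhom y z),
    bhcomp (bid2 f) (bid2 g) = bid2 (bcomp f g);
  bhcompV : forall x y z (f f' f'' : bhom x y) (g g' g'' : bhom y z)
      (a' : bcell f' f'') (a : bcell f f') (b' : bcell g' g'') (b : bcell g g'),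
    bhcomp (bvcomp a' a) (bvcomp b' b) = bvcomp (bhcomp a' b') (bhcomp a b);
  bassocK : forall x y z t (f : bhom x y) (g : bhom y z) (h : bhom z t),
    bvcomp (bassoci f g h) (bassoc f g h) = bid2 _ /\
    bvcomp (bassoc f g h) (bassoci f g h) = bid2 _;
  blunitK : forall x y (f : bhom x y),
    bvcomp (bluniti f) (blunit f) = bid2 _ /\
    bvcomp (blunit f) (bluniti f) = bid2 _;
  brunitK : forall x y (f : bhom x y),
    bvcomp (bruniti f) (brunit f) = bid2 _ /\
    bvcomp (brunit f) (bruniti f) = bid2 _;
  bassoc_nat : forall x y z t (f f' : bhom x y) (g g' : bhom y z)
      (h h' : bhom z t) (a : bcell f f') (b : bcell g g') (c : bcell h h'),
    bvcomp (bassoc f' g' h') (bhcomp (bhcomp a b) c)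
    = bvcomp (bhcomp a (bhcomp b c)) (bassoc f g h);
  blunit_nat : forall x y (f f' : bhom x y) (a : bcell f f'),
    bvcomp (blunit f') (bhcomp (bid2 (bid1 x)) a) = bvcomp a (blunit f);
  brunit_nat : forall x y (f f' : bhom x y) (a : bcell f f'),
    bvcomp (brunit f') (bhcomp a (bid2 (bid1 y))) = bvcomp a (brunit f);
  bpentagon : forall x y z t u
      (f : bhom x y) (g : bhom y z) (h : bhom z t) (k : bhom t u),
    bvcomp (bassoc f g (bcomp h k)) (bassoc (bcomp f g) h k)
    = bvcomp (bhcomp (bid2 f) (bassoc g h k))
        (bvcomp (bassoc f (bcomp g h) k) (bhcomp (bassoc f g h) (bid2 k)));
  btriangle : forall x y z (f : bhom x y) (g : bhom y z),
    bvcomp (bhcomp (bid2 f) (blunit g)) (bassoc f (bid1 y) g)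
    = bhcomp (brunit f) (bid2 g) }.

Arguments bhom {B} x y : rename.
Arguments bcell {B x y} f g : rename.
Arguments bid1 {B} x : rename.
Arguments bcomp {B x y z} f g : rename.
Arguments bid2 {B x y} f : rename.
Arguments bvcomp {B x y f g h} _ _ : rename.
Arguments bhcomp {B x y z f f' g g'} _ _ : rename.
Arguments bassoc {B x y z t} f g h : rename.
Arguments bassoci {B x y z t} f g h : rename.
Arguments blunit {B x y} f : rename.
Arguments bluniti {B x y} f : rename.
Arguments brunit {B x y} f : rename.
Arguments bruniti {B x y} f : rename.

Notation "f '<o>' g" := (bcomp f g) (at level 40, left associativity)
  : bicat_scope.
Notation "a '<h>' b" := (bhcomp a b) (at level 40, left associativity)
  : bicat_scope.
Notation "b '\v' a" := (bvcomp b a) (at level 45, right associativity)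
  : bicat_scope.

Local Open Scope bicat_scope.

Definition invertible2 (B : bicategory) (x y : B) (f g : bhom x y)
    (a : bcell f g) : Prop :=
  exists b : bcell g f, b \v a = bid2 f /\ a \v b = bid2 g.

Definition isomorphic1 (B : bicategory) (x y : B) (f g : bhom x y) : Prop :=
  exists a : bcell f g, invertible2 a.

Definition equivalence1 (B : bicategory) (x y : B) (f : bhom x y) : Prop :=
  exists g : bhom y x,
    isomorphic1 (f <o> g) (bid1 x) /\ isomorphic1 (g <o> f) (bid1 y).

Definition equivalent_objects (B : bicategory) (x y : B) : Prop :=
  exists f : bhom x y, equivalence1 f.

(* A 2-cell is an identity when its source and target are equal 1-cells and it
   is the identity 2-cell of that 1-cell. *)
Inductive is_identity2 (B : bicategory) (x y : B) (f : bhom x y) :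
    forall g : bhom x y, bcell f g -> Prop :=
  IsIdentity2 : is_identity2 (bid2 f).

Record two_functor (B D : bicategory) := TwoFunctor {
  tf_ob :> B -> D;
  tf_hom : forall x y, bhom x y -> bhom (tf_ob x) (tf_ob y);
  tf_cell : forall x y (f g : bhom x y),
    bcell f g -> bcell (tf_hom f) (tf_hom g);
  tf_unit : forall x, bcell (bid1 (tf_ob x)) (tf_hom (bid1 x));
  tf_comp : forall x y z (f : bhom x y) (g : bhom y z),
    bcell (tf_hom f <o> tf_hom g) (tf_hom (f <o> g));
  tf_cell1 : forall x y (f : bhom x y),
    tf_cell (bid2 f) = bid2 (tf_hom f);
  tf_cellV : forall x y (f g h : bhom x y) (b : bcell g h) (a : bcell f g),
    tf_cell (b \v a) = tf_cell b \v tf_cell a;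
  tf_unit_inv : forall x, invertible2 (tf_unit x);
  tf_comp_inv : forall x y z (f : bhom x y) (g : bhom y z),
    invertible2 (tf_comp f g);
  tf_comp_nat : forall x y z (f f' : bhom x y) (g g' : bhom y z)
      (a : bcell f f') (b : bcell g g'),
    tf_comp f' g' \v (tf_cell a <h> tf_cell b)
    = tf_cell (a <h> b) \v tf_comp f g;
  tf_assoc : forall x y z t (f : bhom x y) (g : bhom y z) (h : bhom z t),
    tf_cell (bassoc f g h) \v tf_comp (f <o> g) h
      \v (tf_comp f g <h> bid2 (tf_hom h))
    = tf_comp f (g <o> h) \v (bid2 (tf_hom f) <h> tf_comp g h)
      \v bassoc (tf_hom f) (tf_hom g) (tf_hom h);
  tf_lunit : forall x y (f : bhom x y),
    tf_cell (blunit f) \v tf_comp (bid1 x) f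
      \v (tf_unit x <h> bid2 (tf_hom f))
    = blunit (tf_hom f);
  tf_runit : forall x y (f : bhom x y),
    tf_cell (brunit f) \v tf_comp f (bid1 y)
      \v (bid2 (tf_hom f) <h> tf_unit y)
    = brunit (tf_hom f) }.

Arguments tf_hom {B D} t {x y} f : rename.
Arguments tf_cell {B D} t {x y f g} a : rename.
Arguments tf_unit {B D} t x : rename.
Arguments tf_comp {B D} t {x y z} f g : rename.

Definition strict (B D : bicategory) (F : two_functor B D) : Prop :=
  (forall x, is_identity2 (tf_unit F x)) /\
  (forall x y z (f : bhom x y) (g : bhom y z), is_identity2 (tf_comp F f g)).

Record pseudonatural (B D : bicategory) (F G : two_functor B D) :=
    Pseudonatural {
  pn_ob :> forall x, bhom (F x) (G x);
  pn_hom : forall x y (f : bhom x y),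
    bcell (tf_hom F f <o> pn_ob y) (pn_ob x <o> tf_hom G f);
  pn_hom_inv : forall x y (f : bhom x y), invertible2 (pn_hom f);
  pn_nat : forall x y (f g : bhom x y) (a : bcell f g),
    pn_hom g \v (tf_cell F a <h> bid2 (pn_ob y))
    = (bid2 (pn_ob x) <h> tf_cell G a) \v pn_hom f;
  pn_comp : forall x y z (f : bhom x y) (g : bhom y z),
    pn_hom (f <o> g) \v (tf_comp F f g <h> bid2 (pn_ob z))
    = (bid2 (pn_ob x) <h> tf_comp G f g)
      \v bassoc (pn_ob x) (tf_hom G f) (tf_hom G g)
      \v (pn_hom f <h> bid2 (tf_hom G g))
      \v bassoci (tf_hom F f) (pn_ob y) (tf_hom G g)
      \v (bid2 (tf_hom F f) <h> pn_hom g)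
      \v bassoc (tf_hom F f) (tf_hom F g) (pn_ob z);
  pn_unit : forall x,
    pn_hom (bid1 x) \v (tf_unit F x <h> bid2 (pn_ob x))
    = (bid2 (pn_ob x) <h> tf_unit G x) \v bruniti (pn_ob x)
      \v blunit (pn_ob x) }.

Definition equivalent (B D : bicategory) (F G : two_functor B D) : Prop :=
  exists s : pseudonatural F G, forall x, equivalence1 (s x).

Definition full_subbicategory (B : bicategory) (P : B -> Prop) : bicategory :=
  @Bicategory {x : B | P x}
    (fun x y => bhom (sval x) (sval y)) (fun x y => @bcell B (sval x) (sval y))
    (fun x => bid1 (sval x))
    (fun x y z => @bcomp B (sval x) (sval y) (sval z))
    (fun x y => @bid2 B (sval x) (sval y))
    (fun x y => @bvcomp B (sval x) (sval y))
    (fun x y z => @bhcomp B (sval x) (sval y) (sval z))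
    (fun x y z t => @bassoc B (sval x) (sval y) (sval z) (sval t))
    (fun x y z t => @bassoci B (sval x) (sval y) (sval z) (sval t))
    (fun x y => @blunit B (sval x) (sval y))
    (fun x y => @bluniti B (sval x) (sval y))
    (fun x y => @brunit B (sval x) (sval y))
    (fun x y => @bruniti B (sval x) (sval y))
    (fun x y => @bvcompA B (sval x) (sval y))
    (fun x y => @bvcomp1l B (sval x) (sval y))
    (fun x y => @bvcomp1r B (sval x) (sval y))
    (fun x y z => @bhcomp1 B (sval x) (sval y) (sval z))
    (fun x y z => @bhcompV B (sval x) (sval y) (sval z))
    (fun x y z t => @bassocK B (sval x) (sval y) (sval z) (sval t))
    (fun x y => @blunitK B (sval x) (sval y))
    (fun x y => @brunitK B (sval x) (sval y))
    (fun x y z t => @bassoc_nat B (sval x) (sval y) (sval z) (sval t))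
    (fun x y => @blunit_nat B (sval x) (sval y))
    (fun x y => @brunit_nat B (sval x) (sval y))
    (fun x y z t u =>
       @bpentagon B (sval x) (sval y) (sval z) (sval t) (sval u))
    (fun x y z => @btriangle B (sval x) (sval y) (sval z)).

Record crossed_module := CrossedModule {
  xm_H : groupType;
  xm_G : groupType;
  xm_d : {multiplicative xm_H -> xm_G};
  xm_act : xm_G -> xm_H -> xm_H;
  xm_act1 : forall h, xm_act 1%g h = h;
  xm_actM : forall g g' h, xm_act (g * g')%g h = xm_act g (xm_act g' h);
  xm_act_morph : forall g, {morph xm_act g : h h' / (h * h')%g};
  xm_d_act : forall g h, xm_d (xm_act g h) = (g * xm_d h * g^-1)%g;
  xm_peiffer : forall h h', xm_act (xm_d h) h' = (h * h' * h^-1)%g }.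

Arguments xm_d {X} : rename.
Arguments xm_act {X} g h : rename.

Record xm_morphism (X Y : crossed_module) := XmMorphism {
  xm_mH : {multiplicative xm_H X -> xm_H Y};
  xm_mG : {multiplicative xm_G X -> xm_G Y};
  xm_m_d : forall h, xm_mG (xm_d h) = xm_d (xm_mH h);
  xm_m_act : forall g h, xm_mH (xm_act g h) = xm_act (xm_mG g) (xm_mH h) }.

Lemma multiplicative1 (G H : groupType) (f : {multiplicative G -> H}) :
  f 1%g = 1%g.
Proof. by apply: (@mulgI _ (f 1%g)); rewrite -gmulfM !mulg1. Qed.

Section TwoGroup.
Variable X : crossed_module.
Local Open Scope group_scope.

Definition tg_cell (g g' : xm_G X) : Type := {h : xm_H X | xm_d h * g = g'}.

Lemma tg_cell_eq g g' (a b : tg_cell g g') : sval a = sval b -> a = b.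
Proof.
case: a b => [a pa] [b pb] /= ab; case: _ / ab pb => pb.
by congr exist; apply: Prop_irrelevance.
Qed.

Lemma xm_d1 : xm_d (1 : xm_H X) = 1.
Proof. exact: multiplicative1. Qed.

Lemma xm_actg1 (g : xm_G X) : xm_act g 1 = 1.
Proof. by apply: (@mulgI _ (xm_act g 1)); rewrite -xm_act_morph !mulg1. Qed.

Lemma tg_eq_subproof (g g' : xm_G X) : g = g' -> xm_d 1 * g = g'.
Proof. by rewrite xm_d1 mul1g. Qed.

Definition tg_eq (g g' : xm_G X) (e : g = g') : tg_cell g g' :=
  exist _ 1 (tg_eq_subproof e).

Lemma tg_v_subproof (f g k : xm_G X) (b : tg_cell g k) (a : tg_cell f g) :
  xm_d (sval b * sval a) * f = k.
Proof. by rewrite gmulfM -mulgA (svalP a) (svalP b). Qed.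

Definition tg_v (f g k : xm_G X) (b : tg_cell g k) (a : tg_cell f g) :
  tg_cell f k := exist _ (sval b * sval a) (tg_v_subproof b a).

Lemma tg_h_subproof (f g f1 g1 : xm_G X) (a : tg_cell f g)
  (b : tg_cell f1 g1) :
  xm_d (sval a * xm_act f (sval b)) * (f * f1) = g * g1.
Proof.
case: a b => [a pa] [b pb] /=; rewrite -{}pa -{}pb.
by rewrite gmulfM xm_d_act !mulgA mulgVK.
Qed.

Definition tg_h (f g f1 g1 : xm_G X) (a : tg_cell f g) (b : tg_cell f1 g1) :
  tg_cell (f * f1) (g * g1) :=
  exist _ (sval a * xm_act f (sval b)) (tg_h_subproof a b).

Definition two_group : bicategory.
refine (@Bicategory unit (fun _ _ => xm_G X) (fun _ _ => tg_cell)
  (fun _ => 1) (fun _ _ _ f g => f * g) (fun _ _ f => tg_eq (erefl f))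
  (fun _ _ => tg_v) (fun _ _ _ f g f1 g1 => @tg_h f g f1 g1)
  (fun _ _ _ _ f g h => tg_eq (esym (mulgA f g h)))
  (fun _ _ _ _ f g h => tg_eq (mulgA f g h))
  (fun _ _ f => tg_eq (mul1g f)) (fun _ _ f => tg_eq (esym (mul1g f)))
  (fun _ _ f => tg_eq (mulg1 f)) (fun _ _ f => tg_eq (esym (mulg1 f)))
  _ _ _ _ _ _ _ _ _ _ _ _ _).
all: intros; try split; apply: tg_cell_eq => /=.
all: rewrite ?xm_actg1 ?mulg1 ?mul1g ?mulgA //.
- have pa : xm_d (sval a) * f = f' := svalP a.
  have -> : xm_act f' (sval b')
      = sval a * xm_act f (sval b') * (sval a)^-1.
    by rewrite -xm_peiffer -xm_actM pa.
  by rewrite xm_act_morph !mulgA mulgVK.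
- by rewrite xm_act_morph xm_actM !mulgA.
- by rewrite xm_act1.
Defined.

End TwoGroup.

(* An associative unital [K]-algebra is a ring with a central morphism from [K].
   Unlike [algType], this allows the zero algebra, which is the semimatrix
   algebra with no block. *)
Record algebra (K : fieldType) := Algebra {
  alg_ring :> pzRingType;
  alg_in : {rmorphism K -> alg_ring};
  alg_central : forall k x, alg_in k * x = x * alg_in k }.

Arguments alg_in {K a} : rename.

Section UnitsAndAutomorphisms.
Variables (K : fieldType) (A : algebra K).

Record alg_unit := AlgUnit {
  uval : A;
  uinv : A;
  uvalV : uval * uinv = 1;
  uVval : uinv * uval = 1 }.

Lemma alg_unit_eq (x y : alg_unit) : uval x = uval y -> x = y.
Proof.
case: x y => [x x' xx' x'x] [y y' yy' y'y] /= xy; subst y.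
have x'y' : x' = y' by rewrite -[x']mulr1 -yy' mulrA x'x mul1r.
by subst y'; congr AlgUnit; apply: Prop_irrelevance.
Qed.

HB.instance Definition _ := gen_eqMixin alg_unit.
HB.instance Definition _ := gen_choiceMixin alg_unit.

Definition alg_unit1 := AlgUnit (mulr1 (1 : A)) (mulr1 (1 : A)).
Definition alg_unitV (x : alg_unit) := AlgUnit (uVval x) (uvalV x).

Lemma alg_unitM_subproof (x y : alg_unit) :
  (uval x * uval y) * (uinv y * uinv x) = 1.
Proof. by rewrite mulrA -(mulrA (uval x)) uvalV mulr1 uvalV. Qed.

Lemma alg_unitM_subproof' (x y : alg_unit) :
  (uinv y * uinv x) * (uval x * uval y) = 1.
Proof. by rewrite mulrA -(mulrA (uinv y)) uVval mulr1 uVval. Qed.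

Definition alg_unitM (x y : alg_unit) :=
  AlgUnit (alg_unitM_subproof x y) (alg_unitM_subproof' x y).

Lemma alg_unitMA : associative alg_unitM.
Proof. by move=> x y z; apply: alg_unit_eq; rewrite /= mulrA. Qed.
Lemma alg_unit1M : left_id alg_unit1 alg_unitM.
Proof. by move=> x; apply: alg_unit_eq; rewrite /= mul1r. Qed.
Lemma alg_unitM1 : right_id alg_unit1 alg_unitM.
Proof. by move=> x; apply: alg_unit_eq; rewrite /= mulr1. Qed.
Lemma alg_unitVM : left_inverse alg_unit1 alg_unitV alg_unitM.
Proof. by move=> x; apply: alg_unit_eq; rewrite /= uVval. Qed.
Lemma alg_unitMV : right_inverse alg_unit1 alg_unitV alg_unitM.
Proof. by move=> x; apply: alg_unit_eq; rewrite /= uvalV. Qed.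

HB.instance Definition _ := isGroup.Build alg_unit
  alg_unitMA alg_unit1M alg_unitM1 alg_unitVM alg_unitMV.

Record alg_aut := AlgAut {
  aut_fun :> A -> A;
  aut_inv : A -> A;
  aut_funK : cancel aut_fun aut_inv;
  aut_invK : cancel aut_inv aut_fun;
  aut_add : {morph aut_fun : x y / x + y};
  aut_mul : {morph aut_fun : x y / x * y};
  aut_in : forall k, aut_fun (alg_in k) = alg_in k }.

Lemma alg_aut_eq (f g : alg_aut) : f =1 g -> f = g.
Proof.
case: f g => [f f' fK f'K fa fm fi] [g g' gK g'K ga gm gi] /= fg.
have {}fg : f = g by apply: functional_extensionality_dep.
subst g; have f'g' : f' = g'.
  by apply: functional_extensionality_dep => x; rewrite -[x in LHS]g'K fK.
by subst g'; congr AlgAut; apply: Prop_irrelevance.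
Qed.

HB.instance Definition _ := gen_eqMixin alg_aut.
HB.instance Definition _ := gen_choiceMixin alg_aut.

Definition alg_aut1 : alg_aut.
Proof. by exists id id. Defined.

Definition alg_autV (f : alg_aut) : alg_aut.
Proof.
exists (aut_inv f) f; [exact: aut_invK | exact: aut_funK | | |].
- by move=> x y; apply: (can_inj (aut_funK f)); rewrite aut_add !aut_invK.
- by move=> x y; apply: (can_inj (aut_funK f)); rewrite aut_mul !aut_invK.
- by move=> k; rewrite -{1}(aut_in f k) aut_funK.
Defined.

Definition alg_autM (f g : alg_aut) : alg_aut.
Proof.
exists (fun x => f (g x)) (fun x => aut_inv g (aut_inv f x)).
- by move=> x; rewrite !aut_funK.
- by move=> x; rewrite !aut_invK.
- by move=> x y; rewrite !aut_add.
- by move=> x y; rewrite !aut_mul.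
- by move=> k; rewrite !aut_in.
Defined.

Lemma alg_autMA : associative alg_autM.
Proof. by move=> x y z; apply: alg_aut_eq. Qed.
Lemma alg_aut1M : left_id alg_aut1 alg_autM.
Proof. by move=> x; apply: alg_aut_eq. Qed.
Lemma alg_autM1 : right_id alg_aut1 alg_autM.
Proof. by move=> x; apply: alg_aut_eq. Qed.
Lemma alg_autVM : left_inverse alg_aut1 alg_autV alg_autM.
Proof. by move=> f; apply: alg_aut_eq => x /=; rewrite aut_funK. Qed.
Lemma alg_autMV : right_inverse alg_aut1 alg_autV alg_autM.
Proof. by move=> f; apply: alg_aut_eq => x /=; rewrite aut_invK. Qed.

HB.instance Definition _ := isGroup.Build alg_aut
  alg_autMA alg_aut1M alg_autM1 alg_autVM alg_autMV.

Lemma alg_aut_1 (f : alg_aut) : f 1 = 1.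
Proof. by rewrite -(rmorph1 (@alg_in K A)) aut_in. Qed.

Definition conj_aut (x : alg_unit) : alg_aut.
Proof.
exists (fun y => uval x * y * uinv x) (fun y => uinv x * y * uval x).
- by move=> y; rewrite !mulrA uVval mul1r -mulrA uVval mulr1.
- by move=> y; rewrite !mulrA uvalV mul1r -mulrA uvalV mulr1.
- by move=> y z; rewrite mulrDr mulrDl.
- move=> y z; rewrite -!mulrA; do 2 congr (_ * _).
  by rewrite !mulrA uVval mul1r.
- by move=> k; rewrite -alg_central -mulrA uvalV mulr1.
Defined.

Lemma conj_autM : {morph conj_aut : x y / (x * y)%g}.
Proof. by move=> x y; apply: alg_aut_eq => z /=; rewrite !mulrA. Qed.

HB.instance Definition _ :=
  isMultiplicative.Build alg_unit alg_aut conj_aut conj_autM.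

Definition aut_unit (f : alg_aut) (x : alg_unit) : alg_unit.
Proof.
exists (f (uval x)) (f (uinv x)).
- by rewrite -aut_mul uvalV alg_aut_1.
- by rewrite -aut_mul uVval alg_aut_1.
Defined.

(* The crossed module [A^* -> Aut(A)], [x |-> (y |-> x y x^-1)]. *)
Definition algebra_crossed_module : crossed_module.
Proof.
refine (@CrossedModule alg_unit alg_aut conj_aut aut_unit _ _ _ _ _).
- by move=> x; apply: alg_unit_eq.
- by move=> f g x; apply: alg_unit_eq.
- by move=> f x y; apply: alg_unit_eq; rewrite /= aut_mul.
- by move=> f x; apply: alg_aut_eq => y /=; rewrite !aut_mul aut_invK.
- by move=> x y; apply: alg_unit_eq.
Defined.

End UnitsAndAutomorphisms.

Section Tensor.
Variable K : fieldType.
Implicit Types (V W U : vectType K) (M N L : lmodType K).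

(* [V (x) M] for [V] of finite dimension [d] is realized as [M^d] through the
   library's standard basis [e_1, .., e_d] of [V]: [v (x) m] is the family
   [(v_i m)_i].  Its universal property is [tlift_pure] and [tensor_ext]. *)
Definition tensor V M : lmodType K := {ffun 'I_(\dim {:V}) -> M}.

Definition pure V M (v : V) (m : M) : tensor V M :=
  [ffun i => coord (vbasis {:V}) i v *: m].

Definition tlift V M N (b : V -> M -> N) (x : tensor V M) : N :=
  \sum_(i < \dim {:V}) b (vbasis {:V})`_i (x i).

Definition bilinear V M N (b : V -> M -> N) : Prop :=
  (forall v, linear (b v)) /\ (forall m, linear (fun v => b v m)).

Lemma linearE M N (f : M -> N) : linear f ->
  [/\ {morph f : x y / x + y}, (forall a, {morph f : x / a *: x}), f 0 = 0
    & forall (I : finType) (F : I -> M), f (\sum_i F i) = \sum_i f (F i)].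
Proof.
move=> lf; pose f' : {linear M -> N} :=
  HB.pack f (GRing.isLinear.Build K M N _ f lf).
split=> [x y | a x || I F]; first exact: (linearD f').
- exact: (linearZZ f').
- exact: (linear0 f').
- exact: (linear_sum f').
Qed.

Lemma linear_lfun V W (f : V -> W) : linear f -> linfun f =1 f.
Proof.
move=> lf; pose f' : {linear V -> W} :=
  HB.pack f (GRing.isLinear.Build K V W _ f lf).
exact: (lfunE f').
Qed.

Lemma pure_bilinear V M : bilinear (@pure V M).
Proof.
split=> [v a m n | m a v w]; apply/ffunP=> i; rewrite !ffunE.
  by rewrite scalerDr !scalerA mulrC.
by rewrite linearP scalerDl scalerA.
Qed.

Lemma tlift_linear V M N (b : V -> M -> N) : bilinear b -> linear (tlift b).
Proof.
case=> bl _ a x y; rewrite /tlift scaler_sumr -big_split /=.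
by apply: eq_bigr => i _; rewrite !ffunE bl.
Qed.

Lemma tlift_pure V M N (b : V -> M -> N) v m :
  bilinear b -> tlift b (pure v m) = b v m.
Proof.
case=> bl br; rewrite {2}(coord_vbasis (memvf v)).
have [_ _ _ ->] := linearE (br m).
apply: eq_bigr => i _; rewrite ffunE.
have [_ -> _ _] := linearE (bl (vbasis {:V})`_i).
by have [_ -> _ _] := linearE (br m).
Qed.

Lemma tensor_span V M (x : tensor V M) :
  x = \sum_(i < \dim {:V}) pure (vbasis {:V})`_i (x i).
Proof.
apply/ffunP=> j; rewrite sum_ffunE (bigD1 j) //= ffunE big1 => [|i ij].
  by rewrite coord_free ?(basis_free (vbasisP _)) // eqxx scale1r addr0.
rewrite ffunE coord_free ?(basis_free (vbasisP _)) //.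
by rewrite eq_sym -val_eqE /= in ij *; rewrite (negPf ij) scale0r.
Qed.

Lemma tensor_ext V M N (f g : tensor V M -> N) : linear f -> linear g ->
  (forall v m, f (pure v m) = g (pure v m)) -> f =1 g.
Proof.
move=> lf lg fg x; rewrite (tensor_span x).
have [_ _ _ ->] := linearE lf; have [_ _ _ ->] := linearE lg.
by apply: eq_bigr => i _; apply: fg.
Qed.

Definition vtensor V W : vectType K := {ffun 'I_(\dim {:V}) -> W}.

End Tensor.

Section TensorMaps.
Variable K : fieldType.
Implicit Types (U V W : vectType K) (M N L : lmodType K).

Definition tmap V W M N (f : V -> W) (g : M -> N) :
  tensor V M -> tensor W N := tlift (fun v m => pure (f v) (g m)).

Definition tassoc U V M :
    tensor (vtensor U V) M -> tensor U (tensor V M) :=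
  tlift (fun (t : tensor U V) m => tlift (fun u v => pure u (pure v m)) t).

Definition tassoci U V M :
    tensor U (tensor V M) -> tensor (vtensor U V) M :=
  tlift (fun u => tlift (fun v m => @pure K (vtensor U V) M (pure u v) m)).

Definition tunit M : tensor K^o M -> M := tlift (fun (k : K^o) m => k *: m).

Definition tuniti M : M -> tensor K^o M := pure (1 : K^o).

Lemma linear_comp M N L (f : N -> L) (g : M -> N) :
  linear f -> linear g -> linear (fun x => f (g x)).
Proof. by move=> lf lg a x y; rewrite lg lf. Qed.

Lemma tlift_linearr V M N L (b : L -> V -> M -> N) (x : tensor V M) :
  (forall v m, linear (fun l => b l v m)) -> linear (fun l => tlift (b l) x).
Proof.
move=> lb a l l'; rewrite /tlift scaler_sumr -big_split /=.
by apply: eq_bigr => i _; rewrite lb.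
Qed.

Lemma pure_linearl V M (m : M) : linear (fun v : V => pure v m).
Proof. by case: (pure_bilinear V M). Qed.

Lemma pure_linearr V M (v : V) : linear (fun m : M => pure v m).
Proof. by case: (pure_bilinear V M). Qed.

Lemma tmap_bilinear V W M N (f : V -> W) (g : M -> N) :
  linear f -> linear g -> bilinear (fun v m => pure (f v) (g m)).
Proof.
move=> lf lg; split=> [v a m n | m a v w] /=.
  by rewrite lg pure_linearr.
by rewrite lf pure_linearl.
Qed.

Lemma tmap_linear V W M N (f : V -> W) (g : M -> N) :
  linear f -> linear g -> linear (tmap f g).
Proof. by move=> lf lg; apply: tlift_linear; apply: tmap_bilinear. Qed.

Lemma tmap_pure V W M N (f : V -> W) (g : M -> N) v m :
  linear f -> linear g -> tmap f g (pure v m) = pure (f v) (g m).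
Proof. by move=> lf lg; rewrite /tmap tlift_pure //; apply: tmap_bilinear. Qed.

Lemma tassoc_bilinear1 U V M (m : M) :
  bilinear (fun (u : U) (v : V) => pure u (pure v m)).
Proof.
split=> [u | v]; last exact: pure_linearl.
by move=> a v w; rewrite pure_linearl pure_linearr.
Qed.

Lemma tassoc_bilinear U V M :
  @bilinear K (vtensor U V) M _
    (fun (t : tensor U V) m => tlift (fun u v => pure u (pure v m)) t).
Proof.
split=> [t | m]; last exact: (tlift_linear (tassoc_bilinear1 _ _ m)).
by apply: tlift_linearr => u v a n l; rewrite !pure_linearr.
Qed.

Lemma tassoc_linear U V M : linear (@tassoc U V M).
Proof. exact/tlift_linear/tassoc_bilinear. Qed.

Lemma tassoc_pure U V M (u : U) (v : V) (m : M) :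
  tassoc (@pure K (vtensor U V) M (pure u v) m) = pure u (pure v m).
Proof.
rewrite /tassoc (tlift_pure _ _ (tassoc_bilinear U V M)).
exact: (tlift_pure _ _ (tassoc_bilinear1 _ _ m)).
Qed.

Lemma tassoci_bilinear1 U V M (u : U) :
  bilinear (fun (v : V) (m : M) => @pure K (vtensor U V) M (pure u v) m).
Proof.
split=> [v | m a v w]; first exact: pure_linearr.
by rewrite pure_linearr (@pure_linearl (vtensor U V)).
Qed.

Lemma tassoci_bilinear U V M :
  bilinear (fun u : U =>
    tlift (fun (v : V) (m : M) => @pure K (vtensor U V) M (pure u v) m)).
Proof.
split=> [u | x]; first exact: (tlift_linear (tassoci_bilinear1 _ _ u)).
apply: tlift_linearr => v m a u u'.
by rewrite pure_linearl (@pure_linearl (vtensor U V)).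
Qed.

Lemma tassoci_linear U V M : linear (@tassoci U V M).
Proof. exact/tlift_linear/tassoci_bilinear. Qed.

Lemma tassoci_pure U V M (u : U) (v : V) (m : M) :
  tassoci (pure u (pure v m)) = @pure K (vtensor U V) M (pure u v) m.
Proof.
rewrite /tassoci (tlift_pure _ _ (tassoci_bilinear U V M)).
exact: (tlift_pure _ _ (tassoci_bilinear1 _ _ u)).
Qed.

Lemma tunit_bilinear M : bilinear (fun (k : K^o) (m : M) => k *: m).
Proof.
split=> [k a m n | m a k l]; first by rewrite scalerDr !scalerA mulrC.
by rewrite scalerDl -scalerA.
Qed.

Lemma tunit_linear M : linear (@tunit M).
Proof. exact/tlift_linear/tunit_bilinear. Qed.

Lemma tunit_pure M (k : K^o) (m : M) : tunit (pure k m) = k *: m.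
Proof. exact/tlift_pure/tunit_bilinear. Qed.

Lemma tuniti_linear M : linear (@tuniti M).
Proof. exact: pure_linearr. Qed.

Lemma tunitK M : cancel (@tunit M) (@tuniti M).
Proof.
apply: tensor_ext => [||k m] //.
  exact: (linear_comp (@tuniti_linear M) (@tunit_linear M)).
rewrite tunit_pure /tuniti.
have [_ -> _ _] := linearE (@pure_linearr K^o M 1).
have [_ <- _ _] := linearE (@pure_linearl K^o M m).
by rewrite /GRing.scale /= mulr1.
Qed.

Lemma tunitiK M : cancel (@tuniti M) (@tunit M).
Proof. by move=> m; rewrite /tuniti tunit_pure scale1r. Qed.

Lemma id_linear M : linear (@id M). Proof. by []. Qed.

Lemma lfun_linear V W (f : 'Hom(V, W)) : linear f.
Proof. by move=> k v w; rewrite linearP. Qed.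

Lemma tmap_id1 V M :
  tmap (\1 : 'Hom(V, V))%VF (@id M) =1 (@id (tensor V M)).
Proof.
have l1 := lfun_linear (\1 : 'Hom(V, V))%VF; have li := @id_linear M.
apply: tensor_ext (tmap_linear l1 li) _ _ => // v m.
by rewrite tmap_pure // id_lfunE.
Qed.

Lemma tensor_ext2 U V M N (f g : tensor (vtensor U V) M -> N) :
  linear f -> linear g ->
  (forall u v m, f (@pure K (vtensor U V) M (pure u v) m)
               = g (@pure K (vtensor U V) M (pure u v) m)) -> f =1 g.
Proof.
move=> lf lg fg; apply: tensor_ext => // t m.
have lp := @pure_linearl (vtensor U V) M m.
have lf' := linear_comp lf lp; have lg' := linear_comp lg lp.
exact: (@tensor_ext K U V N _ _ lf' lg' (fun u v => fg u v m) t).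
Qed.

Lemma tensor_ext2r U V M N (f g : tensor U (tensor V M) -> N) :
  linear f -> linear g ->
  (forall u v m, f (pure u (pure v m)) = g (pure u (pure v m))) -> f =1 g.
Proof.
move=> lf lg fg; apply: tensor_ext => // u x.
have lp := @pure_linearr U (tensor V M) u.
exact: (tensor_ext (linear_comp lf lp) (linear_comp lg lp) (fg u) x).
Qed.

Lemma tensor_ext3 U V W M N
    (f g : tensor (vtensor (vtensor U V) W) M -> N) :
  linear f -> linear g ->
  (forall u v w m,
     f (@pure K (vtensor (vtensor U V) W) M
          (@pure K (vtensor U V) W (pure u v) w) m)
   = g (@pure K (vtensor (vtensor U V) W) M
          (@pure K (vtensor U V) W (pure u v) w) m)) -> f =1 g.
Proof.
move=> lf lg fg; apply: tensor_ext2 => // t w m.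
have lp := @pure_linearl (vtensor (vtensor U V) W) M m.
have lq := @pure_linearl (vtensor U V) W w.
have lf' := linear_comp lf (linear_comp lp lq).
have lg' := linear_comp lg (linear_comp lp lq).
exact: (@tensor_ext K U V N _ _ lf' lg' (fun u v => fg u v w m) t).
Qed.

Lemma tassocK U V M : cancel (@tassoc U V M) (@tassoci U V M).
Proof.
apply: tensor_ext2 => [||u v m] //; last by rewrite tassoc_pure tassoci_pure.
exact: (linear_comp (@tassoci_linear _ _ _) (@tassoc_linear _ _ _)).
Qed.

Lemma tassociK U V M : cancel (@tassoci U V M) (@tassoc U V M).
Proof.
apply: tensor_ext2r => [||u v m] //; last by rewrite tassoci_pure tassoc_pure.
exact: (linear_comp (@tassoc_linear _ _ _) (@tassoci_linear _ _ _)).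
Qed.

Definition vmap V V' W W' (f : 'Hom(V, V')) (g : 'Hom(W, W')) :
  'Hom(vtensor V W, vtensor V' W') := linfun (tmap f g).

Definition vassoc U V W :
  'Hom(vtensor (vtensor U V) W, vtensor U (vtensor V W)) :=
  linfun (@tassoc U V W).

Definition vrunit V : 'Hom(vtensor V K^o, V) :=
  linfun (tlift (fun (v : V) (k : K^o) => k *: v)).

Lemma vrunit_bilinear V : bilinear (fun (v : V) (k : K^o) => k *: v).
Proof. by have [l r] := tunit_bilinear V; split. Qed.

End TensorMaps.

Record category := Category {
  cob :> Type;
  chom : cob -> cob -> Type;
  cid : forall x, chom x x;
  ccomp : forall x y z, chom y z -> chom x y -> chom x z;
  ccompA : forall x y z t (h : chom z t) (g : chom y z) (f : chom x y),
    ccomp h (ccomp g f) = ccomp (ccomp h g) f;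
  ccomp1l : forall x y (f : chom x y), ccomp (cid y) f = f;
  ccomp1r : forall x y (f : chom x y), ccomp f (cid x) = f }.

Arguments chom {C} x y : rename.
Arguments cid {C} x : rename.
Arguments ccomp {C x y z} g f : rename.

Notation "g '\c' f" := (ccomp g f) (at level 45, right associativity)
  : bicat_scope.

Definition invertible (C : category) (x y : C) (f : chom x y) : Prop :=
  exists g : chom y x, g \c f = cid x /\ f \c g = cid y.

(* The hom-sets are not asked to carry a [K]-linear structure.  In a module
   category that is module-equivalent to the finite-dimensional [K^n]-modules,
   this structure is determined by the action ([k f] is [k (x) f] on
   [K (x) M = M], and [f + g] is obtained from the action of [K^2]), and it is
   preserved by all module functors. *)
Record module_category (K : fieldType) := ModuleCategory {
  mc_cat :> category;
  mc_act : vectType K -> mc_cat -> mc_cat;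
  mc_map : forall (V W : vectType K) (M N : mc_cat),
    'Hom(V, W) -> chom M N -> chom (mc_act V M) (mc_act W N);
  mc_assoc : forall (U V : vectType K) (M : mc_cat),
    chom (mc_act (vtensor U V) M) (mc_act U (mc_act V M));
  mc_unit : forall M : mc_cat, chom (mc_act K^o M) M;
  mc_map1 : forall (V : vectType K) (M : mc_cat),
    mc_map (\1 : 'Hom(V, V))%VF (cid M) = cid (mc_act V M);
  mc_mapM : forall (V V' V'' : vectType K) (M M' M'' : mc_cat)
      (f' : 'Hom(V', V'')) (f : 'Hom(V, V'))
      (g' : chom M' M'') (g : chom M M'),
    mc_map (f' \o f)%VF (g' \c g) = mc_map f' g' \c mc_map f g;
  mc_assoc_inv : forall (U V : vectType K) (M : mc_cat),
    invertible (mc_assoc U V M);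
  mc_unit_inv : forall M : mc_cat, invertible (mc_unit M);
  mc_assoc_nat : forall (U U' V V' : vectType K) (M M' : mc_cat)
      (e : 'Hom(U, U')) (f : 'Hom(V, V')) (g : chom M M'),
    mc_assoc U' V' M' \c mc_map (vmap e f) g
    = mc_map e (mc_map f g) \c mc_assoc U V M;
  mc_unit_nat : forall (M M' : mc_cat) (g : chom M M'),
    mc_unit M' \c mc_map (\1 : 'Hom(K^o, K^o))%VF g = g \c mc_unit M;
  mc_pentagon : forall (U V W : vectType K) (M : mc_cat),
    mc_assoc U V (mc_act W M) \c mc_assoc (vtensor U V) W M
    = mc_map (\1 : 'Hom(U, U))%VF (mc_assoc V W M)
      \c mc_assoc U (vtensor V W) M \c mc_map (vassoc U V W) (cid M);
  mc_triangle : forall (V : vectType K) (M : mc_cat),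
    mc_map (\1 : 'Hom(V, V))%VF (mc_unit M) \c mc_assoc V K^o M
    = mc_map (vrunit V) (cid M) }.

Arguments mc_act {K C} V M : rename.
Arguments mc_map {K C V W M N} f g : rename.
Arguments mc_assoc {K C} U V M : rename.
Arguments mc_unit {K C} M : rename.

Section ModuleFunctors.
Variable K : fieldType.
Implicit Types C D E : module_category K.

Local Notation id_ V := (\1 : 'Hom(V, V))%VF.

Record module_functor C D := ModuleFunctor {
  mf_ob :> C -> D;
  mf_hom : forall M N : C, chom M N -> chom (mf_ob M) (mf_ob N);
  mf_str : forall (V : vectType K) (M : C),
    chom (mf_ob (mc_act V M)) (mc_act V (mf_ob M));
  mf_hom1 : forall M : C, mf_hom (cid M) = cid (mf_ob M);
  mf_homM : forall (M N L : C) (g : chom N L) (f : chom M N),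
    mf_hom (g \c f) = mf_hom g \c mf_hom f;
  mf_str_inv : forall (V : vectType K) (M : C), invertible (mf_str V M);
  mf_str_nat : forall (V W : vectType K) (M N : C)
      (f : 'Hom(V, W)) (g : chom M N),
    mf_str W N \c mf_hom (mc_map f g) = mc_map f (mf_hom g) \c mf_str V M;
  mf_str_assoc : forall (V W : vectType K) (M : C),
    mc_map (id_ V) (mf_str W M) \c mf_str V (mc_act W M)
      \c mf_hom (mc_assoc V W M)
    = mc_assoc V W (mf_ob M) \c mf_str (vtensor V W) M;
  mf_str_unit : forall M : C,
    mc_unit (mf_ob M) \c mf_str K^o M = mf_hom (mc_unit M) }.

Arguments mf_hom {C D} F {M N} f : rename.
Arguments mf_str {C D} F V M : rename.

Record module_transformation C D (F G : module_functor C D) :=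
    ModuleTransformation {
  mt_ob :> forall M : C, chom (F M) (G M);
  mt_nat : forall (M N : C) (f : chom M N),
    mt_ob N \c mf_hom F f = mf_hom G f \c mt_ob M;
  mt_str : forall (V : vectType K) (M : C),
    mc_map (id_ V) (mt_ob M) \c mf_str F V M
    = mf_str G V M \c mt_ob (mc_act V M) }.

Lemma module_transformation_eq C D (F G : module_functor C D)
  (a b : module_transformation F G) : (forall M, a M = b M) -> a = b.
Proof.
case: a b => [a an ast] [b bn bst] /= ab.
have {}ab : a = b by apply: functional_extensionality_dep.
by subst b; congr ModuleTransformation; apply: Prop_irrelevance.
Qed.

Lemma invertible_comp (C : category) (x y z : C) (g : chom y z)
  (f : chom x y) : invertible g -> invertible f -> invertible (g \c f).
Proof.
case=> g' [g'g gg'] [f' [f'f ff']]; exists (f' \c g'); split.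
  by rewrite -ccompA (ccompA g') g'g ccomp1l.
by rewrite -ccompA (ccompA f) ff' ccomp1l.
Qed.

Lemma mf_hom_inv C D (F : module_functor C D) (M N : C) (f : chom M N) :
  invertible f -> invertible (mf_hom F f).
Proof.
by case=> g [gf fg]; exists (mf_hom F g); rewrite -!mf_homM gf fg !mf_hom1.
Qed.

Definition mf_id C : module_functor C C.
Proof.
refine (@ModuleFunctor C C id (fun _ _ f => f) (fun V M => cid _) _ _ _ _ _ _)
  => //=.
- by move=> V M; exists (cid _); rewrite ccomp1l.
- by move=> V W M N f g; rewrite ccomp1l ccomp1r.
- by move=> V W M; rewrite mc_map1 !ccomp1l ccomp1r.
- by move=> M; rewrite ccomp1r.
Defined.

Lemma mc_map1M C (V : vectType K) (M N L : C) (g : chom N L) (f : chom M N) :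
  mc_map (id_ V) (g \c f) = mc_map (id_ V) g \c mc_map (id_ V) f.
Proof. by rewrite -mc_mapM comp_lfun1l. Qed.

(* [mf_comp F G] is [F] followed by [G]. *)
Definition mf_comp C D E (F : module_functor C D) (G : module_functor D E) :
  module_functor C E.
Proof.
refine (@ModuleFunctor C E (fun M => G (F M))
  (fun _ _ f => mf_hom G (mf_hom F f))
  (fun V M => mf_str G V (F M) \c mf_hom G (mf_str F V M)) _ _ _ _ _ _).
- by move=> M; rewrite !mf_hom1.
- by move=> M N L g f; rewrite !mf_homM.
- move=> V M; apply: invertible_comp; first exact: mf_str_inv.
  exact/mf_hom_inv/mf_str_inv.
- move=> V W M N f g.
  by rewrite -ccompA -mf_homM mf_str_nat mf_homM !ccompA mf_str_nat.
- move=> V W M; rewrite mc_map1M -!ccompA -mf_homM.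
  rewrite (ccompA (mc_map _ (mf_hom G _))) -mf_str_nat.
  rewrite -!ccompA -!mf_homM mf_str_assoc mf_homM.
  by rewrite !ccompA -mf_str_assoc -!ccompA.
- by move=> M; rewrite ccompA mf_str_unit -mf_homM mf_str_unit.
Defined.

End ModuleFunctors.

Section ModuleCategoryBicategory.
Variable K : fieldType.
Implicit Types C D E : module_category K.

Definition mt_id C D (F : module_functor C D) : module_transformation F F.
Proof.
exists (fun M => cid (F M)) => [M N f | V M].
  by rewrite ccomp1l ccomp1r.
by rewrite mc_map1 ccomp1l ccomp1r.
Defined.

Definition mt_v C D (F G H : module_functor C D)
    (b : module_transformation G H) (a : module_transformation F G) :
  module_transformation F H.
Proof.
exists (fun M => b M \c a M) => [M N f | V M].
  by rewrite -ccompA mt_nat ccompA mt_nat -ccompA.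
by rewrite mc_map1M -ccompA mt_str ccompA mt_str -ccompA.
Defined.

Definition mt_h C D E (F F' : module_functor C D) (G G' : module_functor D E)
    (a : module_transformation F F') (b : module_transformation G G') :
  module_transformation (mf_comp F G) (mf_comp F' G').
Proof.
exists (fun M => mf_hom G' (a M) \c b (F M)) => [M N f | V M] /=.
  by rewrite -ccompA mt_nat ccompA -mf_homM mt_nat mf_homM -ccompA.
rewrite mc_map1M -ccompA (ccompA (mc_map _ (b _))) mt_str.
rewrite -(ccompA (mf_str G' _ _)) mt_nat !ccompA -mf_str_nat.
by rewrite -(ccompA (mf_str G' _ _)) -mf_homM mt_str mf_homM -!ccompA.
Defined.

Definition mt_assoc C D E L (F : module_functor C D) (G : module_functor D E)
    (H : module_functor E L) :
  module_transformation (mf_comp (mf_comp F G) H) (mf_comp F (mf_comp G H)).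
Proof.
refine (@ModuleTransformation K _ _
  (mf_comp (mf_comp F G) H) (mf_comp F (mf_comp G H))
  (fun M => cid (H (G (F M)))) _ _)
  => [M N f | V M] /=; first by rewrite ccomp1l ccomp1r.
by rewrite mc_map1 ccomp1l ccomp1r mf_homM ccompA.
Defined.

Definition mt_associ C D E L (F : module_functor C D) (G : module_functor D E)
    (H : module_functor E L) :
  module_transformation (mf_comp F (mf_comp G H)) (mf_comp (mf_comp F G) H).
Proof.
refine (@ModuleTransformation K _ _
  (mf_comp F (mf_comp G H)) (mf_comp (mf_comp F G) H)
  (fun M => cid (H (G (F M)))) _ _)
  => [M N f | V M] /=; first by rewrite ccomp1l ccomp1r.
by rewrite mc_map1 ccomp1l ccomp1r mf_homM ccompA.
Defined.

Definition mt_lunit C D (F : module_functor C D) :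
  module_transformation (mf_comp (mf_id C) F) F.
Proof.
refine (@ModuleTransformation K _ _
  (mf_comp (mf_id C) F) F
  (fun M => cid (F M)) _ _)
  => [M N f | V M] /=; first by rewrite ccomp1l ccomp1r.
by rewrite mc_map1 ccomp1l mf_hom1.
Defined.

Definition mt_luniti C D (F : module_functor C D) :
  module_transformation F (mf_comp (mf_id C) F).
Proof.
refine (@ModuleTransformation K _ _
  F (mf_comp (mf_id C) F)
  (fun M => cid (F M)) _ _)
  => [M N f | V M] /=; first by rewrite ccomp1l ccomp1r.
by rewrite mc_map1 ccomp1l mf_hom1 !ccomp1r.
Defined.

Definition mt_runit C D (F : module_functor C D) :
  module_transformation (mf_comp F (mf_id D)) F.
Proof.
refine (@ModuleTransformation K _ _
  (mf_comp F (mf_id D)) F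
  (fun M => cid (F M)) _ _)
  => [M N f | V M] /=; first by rewrite ccomp1l ccomp1r.
by rewrite mc_map1 !ccomp1l ccomp1r.
Defined.

Definition mt_runiti C D (F : module_functor C D) :
  module_transformation F (mf_comp F (mf_id D)).
Proof.
refine (@ModuleTransformation K _ _
  F (mf_comp F (mf_id D))
  (fun M => cid (F M)) _ _)
  => [M N f | V M] /=; first by rewrite ccomp1l ccomp1r.
by rewrite mc_map1 !ccomp1l ccomp1r.
Defined.

Lemma mt_invertible C D (F G : module_functor C D)
    (a : module_transformation F G) :
  (forall M, invertible (a M)) ->
  exists b : module_transformation G F,
    mt_v b a = mt_id F /\ mt_v a b = mt_id G.
Proof.
move=> a_inv; pose b M := sval (boolp.cid (a_inv M)).
have ba M : b M \c a M = cid _ by rewrite /b; case: boolp.cid => ? [].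
have ab M : a M \c b M = cid _ by rewrite /b; case: boolp.cid => ? [].
have bn M N (f : chom M N) : b N \c mf_hom G f = mf_hom F f \c b M.
  rewrite -[LHS]ccomp1r -(ab M) -ccompA (ccompA (mf_hom G f)) -mt_nat.
  by rewrite !ccompA ba ccomp1l.
have bs (V : vectType K) (M : C) :
    mc_map (\1 : 'Hom(V, V))%VF (b M) \c mf_str G V M
    = mf_str F V M \c b (mc_act V M).
  rewrite -[LHS]ccomp1r -(ab (mc_act V M)) -ccompA.
  rewrite (ccompA (mf_str G _ _)) -mt_str !ccompA -mc_map1M ba mc_map1.
  by rewrite ccomp1l.
exists (ModuleTransformation bn bs).
by split; apply: module_transformation_eq => M /=.
Qed.

Definition module_categories : bicategory.
Proof.
refine (@Bicategory (module_category K) (@module_functor K)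
  (@module_transformation K) (@mf_id K) (@mf_comp K) mt_id mt_v mt_h
  mt_assoc mt_associ mt_lunit mt_luniti mt_runit mt_runiti
  _ _ _ _ _ _ _ _ _ _ _ _ _).
all: intros; try split; apply: module_transformation_eq => M /=.
all: rewrite ?mf_hom1 ?ccomp1l ?ccomp1r ?mf_hom1 ?ccomp1l //.
- by rewrite ccompA.
- by rewrite mf_homM -!ccompA (ccompA (mf_hom _ (a M))) -mt_nat -!ccompA.
- by rewrite mf_homM ccompA.
Defined.

End ModuleCategoryBicategory.

(* An [A]-module is a [K]-vector space with an algebra morphism from [A] to its
   endomorphisms; keeping the vector space apart from the action makes [M] and
   [M^[g]] share their underlying vector space. *)
Record amodule (K : fieldType) (A : algebra K) := AModule {
  am_space :> lmodType K;
  am_act : A -> am_space -> am_space;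
  am_addl : forall a b m, am_act (a + b) m = am_act a m + am_act b m;
  am_addr : forall a m n, am_act a (m + n) = am_act a m + am_act a n;
  am_mul : forall a b m, am_act (a * b) m = am_act a (am_act b m);
  am_in : forall k m, am_act (alg_in k) m = k *: m }.

Arguments am_act {K A M} a m : rename.

Section Modules.
Variables (K : fieldType) (A : algebra K).
Implicit Types M N L : amodule A.

Record amod_hom M N := AmodHom {
  ah_fun :> M -> N;
  ah_linear : linear ah_fun;
  ah_act : forall a m, ah_fun (am_act a m) = am_act a (ah_fun m) }.

Lemma amod_hom_eq M N (f g : amod_hom M N) : f =1 g -> f = g.
Proof.
case: f g => [f fl fa] [g gl ga] /= fg.
have {}fg : f = g by apply: functional_extensionality_dep.
by subst g; congr AmodHom; apply: Prop_irrelevance.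
Qed.

Lemma am_linear M a : linear (@am_act _ _ M a).
Proof.
move=> k m n; rewrite am_addr -[in LHS](@am_in K A M k) -am_mul -alg_central.
by rewrite am_mul am_in.
Qed.

Lemma am_act1 M (m : M) : am_act 1 m = m.
Proof. by rewrite -(rmorph1 (@alg_in K A)) am_in scale1r. Qed.

Definition ah_id M : amod_hom M M.
Proof. by exists id. Defined.

Definition ah_comp M N L (g : amod_hom N L) (f : amod_hom M N) : amod_hom M L.
Proof.
exists (fun m => g (f m)) => [k m n | a m]; first by rewrite !ah_linear.
by rewrite !ah_act.
Defined.

Definition amod_iso M N : Prop :=
  exists (f : amod_hom M N) (g : amod_hom N M), cancel f g /\ cancel g f.

Definition am_tensor (V : vectType K) M : amodule A.
Proof.
refine (@AModule K A (tensor V M) (fun a x => [ffun i => am_act a (x i)])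
  _ _ _ _).
- by move=> a b x; apply/ffunP=> i; rewrite !ffunE am_addl.
- by move=> a x y; apply/ffunP=> i; rewrite !ffunE am_addr.
- by move=> a b x; apply/ffunP=> i; rewrite !ffunE am_mul.
- by move=> k x; apply/ffunP=> i; rewrite !ffunE am_in.
Defined.

Lemma am_act_pure (V : vectType K) M a (v : V) (m : M) :
  @am_act K A (am_tensor V M) a (pure v m) = pure v (am_act a m).
Proof.
by apply/ffunP=> i; rewrite !ffunE; have [_ -> _ _] := linearE (@am_linear M a).
Qed.

Lemma am_map_act (V W : vectType K) M N (f : 'Hom(V, W)) (g : amod_hom M N)
    a x :
  tmap f g (@am_act K A (am_tensor V M) a x)
  = @am_act K A (am_tensor W N) a (tmap f g x).
Proof.
have lf := lfun_linear f; have lg := ah_linear g; move: x.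
apply: (@tensor_ext _ V M (tensor W N)
  (fun x => tmap f g (@am_act K A (am_tensor V M) a x))
  (fun x => @am_act K A (am_tensor W N) a (tmap f g x))) => [||v m].
- exact: (linear_comp (tmap_linear lf lg) (@am_linear (am_tensor V M) a)).
- exact: (linear_comp (@am_linear (am_tensor W N) a) (tmap_linear lf lg)).
- by rewrite am_act_pure !tmap_pure // am_act_pure ah_act.
Qed.

Definition am_map (V W : vectType K) M N (f : 'Hom(V, W)) (g : amod_hom M N) :
    amod_hom (am_tensor V M) (am_tensor W N) :=
  @AmodHom (am_tensor V M) (am_tensor W N) _
    (tmap_linear (lfun_linear f) (ah_linear g)) (am_map_act f g).

Definition am_assoc (U V : vectType K) M :
  amod_hom (am_tensor (vtensor U V) M) (am_tensor U (am_tensor V M)).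
Proof.
exists (@tassoc K U V M); first exact: tassoc_linear.
move=> a; apply: (@tensor_ext2 K U V M (tensor U (tensor V M))
  (fun x => tassoc (@am_act K A (am_tensor (vtensor U V) M) a x))
  (fun x => @am_act K A (am_tensor U (am_tensor V M)) a (tassoc x)))
  => [||u v m].
- exact: (linear_comp (@tassoc_linear K U V M)
    (@am_linear (am_tensor (vtensor U V) M) a)).
- exact: (linear_comp (@am_linear (am_tensor U (am_tensor V M)) a)
    (@tassoc_linear K U V M)).
- by rewrite am_act_pure !tassoc_pure !am_act_pure.
Defined.

Definition am_associ (U V : vectType K) M :
  amod_hom (am_tensor U (am_tensor V M)) (am_tensor (vtensor U V) M).
Proof.
exists (@tassoci K U V M); first exact: tassoci_linear.
move=> a x; have /= := ah_act (am_assoc U V M) a (tassoci x).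
by rewrite tassociK => <-; rewrite tassocK.
Defined.

Definition am_unit M : amod_hom (am_tensor K^o M) M.
Proof.
exists (@tunit K M); first exact: tunit_linear.
move=> a; apply: (@tensor_ext K K^o M M
  (fun x => tunit (@am_act K A (am_tensor K^o M) a x))
  (fun x => am_act a (tunit x))) => [||v m].
- exact: (linear_comp (@tunit_linear K M) (@am_linear (am_tensor K^o M) a)).
- exact: (linear_comp (@am_linear M a) (@tunit_linear K M)).
- rewrite am_act_pure !tunit_pure.
  by have [_ -> _ _] := linearE (@am_linear M a).
Defined.

Definition am_uniti M : amod_hom M (am_tensor K^o M).
Proof.
exists (@tuniti K M); first exact: tuniti_linear.
by move=> a m; rewrite /tuniti am_act_pure.
Defined.

Section FullSubcategory.
Variable P : amodule A -> Prop.
Hypothesis P_tensor : forall V M, P M -> P (am_tensor V M).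

Definition amod_cat : category.
Proof.
refine (@Category {M : amodule A | P M}
  (fun X Y => amod_hom (sval X) (sval Y)) (fun X => ah_id (sval X))
  (fun X Y Z g f => ah_comp g f) _ _ _).
all: by intros; apply: amod_hom_eq.
Defined.

Lemma amod_hom_invertible (X Y : amod_cat) (f : chom X Y)
    (g : sval Y -> sval X) :
  cancel f g -> cancel g f -> invertible f.
Proof.
move=> fg gf; have gl : linear g.
  by move=> k x y; apply: (can_inj fg); rewrite ah_linear !gf.
have ga a x : g (am_act a x) = am_act a (g x).
  by apply: (can_inj fg); rewrite ah_act !gf.
by exists (AmodHom gl ga); split; apply: amod_hom_eq.
Qed.

Definition amod_module_category : module_category K.
Proof.
refine (@ModuleCategory K amod_cat
  (fun V X => exist P (am_tensor V (sval X)) (P_tensor V (svalP X)))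
  (fun V W X Y f g => am_map f g)
  (fun U V X => am_assoc U V (sval X)) (fun X => am_unit (sval X))
  _ _ _ _ _ _ _ _).
- by move=> V M; apply: amod_hom_eq; apply: tmap_id1.
- move=> V V' V'' M M' M'' f' f g' g; apply: amod_hom_eq => x /=.
  have lf'f := lfun_linear (f' \o f)%VF.
  have lf := lfun_linear f; have lf' := lfun_linear f'.
  have lg := ah_linear g; have lg' := ah_linear g'.
  have lg'g := linear_comp lg' lg.
  apply: (@tensor_ext _ V (sval M) (tensor V'' (sval M''))
    (tmap (f' \o f)%VF (fun m => g' (g m)))
    (fun x => tmap f' g' (tmap f g x))) => [||v m].
  - exact: tmap_linear.
  - exact: (linear_comp (tmap_linear lf' lg') (tmap_linear lf lg)).
  - by rewrite !tmap_pure // comp_lfunE.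
- move=> U V M; exists (am_associ U V (sval M)).
  by split; apply: amod_hom_eq => x /=; rewrite ?tassocK ?tassociK.
- move=> M; exists (am_uniti (sval M)).
  by split; apply: amod_hom_eq => x /=; rewrite ?tunitK ?tunitiK.
- move=> U U' V V' M M' e f g; apply: amod_hom_eq => x /=.
  have le := lfun_linear e; have lf := lfun_linear f.
  have lg := ah_linear g; have lef := lfun_linear (vmap e f).
  have lfg := tmap_linear lf lg.
  apply: (@tensor_ext2 K U V (sval M) (tensor U' (tensor V' (sval M')))
    (fun x => tassoc (tmap (vmap e f) g x))
    (fun x => tmap e (tmap f g) (tassoc x))) => [||u v m].
  - exact: (linear_comp (@tassoc_linear _ _ _ _) (tmap_linear lef lg)).
  - exact: (linear_comp (tmap_linear le lfg) (@tassoc_linear _ _ _ _)).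
  - rewrite tmap_pure // linear_lfun; last exact: tmap_linear.
    by rewrite (tmap_pure _ _ le lf) !tassoc_pure !tmap_pure.
- move=> M M' g; apply: amod_hom_eq => x /=.
  have l1 := lfun_linear (\1 : 'Hom(K^o, K^o))%VF.
  have lg := ah_linear g.
  apply: (@tensor_ext _ K^o (sval M) (sval M')
    (fun x => tunit (tmap (\1 : 'Hom(K^o, K^o))%VF g x))
    (fun x => g (tunit x))) => [||k m].
  - exact: (linear_comp (@tunit_linear _ _) (tmap_linear l1 lg)).
  - exact: (linear_comp lg (@tunit_linear _ _)).
  - rewrite tmap_pure // !tunit_pure id_lfunE.
    by have [_ -> _ _] := linearE lg.
- move=> U V W M; apply: amod_hom_eq => x /=.
  have l1 := lfun_linear (\1 : 'Hom(U, U))%VF.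
  have lid := @id_linear _ (sval M).
  have la := lfun_linear (vassoc U V W).
  have lm := tmap_linear la lid.
  have lt := tmap_linear l1 (@tassoc_linear _ V W (sval M)).
  move: x; apply: tensor_ext3 => [||u v w m].
  - exact: (linear_comp (@tassoc_linear _ U V (tensor W (sval M)))
      (@tassoc_linear _ (vtensor U V) W (sval M))).
  - exact: (linear_comp lt (linear_comp
      (@tassoc_linear _ U (vtensor V W) (sval M)) lm)).
  - rewrite !tassoc_pure [tmap _ id _]tmap_pure //.
    rewrite linear_lfun; last exact: tassoc_linear.
    by rewrite !tassoc_pure tmap_pure ?tassoc_pure ?id_lfunE //;
      apply: tassoc_linear.
- move=> V M; apply: amod_hom_eq => x /=.
  have l1 := lfun_linear (\1 : 'Hom(V, V))%VF.
  have lid := @id_linear _ (sval M).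
  have lr := lfun_linear (vrunit V).
  have lu := @tunit_linear _ (sval M).
  move: x; apply: tensor_ext2 => [||v k m].
  - exact: (linear_comp (tmap_linear l1 lu)
      (@tassoc_linear _ V K^o (sval M))).
  - exact: (tmap_linear lr lid).
  - rewrite tassoc_pure !tmap_pure // id_lfunE tunit_pure.
    rewrite linear_lfun; last exact/tlift_linear/vrunit_bilinear.
    rewrite (tlift_pure _ _ (vrunit_bilinear V)).
    have [_ -> _ _] := linearE (@pure_linearr _ V (sval M) v).
    by have [_ -> _ _] := linearE (@pure_linearl _ V (sval M) m).
Defined.
End FullSubcategory.
End Modules.

Section TwoVectorSpaces.
Variable K : fieldType.

Lemma diag_in_additive n :
  zmod_morphism (fun k : K => [ffun _ : 'I_n => k]).
Proof. by move=> k l; apply/ffunP=> i; rewrite !ffunE. Qed.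

Lemma diag_in_monoid n :
  GRing.monoid_morphism (fun k : K => [ffun _ : 'I_n => k]).
Proof. by split=> [|k l]; apply/ffunP=> i; rewrite !ffunE. Qed.

Definition diag_in n : {rmorphism K -> {ffun 'I_n -> K}} :=
  HB.pack (fun k : K => [ffun _ : 'I_n => k])
    (GRing.isZmodMorphism.Build _ _ _ (diag_in_additive n))
    (GRing.isMonoidMorphism.Build _ _ _ (diag_in_monoid n)).

Lemma diag_central n k x : diag_in n k * x = x * diag_in n k.
Proof. by apply/ffunP=> i; rewrite !ffunE mulrC. Qed.

Definition diag_algebra n : algebra K := Algebra (@diag_central n).

Definition finite_dimensional (M : lmodType K) : Prop :=
  exists (I : finType) (b : I -> M),
    forall m, exists c : I -> K, m = \sum_i c i *: b i.

Lemma finite_dimensional_tensor (V : vectType K) (M : lmodType K) :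
  finite_dimensional M -> finite_dimensional (tensor V M).
Proof.
case=> I [b bP]; exists ('I_(\dim {:V}) * I)%type.
exists (fun p : 'I_(\dim {:V}) * I => pure (vbasis {:V})`_p.1 (b p.2)) => x.
exists (fun p : 'I_(\dim {:V}) * I => sval (boolp.cid (bP (x p.1))) p.2).
rewrite [LHS]tensor_span -(pair_bigA _ (fun (k : 'I__) i =>
  sval (boolp.cid (bP (x k))) i *: pure (vbasis {:V})`_k (b i))) /=.
apply: eq_bigr => k _; case: boolp.cid => c /= {1}->.
have [_ fZ _ ->] := linearE (@pure_linearr _ V M (vbasis {:V})`_k).
by apply: eq_bigr => i _; rewrite fZ.
Qed.

Definition diag_modules n : module_category K :=
  @amod_module_category K (diag_algebra n) (fun M => finite_dimensional M)
    (fun V M => @finite_dimensional_tensor V M).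

Definition is_two_vector_space (C : module_categories K) : Prop :=
  exists n, equivalent_objects C (diag_modules n : module_categories K).

Definition two_vect : bicategory := full_subbicategory is_two_vector_space.

Definition two_rep (X : crossed_module) : Type :=
  two_functor (two_group X) two_vect.

End TwoVectorSpaces.

Section Semimatrix.
Variable K : fieldType.

Definition is_direct_sum (A : algebra K) (I : finType) (N : I -> amodule A)
    (M : amodule A) : Prop :=
  exists (inj : forall i, amod_hom (N i) M) (prj : forall i, amod_hom M (N i)),
    [/\ forall i, cancel (inj i) (prj i),
        forall i j x, i != j -> prj j (inj i x) = 0
      & forall m, \sum_i inj i (prj i m) = m].

Definition am_twist (A : algebra K) (g : alg_aut A) (M : amodule A) :
  amodule A.
Proof.
refine (@AModule K A M (fun a m => am_act (g a) m) _ _ _ _).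
- by move=> a b m; rewrite aut_add am_addl.
- by move=> a m n; rewrite am_addr.
- by move=> a b m; rewrite aut_mul am_mul.
- by move=> k m; rewrite aut_in am_in.
Defined.

(* [A] is the direct sum of the [End_K(S_i)] up to isomorphism: the isomorphism
   is given by actions of [A] on the vector spaces [S_i], which makes it an
   algebra morphism, and [sm_bij] is its bijectivity. *)
Record semimatrix_algebra := SemimatrixAlgebra {
  sm_alg :> algebra K;
  sm_n : nat;
  sm_S : 'I_sm_n -> amodule sm_alg;
  sm_bij : forall f : (forall i, {linear sm_S i -> sm_S i}),
    exists! a : sm_alg, forall i (m : sm_S i), am_act a m = f i m }.

Arguments sm_S {A} i : rename.

Section StandardModules.
Variable A : semimatrix_algebra.

(* Membership in [A-Mod^o]. *)
Definition sm_module (M : amodule A) : Prop :=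
  exists (I : finType) (N : I -> amodule A),
    (forall i, exists (j : 'I_(sm_n A)) (g : alg_aut A),
       amod_iso (N i) (am_twist g (sm_S j))) /\
    is_direct_sum N M.

Lemma sm_module_tensor (V : vectType K) (M : amodule A) :
  sm_module M -> sm_module (am_tensor V M).
Proof.
case=> I [N [Nstd [inj [prj [injK inj0 inj_sum]]]]].
pose e (k : 'I_(\dim {:V})) := (vbasis {:V})`_k.
have injl (p : 'I_(\dim {:V}) * I) :
    linear (fun x => pure (e p.1) (inj p.2 x) : am_tensor V M).
  by move=> a x y; rewrite ah_linear pure_linearr.
have inja (p : 'I_(\dim {:V}) * I) (a : A) (x : N p.2) :
    (pure (e p.1) (inj p.2 (am_act a x)) : am_tensor V M)
    = am_act a (pure (e p.1) (inj p.2 x) : am_tensor V M).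
  by rewrite am_act_pure ah_act.
have prjl (p : 'I_(\dim {:V}) * I) :
    linear (fun x : am_tensor V M => prj p.2 (x p.1)).
  by move=> a x y; rewrite !ffunE ah_linear.
have prja (p : 'I_(\dim {:V}) * I) (a : A) (x : am_tensor V M) :
    prj p.2 ((am_act a x : tensor V M) p.1) = am_act a (prj p.2 (x p.1)).
  by rewrite ffunE ah_act.
exists ('I_(\dim {:V}) * I)%type, (fun p => N p.2).
split=> [p | ]; first exact: Nstd.
exists (fun p => AmodHom (injl p) (inja p)).
exists (fun p => AmodHom (prjl p) (prja p)).
have eK (k l : 'I_(\dim {:V})) : coord (vbasis {:V}) k (e l) = (k == l)%:R.
  by rewrite /e coord_free ?(basis_free (vbasisP _)) // eq_sym.
split=> [p x | p q x pq | x] /=.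
- by rewrite ffunE eK eqxx scale1r injK.
- rewrite ffunE eK; have [_ prjZ _ _] := linearE (ah_linear (prj q.2)).
  rewrite prjZ; case: (eqVneq q.1 p.1) => [qp1 | _]; last by rewrite scale0r.
  rewrite inj0 ?scaler0 //; apply: contraNneq pq => pq2.
  by rewrite -pair_eqE /= qp1 pq2 !eqxx.
- rewrite [RHS]tensor_span -(pair_bigA _ (fun k i =>
    pure (e k) (inj i (prj i (x k))))) /=.
  apply: eq_bigr => k _; rewrite -{2}[x k]inj_sum.
  by have [_ _ _ ->] := linearE (@pure_linearr _ V M (e k)).
Qed.

Lemma sm_module_twist (f : alg_aut A) (M : amodule A) :
  sm_module M -> sm_module (am_twist f M).
Proof.
case=> I [N [Nstd [inj [prj [injK inj0 inj_sum]]]]].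
have tw (P Q : amodule A) (h : amod_hom P Q) :
    exists h' : amod_hom (am_twist f P) (am_twist f Q), h' =1 h.
  by exists (@AmodHom _ _ (am_twist f P) (am_twist f Q) h (ah_linear h)
    (fun a => ah_act h (f a))).
exists I, (fun i => am_twist f (N i)); split=> [i | ].
  have [j [g [u [v [uv vu]]]]] := Nstd i.
  have [u' u'E] := tw _ _ u; have [v' v'E] := tw _ _ v.
  exists j, (g * f)%g.
  exists (@AmodHom _ _ (am_twist f (N i)) (am_twist (g * f)%g (sm_S j)) u'
    (ah_linear u') (ah_act u')).
  exists (@AmodHom _ _ (am_twist (g * f)%g (sm_S j)) (am_twist f (N i)) v'
    (ah_linear v') (ah_act v')).
  by split=> x /=; rewrite u'E v'E.
exists (fun i => sval (boolp.cid (tw _ _ (inj i)))).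
exists (fun i => sval (boolp.cid (tw _ _ (prj i)))).
have injE i := svalP (boolp.cid (tw _ _ (inj i))).
have prjE i := svalP (boolp.cid (tw _ _ (prj i))).
split=> [i x | i j x ij | m]; rewrite ?prjE ?injE ?injK ?inj0 //.
by rewrite -[RHS]inj_sum; apply: eq_bigr => i _; rewrite injE prjE.
Qed.

Definition sm_modules : module_category K :=
  amod_module_category sm_module_tensor.

Definition twist_functor (g : alg_aut A) : module_functor sm_modules sm_modules.
Proof.
refine (@ModuleFunctor K sm_modules sm_modules
  (fun M => exist sm_module (am_twist g (sval M))
     (sm_module_twist g (svalP M)))
  (fun M N f => @AmodHom _ _ (am_twist g (sval M)) (am_twist g (sval N)) f
     (ah_linear f) (fun a => ah_act f (g a)))
  (fun V M => @AmodHom _ _ (am_twist g (am_tensor V (sval M)))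
     (am_tensor V (am_twist g (sval M))) id (fun _ _ _ => erefl)
     (fun _ _ => erefl))
  _ _ _ _ _ _).
- by move=> M; apply: amod_hom_eq.
- by move=> M N L h f; apply: amod_hom_eq.
- move=> V M; unshelve eexists.
    exact: (@AmodHom _ _ (am_tensor V (am_twist g (sval M)))
      (am_twist g (am_tensor V (sval M))) id (fun _ _ _ => erefl)
      (fun _ _ => erefl)).
  by split; apply: amod_hom_eq.
- by move=> V W M N f h; apply: amod_hom_eq.
- move=> V W M; apply: amod_hom_eq => x /=.
  exact: (@tmap_id1 K V (tensor W (sval M))).
- by move=> M; apply: amod_hom_eq.
Defined.

End StandardModules.

Section Theta.
Variables (X : crossed_module) (A : semimatrix_algebra).
Variable omega : xm_morphism X (algebra_crossed_module A).
Hypothesis A_2vect : is_two_vector_space (sm_modules A : module_categories K).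

Let om_aut (g : xm_G X) : alg_aut A := xm_mG omega g.
Let om_unit (h : xm_H X) : alg_unit A := xm_mH omega h.

Lemma theta_cell_act (g g' : xm_G X) (h : tg_cell g g') (M : amodule A)
    (a : A) (m : M) :
  am_act (uval (om_unit (sval h))) (am_act (om_aut g a) m)
  = am_act (om_aut g' a) (am_act (uval (om_unit (sval h))) m).
Proof.
rewrite -!am_mul; congr am_act.
have -> : om_aut g' = (om_aut (xm_d (sval h)) * om_aut g)%g.
  by rewrite /om_aut -gmulfM (svalP h).
by rewrite /om_aut xm_m_d /= -mulrA uVval mulr1.
Qed.

Definition theta_cell (g g' : xm_G X) (h : tg_cell g g') :
  module_transformation (twist_functor (om_aut g)) (twist_functor (om_aut g')).
Proof.
refine (@ModuleTransformation K (sm_modules A) (sm_modules A)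
  (twist_functor (om_aut g)) (twist_functor (om_aut g'))
  (fun M => @AmodHom _ _ (am_twist (om_aut g) (sval M))
     (am_twist (om_aut g') (sval M))
     (@am_act K A (sval M) (uval (om_unit (sval h))))
     (@am_linear _ _ (sval M) (uval (om_unit (sval h))))
     (@theta_cell_act g g' h (sval M))) _ _).
- by move=> M N f; apply: amod_hom_eq => m /=; rewrite ah_act.
- move=> V M; apply: amod_hom_eq => /=.
  have l1 := lfun_linear (\1 : 'Hom(V, V))%VF.
  have la := @am_linear _ _ (sval M) (uval (om_unit (sval h))).
  have lt := @am_linear _ _ (am_tensor V (sval M)) (uval (om_unit (sval h))).
  apply: (tensor_ext (tmap_linear l1 la) lt) => v m.
  by rewrite tmap_pure // id_lfunE am_act_pure.
Defined.

Lemma theta_unit_act (M : amodule A) (a : A) (m : M) :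
  am_act a m = am_act (om_aut 1%g a) m.
Proof. by rewrite /om_aut multiplicative1. Qed.

Definition theta_unit :
  module_transformation (mf_id (sm_modules A)) (twist_functor (om_aut 1%g)).
Proof.
refine (@ModuleTransformation K (sm_modules A) (sm_modules A)
  (mf_id (sm_modules A)) (twist_functor (om_aut 1%g))
  (fun M => @AmodHom _ _ (sval M) (am_twist (om_aut 1%g) (sval M)) id
     (fun _ _ _ => erefl) (@theta_unit_act (sval M))) _ _).
- by move=> M N f; apply: amod_hom_eq.
- by move=> V M; apply: amod_hom_eq; apply: tmap_id1.
Defined.

Lemma theta_comp_act (f g : xm_G X) (M : amodule A) (a : A) (m : M) :
  am_act (om_aut f (om_aut g a)) m = am_act (om_aut (f * g)%g a) m.
Proof. by rewrite /om_aut gmulfM. Qed.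

Definition theta_comp (f g : xm_G X) :
  module_transformation
    (mf_comp (twist_functor (om_aut f)) (twist_functor (om_aut g)))
    (twist_functor (om_aut (f * g)%g)).
Proof.
refine (@ModuleTransformation K (sm_modules A) (sm_modules A)
  (mf_comp (twist_functor (om_aut f)) (twist_functor (om_aut g)))
  (twist_functor (om_aut (f * g)%g))
  (fun M => @AmodHom _ _
     (am_twist (om_aut g) (am_twist (om_aut f) (sval M)))
     (am_twist (om_aut (f * g)%g) (sval M)) id
     (fun _ _ _ => erefl) (@theta_comp_act f g (sval M))) _ _).
- by move=> M N h; apply: amod_hom_eq.
- by move=> V M; apply: amod_hom_eq; apply: tmap_id1.
Defined.

Lemma om_unit1 : uval (om_unit 1%g) = 1.
Proof. by rewrite /om_unit multiplicative1. Qed.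

Definition theta : two_functor (two_group X) (two_vect K).
Proof.
refine (@TwoFunctor (two_group X) (two_vect K)
  (fun _ => exist _ (sm_modules A : module_categories K) A_2vect)
  (fun _ _ g => twist_functor (om_aut g)) (fun _ _ g g' h => theta_cell h)
  (fun _ => theta_unit) (fun _ _ _ f g => theta_comp f g)
  _ _ _ _ _ _ _ _).
- move=> ? ? g; apply: module_transformation_eq => M; apply: amod_hom_eq => m.
  by rewrite /= om_unit1 am_act1.
- move=> ? ? f g h b a; apply: module_transformation_eq => M.
  by apply: amod_hom_eq => m; rewrite /= /om_unit gmulfM /= am_mul.
- by move=> ?; apply: mt_invertible => M;
    exact: (@amod_hom_invertible K A (@sm_module A)
      M (twist_functor (om_aut 1%g) M) (theta_unit M) id).
- by move=> ? ? ? f g; apply: mt_invertible => M;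
    exact: (@amod_hom_invertible K A (@sm_module A)
      (twist_functor (om_aut g) (twist_functor (om_aut f) M))
      (twist_functor (om_aut (f * g)%g) M) (theta_comp f g M) id).
- move=> ? ? ? f f' g g' a b; apply: module_transformation_eq => M.
  apply: amod_hom_eq => m.
  by rewrite /= /om_unit gmulfM xm_m_act /= am_mul.
- move=> ? ? ? ? f g h; apply: module_transformation_eq => M.
  by apply: amod_hom_eq => m; rewrite /= om_unit1 am_act1.
- move=> ? ? f; apply: module_transformation_eq => M.
  by apply: amod_hom_eq => m; rewrite /= om_unit1 am_act1.
- move=> ? ? f; apply: module_transformation_eq => M.
  by apply: amod_hom_eq => m; rewrite /= om_unit1 am_act1.
Defined.

End Theta.
End Semimatrix.

(* Main.v *)
(* Let [E : C -> K^n-mod] be an equivalence of module categories, where [C] is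
   the value of the 2-representation at the object of the 2-group, and put
   [Phi M := prod_(g : G) E (R g M)].  Translating the index set makes [Phi M]
   isomorphic to [Phi (R f M)] by a map [psi f], and these maps are strictly
   compatible with the constraints of [R].  Conjugation by [psi f] is therefore
   a strict action of [G] on the algebra of natural endomorphisms of [Phi], and
   [R h] induces the natural automorphism
   [y |-> (k |-> R h (y ((d h)^-1 k)))] of [Phi].  As [C] is semisimple with
   finitely many simple objects [L_j], this algebra is [prod_j End (Phi L_j)], a
   semimatrix algebra [A]; [Phi] lifts to an equivalence from [C] to the
   standard [A]-modules, and [psi] makes it an equivalence from [R] to
   [Theta_A]. *)
From HB Require Import structures.
From mathcomp Require Import all_boot all_order all_algebra.
From mathcomp Require Import boolp.
Require Import Defs.

Set Implicit Arguments.
Unset Strict Implicit.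
Unset Printing Implicit Defensive.

Import GRing.Theory.
Local Open Scope ring_scope.
Local Open Scope bicat_scope.

(** * Equivalences of module categories *)

(** The product over [G] rigidifies the pseudofunctor. Isomorphisms of [E M] with [E (R g M)] chosen
    for each [g] need not compose strictly; in the product the constraints are absorbed by the shift
    of the index, and their associativity becomes the exact multiplicativity of [psi]. The price is
    that the blocks are infinite-dimensional when [G] is infinite. Two further obstacles shape the
    proof. Semisimplicity of [C] speaks of sums of morphisms, but the hom-sets of a module category
    carry no sums: these are formed among [K^n]-modules, carried to [C] by a quasi-inverse of [E],
    and compared on the fibres. And standard modules admit twists by all automorphisms of [A], not
    only by those that come from [G], so essential surjectivity requires that every twist of a block
    is isomorphic to a block. *)

Section Bicategories.
Variable B : bicategory.

Lemma isomorphic1_sym (x y : B) (f g : bhom x y) :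
  isomorphic1 f g -> isomorphic1 g f.
Proof. by case=> a [b [ba ab]]; exists b, a. Qed.

Lemma isomorphic1_trans (x y : B) (f g h : bhom x y) :
  isomorphic1 f g -> isomorphic1 g h -> isomorphic1 f h.
Proof.
case=> a [a' [a'a aa']] [b [b' [b'b bb']]]; exists (b \v a), (a' \v b').
rewrite !bvcompA -(bvcompA a') b'b bvcomp1r a'a.
by rewrite -(bvcompA b) aa' bvcomp1r bb'.
Qed.

Lemma isomorphic1_comp (x y z : B) (f f' : bhom x y) (g g' : bhom y z) :
  isomorphic1 f f' -> isomorphic1 g g' -> isomorphic1 (f <o> g) (f' <o> g').
Proof.
case=> a [a' [a'a aa']] [b [b' [b'b bb']]]; exists (a <h> b), (a' <h> b').
by rewrite -!bhcompV a'a b'b aa' bb' !bhcomp1.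
Qed.

Lemma isomorphic1_refl (x y : B) (f : bhom x y) : isomorphic1 f f.
Proof. by exists (bid2 f), (bid2 f); rewrite bvcomp1l. Qed.

Lemma isomorphic1_assoc (x y z t : B) (f : bhom x y) (g : bhom y z)
    (h : bhom z t) :
  isomorphic1 (f <o> g <o> h) (f <o> (g <o> h)).
Proof. by exists (bassoc f g h), (bassoci f g h); apply: bassocK. Qed.

Lemma isomorphic1_cancel (x y z : B) (f : bhom x y) (f' : bhom y x)
    (g : bhom y z) (g' : bhom z y) :
  isomorphic1 (f <o> f') (bid1 x) -> isomorphic1 (g <o> g') (bid1 y) ->
  isomorphic1 ((f <o> g) <o> (g' <o> f')) (bid1 x).
Proof.
move=> ff' gg'; apply: isomorphic1_trans (isomorphic1_assoc _ _ _) _.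
apply: isomorphic1_trans ff'; apply: isomorphic1_comp.
  exact: isomorphic1_refl.
apply: isomorphic1_trans (isomorphic1_sym (isomorphic1_assoc _ _ _)) _.
have: isomorphic1 (bid1 y <o> f') f'.
  by exists (blunit f'), (bluniti f'); apply: blunitK.
by apply: isomorphic1_trans; apply: isomorphic1_comp (isomorphic1_refl _).
Qed.

Lemma equivalence1_comp (x y z : B) (f : bhom x y) (g : bhom y z) :
  equivalence1 f -> equivalence1 g -> equivalence1 (f <o> g).
Proof.
case=> f' [ff' f'f] [g' [gg' g'g]]; exists (g' <o> f').
by split; apply: isomorphic1_cancel.
Qed.

End Bicategories.

Section ModuleEquivalences.
Variable K : fieldType.
Implicit Types C D : module_category K.

Lemma vmap_id1 (U V : vectType K) :
  vmap (\1 : 'Hom(U, U)) (\1 : 'Hom(V, V)) = \1%VF.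
Proof.
apply/lfunP=> x; rewrite linear_lfun; last first.
  by apply: tmap_linear; apply: lfun_linear.
have -> : (\1 : 'Hom(V, V))%VF = id :> (V -> V).
  by apply: funext => v; rewrite id_lfunE.
by rewrite id_lfunE; apply: tmap_id1.
Qed.

Lemma invertible_mono (C : category) (x y z : C) (g : chom y z)
    (f f' : chom x y) : invertible g -> g \c f = g \c f' -> f = f'.
Proof.
by case=> g' [g'g _] gf; rewrite -[f]ccomp1l -[f']ccomp1l -g'g -!ccompA gf.
Qed.

Lemma invertible_epi (C : category) (x y z : C) (g : chom x y)
    (f f' : chom y z) : invertible g -> f \c g = f' \c g -> f = f'.
Proof.
by case=> g' [_ gg'] fg; rewrite -[f]ccomp1r -[f']ccomp1r -gg' !ccompA fg.
Qed.

Section FullyFaithful.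
Variables (C D : module_category K) (F : module_functor C D).
Hypothesis F_faithful : forall M N, injective (@mf_hom _ _ _ F M N).
Hypothesis F_full : forall (M N : C) (w : chom (F M) (F N)),
  exists v, mf_hom F v = w.
Hypothesis F_surj : forall N : D, exists (M : C) (f : chom (F M) N),
  invertible f.

Let lift M N (w : chom (F M) (F N)) : chom M N := sval (boolp.cid (F_full w)).
Let liftE M N (w : chom (F M) (F N)) : mf_hom F (lift w) = w.
Proof. exact: svalP (boolp.cid (F_full w)). Qed.

Let Q (N : D) : C := sval (boolp.cid (F_surj N)).
Let e (N : D) : chom (F (Q N)) N := sval (boolp.cid (svalP (boolp.cid
  (F_surj N)))).
Let e_inv N : invertible (e N).
Proof. exact: svalP (boolp.cid (svalP (boolp.cid (F_surj N)))). Qed.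
Let e' (N : D) : chom N (F (Q N)) := sval (boolp.cid (e_inv N)).
Let e'e N : e' N \c e N = cid _.
Proof. by have [] := svalP (boolp.cid (e_inv N)). Qed.
Let ee' N : e N \c e' N = cid _.
Proof. by have [] := svalP (boolp.cid (e_inv N)). Qed.

Let s' V M : chom (mc_act V (F M)) (F (mc_act V M)) :=
  sval (boolp.cid (mf_str_inv F V M)).
Let s's V M : s' V M \c mf_str F V M = cid _.
Proof. by have [] := svalP (boolp.cid (mf_str_inv F V M)). Qed.
Let ss' V M : mf_str F V M \c s' V M = cid _.
Proof. by have [] := svalP (boolp.cid (mf_str_inv F V M)). Qed.

Let lift_inv M N (w : chom (F M) (F N)) : invertible w -> invertible (lift w).
Proof.
case=> w' [w'w ww']; exists (lift w').
by split; apply: F_faithful; rewrite mf_homM mf_hom1 !liftE.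
Qed.

Let id_ (V : vectType K) := (\1 : 'Hom(V, V))%VF.

Let s'_nat (V W : vectType K) (M N : C) (f : 'Hom(V, W)) (g : chom M N) :
  mf_hom F (mc_map f g) \c s' V M = s' W N \c mc_map f (mf_hom F g).
Proof.
apply: (invertible_mono (mf_str_inv F W N)).
by rewrite !ccompA ss' ccomp1l mf_str_nat -ccompA ss' ccomp1r.
Qed.

Let s'_assoc (V W : vectType K) (M : C) :
  mf_hom F (mc_assoc V W M) \c s' (vtensor V W) M
  = s' V (mc_act W M) \c mc_map (id_ V) (s' W M) \c mc_assoc V W (F M).
Proof.
apply: (invertible_epi (mf_str_inv F (vtensor V W) M)).
rewrite -!ccompA s's -mf_str_assoc ccomp1r (ccompA (mc_map _ (s' W M))).
by rewrite -mc_map1M s's mc_map1 ccomp1l !ccompA s's ccomp1l.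
Qed.

Let s'_unit (M : C) : mf_hom F (mc_unit M) \c s' K^o M = mc_unit (F M).
Proof. by rewrite -mf_str_unit -ccompA ss' ccomp1r. Qed.

(** This choice is forced: it is the only constraint for which [e] is a module transformation from
    [Q] followed by [F] to the identity. Its axioms are checked after applying the faithful functor
    [F]. *)
Let qstr V N : chom (Q (mc_act V N)) (mc_act V (Q N)) :=
  lift (s' V (Q N) \c mc_map (id_ V) (e' N) \c e (mc_act V N)).

Let quasi_inverse : module_functor D C.
Proof.
refine (@ModuleFunctor K D C Q (fun M N f => lift (e' N \c f \c e M)) qstr
  _ _ _ _ _ _).
- by move=> M; apply: F_faithful; rewrite liftE mf_hom1 ccomp1l e'e.
- move=> M N L g f; apply: F_faithful; rewrite mf_homM !liftE.
  by rewrite -!ccompA (ccompA (e N)) ee' ccomp1l.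
- move=> V M; apply: lift_inv; apply: invertible_comp.
    by exists (mf_str F V (Q M)).
  apply: invertible_comp (e_inv _).
  by exists (mc_map (id_ V) (e M)); rewrite -!mc_map1M ee' e'e !mc_map1.
- move=> V W M N f g; apply: F_faithful; rewrite !mf_homM !liftE.
  rewrite -!ccompA (ccompA (e _)) ee' ccomp1l.
  rewrite (ccompA (mf_hom F _)) s'_nat liftE -!ccompA; congr (_ \c _).
  rewrite !ccompA -!mc_mapM; congr (_ \c _).
  by rewrite comp_lfun1l comp_lfun1r -!ccompA ee' ccomp1r.
- move=> V W M; apply: F_faithful; rewrite !mf_homM !liftE -!ccompA.
  rewrite (ccompA (mf_hom F (mc_map _ _))) s'_nat liftE.
  rewrite (ccompA (mf_hom F (mc_assoc _ _ _))) s'_assoc.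
  rewrite -!ccompA; congr (_ \c _).
  rewrite (ccompA (e (mc_act V _))) ee' ccomp1l.
  rewrite !mc_map1M -!ccompA (ccompA (mc_map _ (e _))) -mc_map1M ee' mc_map1.
  rewrite ccomp1l; congr (_ \c _).
  by rewrite !ccompA -mc_assoc_nat vmap_id1.
- move=> M; apply: F_faithful; rewrite !mf_homM !liftE.
  by rewrite ccompA s'_unit ccompA mc_unit_nat -!ccompA.
Defined.

(** Both isomorphisms come from [e]: over [D] it is [e] itself, over [C] it is the preimage under
    [F] of [e] at [F M]. *)
Lemma fully_faithful_equivalence : @equivalence1 (module_categories K) C D F.
Proof.
exists quasi_inverse; split.
- have an M N (f : chom M N) :
      lift (e (F N)) \c mf_hom quasi_inverse (mf_hom F f)
      = f \c lift (e (F M)).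
    apply: F_faithful; rewrite !mf_homM !liftE.
    by rewrite (ccompA (e _)) ee' ccomp1l.
  have as_ V M : mc_map (id_ V) (lift (e (F M)))
        \c mf_str (mf_comp F quasi_inverse) V M
      = mf_str (mf_id C) V M \c lift (e (F (mc_act V M))).
    apply: F_faithful; rewrite /= ccomp1l !mf_homM !liftE.
    rewrite -!ccompA (ccompA (mf_hom F (mc_map _ _))) s'_nat liftE.
    rewrite -!ccompA (ccompA (e _)) ee' ccomp1l.
    by rewrite (ccompA (mc_map _ _)) -mc_map1M ee' mc_map1 ccomp1l ccompA s's
      ccomp1l.
  exists (@ModuleTransformation K _ _ (mf_comp F quasi_inverse)
    (mf_id C) _ an as_).
  by apply: mt_invertible => M; apply: lift_inv (e_inv (F M)).
- have bn M N (f : chom M N) :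
      e N \c mf_hom F (mf_hom quasi_inverse f) = f \c e M.
    by rewrite liftE !ccompA ee' ccomp1l.
  have bs V M : mc_map (id_ V) (e M) \c mf_str (mf_comp quasi_inverse F) V M
      = mf_str (mf_id D) V M \c e (mc_act V M).
    rewrite /= ccomp1l liftE (ccompA (mf_str _ _ _)) ss' ccomp1l ccompA.
    by rewrite -mc_map1M ee' mc_map1 ccomp1l.
  exists (@ModuleTransformation K _ _ (mf_comp quasi_inverse F)
    (mf_id D) _ bn bs).
  exact: mt_invertible.
Qed.

End FullyFaithful.

Lemma invertible2_component C D (F G : module_functor C D)
    (a : @bcell (module_categories K) C D F G) (M : C) :
  invertible2 a -> invertible ((a : module_transformation F G) M).
Proof.
by case=> b [ba ab]; exists ((b : module_transformation G F) M); split;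
  [move: ba | move: ab] => /(congr1 (fun t : module_transformation _ _ => t M)).
Qed.

Lemma equivalence1_faithful C D (F : module_functor C D) :
  @equivalence1 (module_categories K) C D F ->
  forall M N, injective (@mf_hom _ _ _ F M N).
Proof.
case=> G [[a a_inv] _] M N f f' ff'.
apply: (invertible_epi (invertible2_component M a_inv)).
have aE (h : chom M N) :
    h \c (a : module_transformation (mf_comp F G) (mf_id C)) M
    = (a : module_transformation (mf_comp F G) (mf_id C)) N
      \c mf_hom G (mf_hom F h).
  exact: esym (mt_nat a h).
by rewrite !aE ff'.
Qed.

Lemma equivalence1_sym C D (F : module_functor C D)
    (G : module_functor D C) :
  @isomorphic1 (module_categories K) C C (mf_comp F G) (mf_id C) ->
  @isomorphic1 (module_categories K) D D (mf_comp G F) (mf_id D) ->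
  @equivalence1 (module_categories K) D C G.
Proof. by exists F. Qed.

(** The preimage of [w] is [mf_hom G w] conjugated by the isomorphism of [G (F M)] with [M]. That
    [F] sends it to [w] is seen after applying [G], which is faithful as an equivalence. *)
Lemma equivalence1_full C D (F : module_functor C D) :
  @equivalence1 (module_categories K) C D F ->
  forall (M N : C) (w : chom (F M) (F N)), exists v, mf_hom F v = w.
Proof.
case=> G [FG GF] M N w.
have G_faithful := equivalence1_faithful (equivalence1_sym FG GF).
case: FG => a a_inv.
have [b [ba ab]] := invertible2_component M a_inv.
pose aM := (a : module_transformation (mf_comp F G) (mf_id C)) M.
pose aN := (a : module_transformation (mf_comp F G) (mf_id C)) N.
exists (aN \c mf_hom G w \c b); apply: G_faithful.
apply: (invertible_mono (invertible2_component N a_inv)).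
rewrite -[LHS]/(aN \c mf_hom (mf_comp F G) (aN \c mf_hom G w \c b)).
rewrite (mt_nat (a : module_transformation (mf_comp F G) (mf_id C))) /=.
by rewrite -!ccompA ba ccomp1r.
Qed.

Lemma equivalence1_surj C D (F : module_functor C D) :
  @equivalence1 (module_categories K) C D F ->
  forall N : D, exists (M : C) (f : chom (F M) N), invertible f.
Proof.
case=> G [_ [b b_inv]] N; exists (G N).
exists ((b : module_transformation (mf_comp G F) (mf_id D)) N).
exact: invertible2_component b_inv.
Qed.

End ModuleEquivalences.

(** * Full sub-bicategories *)

Section ForgetfulFunctor.
Variables (B D : bicategory) (P : D -> Prop).

(** Lets the construction take place among all module categories, without carrying proofs that they
    are 2-vector spaces. *)
Definition forget_full (F : two_functor B (full_subbicategory P)) :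
  two_functor B D :=
  @TwoFunctor B D (fun x => sval (F x)) (fun x y f => @tf_hom _ _ F x y f)
    (fun x y f g a => @tf_cell _ _ F x y f g a) (fun x => tf_unit F x)
    (fun x y z f g => @tf_comp _ _ F x y z f g)
    (fun x y f => @tf_cell1 _ _ F x y f)
    (fun x y f g h b a => @tf_cellV _ _ F x y f g h b a)
    (fun x => @tf_unit_inv _ _ F x)
    (fun x y z f g => @tf_comp_inv _ _ F x y z f g)
    (fun x y z f f' g g' a b => @tf_comp_nat _ _ F x y z f f' g g' a b)
    (fun x y z t f g h => @tf_assoc _ _ F x y z t f g h)
    (fun x y f => @tf_lunit _ _ F x y f) (fun x y f => @tf_runit _ _ F x y f).

Lemma forget_full_equivalent (F F' : two_functor B (full_subbicategory P)) :
  equivalent (forget_full F) (forget_full F') -> equivalent F F'.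
Proof.
case=> s s_equiv.
by exists (@Pseudonatural B (full_subbicategory P) F F' (@pn_ob _ _ _ _ s)
  (@pn_hom _ _ _ _ s) (@pn_hom_inv _ _ _ _ s) (@pn_nat _ _ _ _ s)
  (@pn_comp _ _ _ _ s) (@pn_unit _ _ _ _ s)).
Qed.
End ForgetfulFunctor.

(** * Linearity of module functors *)

Section LinearCombinations.
Variables (K : fieldType) (A : algebra K).

Lemma ah_lincomb_linear (M N : amodule A) (I : finType) (c : I -> K)
    (f : I -> amod_hom M N) : linear (fun m => \sum_i c i *: f i m).
Proof.
move=> k x y; rewrite scaler_sumr -big_split; apply: eq_bigr => i _ /=.
by rewrite ah_linear scalerDr !scalerA mulrC.
Qed.

Lemma ah_lincomb_act (M N : amodule A) (I : finType) (c : I -> K)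
    (f : I -> amod_hom M N) a m :
  \sum_i c i *: f i (am_act a m) = am_act a (\sum_i c i *: f i m).
Proof.
have [_ aZ _ ->] := Defs.linearE (@am_linear _ _ N a).
by apply: eq_bigr => i _; rewrite aZ ah_act.
Qed.

(** The one operation through which all linearity is expressed: index type [void] gives the zero
    morphism, [unit] a scalar multiple, and coefficients 1 a sum. *)
Definition ah_lincomb (M N : amodule A) (I : finType) (c : I -> K)
    (f : I -> amod_hom M N) : amod_hom M N :=
  AmodHom (ah_lincomb_linear c f) (ah_lincomb_act c f).

End LinearCombinations.

Section Additivity.
Variables (K : fieldType) (A B : algebra K).
Variables (P : amodule A -> Prop) (Q : amodule B -> Prop).
Hypothesis P_tensor : forall V M, P M -> P (am_tensor V M).
Hypothesis Q_tensor : forall V M, Q M -> Q (am_tensor V M).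
Let CA : module_category K := amod_module_category P_tensor.
Let CB : module_category K := amod_module_category Q_tensor.
Variable S : module_functor CA CB.

Section LinearCombination.
Variables (M N : CA) (I : finType) (f : I -> amod_hom (sval M) (sval N)).
Let V : vectType K := {ffun I -> K^o}.

Let weight (c : I -> K) : 'Hom(K^o, V) :=
  linfun (fun k : K^o => [ffun i => k * c i] : V).

Let weightE c k : weight c k = [ffun i => k * c i].
Proof.
apply: (@linear_lfun K K^o V (fun k : K^o => [ffun i => k * c i] : V)).
move=> a x y; apply/ffunP=> i; rewrite !ffunE.
by rewrite mulrDl -mulrA.
Qed.

Let combine_bilinear :
  @bilinear K V (sval M) (sval N) (fun v m =>
    \sum_i (v : {ffun I -> K^o}) i *: f i m).
Proof.
split=> [v | m k v w].
  exact: (@ah_lincomb_linear K A (sval M) (sval N) I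
    (fun i => (v : {ffun I -> K^o}) i) f).
rewrite scaler_sumr -big_split; apply: eq_bigr => i _ /=.
by rewrite !ffunE scalerDl scalerA.
Qed.

Let combine : amod_hom (am_tensor V (sval M)) (sval N).
Proof.
exists (tlift (fun v m => \sum_i (v : {ffun I -> K^o}) i *: f i m)).
  exact: tlift_linear combine_bilinear.
move=> a; apply: (@tensor_ext K V (sval M) (sval N)
  (fun x => tlift _ (@am_act K A (am_tensor V (sval M)) a x))
  (fun x => am_act a (tlift _ x))) => [||v m].
- exact: linear_comp (tlift_linear combine_bilinear)
    (@am_linear _ _ (am_tensor V (sval M)) a).
- exact: linear_comp (@am_linear _ _ (sval N) a)
    (tlift_linear combine_bilinear).
- rewrite am_act_pure !(tlift_pure _ _ combine_bilinear).
  exact: ah_lincomb_act.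
Defined.

Let lincombE (c : I -> K) : ah_lincomb c f
  = ah_comp combine (ah_comp (am_map (weight c) (ah_id (sval M)))
      (am_uniti (sval M))).
Proof.
apply: amod_hom_eq => m /=; rewrite /tuniti.
rewrite tmap_pure ?(tlift_pure _ _ combine_bilinear); last exact: id_linear.
  by apply: eq_bigr => i _; rewrite weightE ffunE mul1r.
exact: lfun_linear.
Qed.

(* A linear combination of the [f i] factors as [M -> V (x) M -> N] for
   [V := K^I], where the first map depends on the coefficients only, through a
   linear map [K -> V], and the second map depends on the [f i] only. *)
Lemma mf_hom_lincomb (c : I -> K) x :
  (mf_hom S (ah_lincomb c f : chom M N) : amod_hom _ _) x
  = \sum_i c i *: (mf_hom S (f i : chom M N) : amod_hom _ _) x.
Proof.
have [s' [s's _]] := mf_str_inv S V M.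
have {}s's y : (s' : amod_hom _ _) ((mf_str S V M : amod_hom _ _) y) = y.
  by have /(congr1 (fun g : amod_hom _ _ => g y)) := s's.
have SE (c' : I -> K) : mf_hom S (ah_lincomb c' f : chom M N)
   = mf_hom S (combine : chom (mc_act V M) N) \c
     mf_hom S (mc_map (weight c') (cid M)) \c
     mf_hom S (am_uniti (sval M) : chom M (mc_act K^o M)).
  by rewrite -!mf_homM lincombE.
pose y : tensor K^o (sval (S M)) := (mf_str S K^o M : amod_hom _ _)
  ((mf_hom S (am_uniti (sval M) : chom M (mc_act K^o M)) : amod_hom _ _) x).
have SxE (c' : I -> K) :
    (mf_hom S (ah_lincomb c' f : chom M N) : amod_hom _ _) x
    = (mf_hom S (combine : chom (mc_act V M) N) : amod_hom _ _)
        ((s' : amod_hom _ _) (tmap (weight c') id y)).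
  rewrite SE /=; congr (ah_fun _ _).
  rewrite -[LHS]s's; congr (ah_fun _ _).
  have /(congr1 (fun g : amod_hom _ _ => g
    ((mf_hom S (am_uniti (sval M) : chom M (mc_act K^o M)) : amod_hom _ _) x)))
    := mf_str_nat S (weight c') (cid M).
  by rewrite mf_hom1.
(* Each [f i] is a combination of the whole family, so both sides become values of the same two
   maps, and only the linearity of [weight] in the coefficients remains. *)
have fE i : f i = ah_lincomb (fun j => (j == i)%:R) f.
  apply: amod_hom_eq => m /=; rewrite (bigD1 i) //= eqxx scale1r.
  by rewrite big1 ?addr0 // => j /negPf ->; rewrite scale0r.
under eq_bigr => i _ do rewrite fE SxE.
rewrite SxE.
have [_ SZ _ SS] := Defs.linearE (ah_linear
  (mf_hom S (combine : chom (mc_act V M) N) : amod_hom _ _)).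
have [_ sZ _ sS] := Defs.linearE (ah_linear (s' : amod_hom _ _)).
under eq_bigr => i _ do rewrite -SZ -sZ.
rewrite -SS -sS; do 2 congr (ah_fun _ _).
rewrite /tmap /tlift; under [RHS]eq_bigr => i _ do rewrite scaler_sumr.
rewrite exchange_big; apply: eq_bigr => k _ /=.
have [_ pZ _ pS] := Defs.linearE (@pure_linearl K V (sval (S M)) (y k)).
under eq_bigr => i _ do rewrite -pZ.
rewrite -pS; congr pure; apply/ffunP=> i; rewrite weightE ffunE sum_ffunE.
rewrite (bigD1 i) //= !ffunE weightE ffunE eqxx mulr1 big1 ?addr0 => [|j ji].
  by rewrite mulrC.
rewrite !ffunE weightE ffunE eq_sym (negPf ji) mulr0.
exact: scaler0.
Qed.
End LinearCombination.
End Additivity.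

(** * Products of vector spaces over an arbitrary index type *)

Section DependentProduct.
Variables (K : fieldType) (I : Type) (M : I -> lmodType K).

(** The index type will be the group [G], possibly infinite, so finitely supported or finite
    functions would not do. *)
Definition dprod : Type := forall i, M i.

HB.instance Definition _ := gen_eqMixin dprod.
HB.instance Definition _ := gen_choiceMixin dprod.

Lemma dprodP (x y : dprod) : (forall i, x i = y i) -> x = y.
Proof. exact: functional_extensionality_dep. Qed.

Let addA : associative (fun x y : dprod => (fun i => x i + y i) : dprod).
Proof. by move=> x y z; apply: dprodP => i; rewrite addrA. Qed.
Let addC : commutative (fun x y : dprod => (fun i => x i + y i) : dprod).
Proof. by move=> x y; apply: dprodP => i; rewrite addrC. Qed.
Let add0 : left_id ((fun i => 0) : dprod) (fun x y => fun i => x i + y i).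
Proof. by move=> x; apply: dprodP => i; rewrite add0r. Qed.
Let addN : left_inverse ((fun i => 0) : dprod) (fun x => fun i => - x i)
  (fun x y => fun i => x i + y i).
Proof. by move=> x; apply: dprodP => i; rewrite addNr. Qed.

HB.instance Definition _ := GRing.isZmodule.Build dprod addA addC add0 addN.

Let scaleA (a b : K) (x : dprod) :
  (fun i => a *: (b *: x i)) = (fun i => (a * b) *: x i) :> dprod.
Proof. by apply: dprodP => i; rewrite scalerA. Qed.
Let scale1 : left_id 1 (fun (a : K) (x : dprod) => (fun i => a *: x i) : dprod).
Proof. by move=> x; apply: dprodP => i; rewrite scale1r. Qed.
Let scaleDr : right_distributive
  (fun (a : K) (x : dprod) => (fun i => a *: x i) : dprod) +%R.
Proof. by move=> a x y; apply: dprodP => i; rewrite scalerDr. Qed.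
Let scaleDl (x : dprod) :
  {morph (fun a : K => (fun i => a *: x i) : dprod) : a b / a + b}.
Proof. by move=> a b; apply: dprodP => i; rewrite scalerDl. Qed.

HB.instance Definition _ := GRing.Zmodule_isLmodule.Build K dprod
  scaleA scale1 scaleDr scaleDl.

Lemma dprodD (x y : dprod) i : (x + y) i = x i + y i. Proof. by []. Qed.
Lemma dprodZ (a : K) (x : dprod) i : (a *: x) i = a *: x i. Proof. by []. Qed.

Lemma dprod_sum (J : finType) (F : J -> dprod) i :
  (\sum_j F j) i = \sum_j F j i.
Proof. by elim/big_rec2: _ => //= j x y _ <-. Qed.

End DependentProduct.

(** * Coordinates in tensor products *)

Section TensorMap.
Variable K : fieldType.

(** For linear [e] this is [tmap] of the identity and [e], but it computes coordinate by coordinate.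
    It is used to evaluate tensors over a product at one index. *)
Definition tensor_map (V : vectType K) (N N' : lmodType K) (e : N -> N')
  (y : tensor V N) : tensor V N' := [ffun d => e (y d)].

Section Linear.
Variables (N N' : lmodType K) (e : N -> N').
Hypothesis e_linear : linear e.

Lemma tensor_map_linear V : linear (@tensor_map V _ _ e).
Proof. by move=> k x y; apply/ffunP=> d; rewrite !ffunE e_linear. Qed.

Lemma tensor_map_pure (V : vectType K) (v : V) m :
  tensor_map e (pure v m) = pure v (e m).
Proof.
by apply/ffunP=> d; rewrite !ffunE; have [_ -> _ _] := Defs.linearE e_linear.
Qed.

End Linear.

Lemma tensor_map_tmap (N N' P P' : lmodType K) (e : N -> N') (e' : P -> P')
    (V W : vectType K) (f : 'Hom(V, W)) (g : N -> P) (g' : N' -> P') y :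
  linear e -> linear e' -> linear g -> linear g' ->
  (forall x, e' (g x) = g' (e x)) ->
  tensor_map e' (tmap f g y) = tmap f g' (tensor_map e y).
Proof.
move=> le le' lg lg' gg'; have lf := lfun_linear f.
apply: (@tensor_ext K V N (tensor W P') (fun y => tensor_map e' (tmap f g y))
  (fun y => tmap f g' (tensor_map e y))) y => [||v m].
- exact: linear_comp (tensor_map_linear le' (V := W)) (tmap_linear lf lg).
- exact: linear_comp (tmap_linear lf lg') (tensor_map_linear le (V := V)).
- by rewrite tmap_pure // !tensor_map_pure // tmap_pure // gg'.
Qed.

Lemma tensor_map_tassoc (N N' : lmodType K) (e : N -> N') (U V : vectType K)
    (y : tensor (vtensor U V) N) : linear e ->
  tensor_map (tensor_map e (V := V)) (tassoc y) = tassoc (tensor_map e y).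
Proof.
move=> le; have leV := tensor_map_linear le (V := V).
apply: (@tensor_ext2 K U V N (tensor U (tensor V N'))
  (fun y => tensor_map (tensor_map e (V := V)) (tassoc y))
  (fun y => tassoc (tensor_map e y))) y => [||u v m].
- exact: linear_comp (tensor_map_linear leV (V := U)) (@tassoc_linear _ _ _ _).
- exact: linear_comp (@tassoc_linear _ _ _ _)
    (tensor_map_linear le (V := vtensor U V)).
- by rewrite tassoc_pure !tensor_map_pure // tassoc_pure.
Qed.

Lemma tensor_map_tunit (N N' : lmodType K) (e : N -> N') (y : tensor K^o N) :
  linear e -> e (tunit y) = tunit (tensor_map e y).
Proof.
move=> le; apply: (@tensor_ext K K^o N N' (fun y => e (tunit y))
  (fun y => tunit (tensor_map e y))) y => [||k m].
- exact: linear_comp le (@tunit_linear _ _).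
- exact: linear_comp (@tunit_linear _ _) (tensor_map_linear le (V := K^o)).
- by rewrite tensor_map_pure // !tunit_pure; have [_ -> _ _] := Defs.linearE le.
Qed.

Definition coord_hom (V : vectType K) (d : 'I_(\dim {:V})) : 'Hom(V, K^o) :=
  linfun (coord (vbasis {:V}) d : V -> K^o).

(** Expresses a coordinate through the structure maps of a module category alone, so that
    coordinates make sense in any module category and are respected by module functors. *)
Lemma tunit_coord (V : vectType K) (N : lmodType K) d (y : tensor V N) :
  tunit (tmap (coord_hom d) id y) = y d.
Proof.
have lc := lfun_linear (coord_hom d).
apply: (@tensor_ext K V N N (fun y => tunit (tmap (coord_hom d) id y))
  (fun y => y d)) y => [||v m].
- exact: linear_comp (@tunit_linear _ _) (tmap_linear lc (@id_linear _ _)).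
- by move=> k x y; rewrite !ffunE.
- by rewrite tmap_pure // tunit_pure ffunE lfunE.
Qed.

End TensorMap.

(** * Modules over the diagonal algebra *)

Section DiagonalModules.
Variables (K : fieldType) (n : nat).
Let B : algebra K := diag_algebra K n.

Definition diag_simple (i : 'I_n) : amodule B.
Proof.
refine (@AModule K B (K^o : lmodType K)
  (fun (a : {ffun 'I_n -> K}) (x : K^o) => a i * x : K^o) _ _ _ _).
- by move=> a b x; rewrite ffunE mulrDl.
- by move=> a x y; rewrite mulrDr.
- by move=> a b x; rewrite ffunE mulrA.
- by move=> k x; rewrite ffunE.
Defined.

Lemma diag_simple_finite i : finite_dimensional (diag_simple i).
Proof.
exists unit, (fun _ => 1 : K^o) => m; exists (fun _ => m).
by rewrite big_const card_unit /= addr0 /GRing.scale /= mulr1.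
Qed.

Definition diag_sum (I : finType) (t : I -> 'I_n) : amodule B.
Proof.
refine (@AModule K B ({ffun I -> K^o} : lmodType K)
  (fun (a : {ffun 'I_n -> K}) x => [ffun k => a (t k) * x k : K^o]) _ _ _ _).
- by move=> a b x; apply/ffunP=> k; rewrite !ffunE mulrDl.
- by move=> a x y; apply/ffunP=> k; rewrite !ffunE mulrDr.
- by move=> a b x; apply/ffunP=> k; rewrite !ffunE mulrA.
- by move=> c x; apply/ffunP=> k; rewrite !ffunE.
Defined.

Lemma diag_sum_finite I t : finite_dimensional (@diag_sum I t).
Proof.
exists I, (fun k => [ffun l => (l == k)%:R : K^o]) => m; exists m.
apply/ffunP=> l; rewrite sum_ffunE (bigD1 l) //= !ffunE eqxx.
rewrite big1 => [|k kl]; first by rewrite addr0 /GRing.scale /= mulr1.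
by rewrite !ffunE eq_sym (negPf kl) scaler0.
Qed.

Lemma diag_sum_direct I t :
  is_direct_sum (fun k => diag_simple (t k)) (@diag_sum I t).
Proof.
have ul k : linear (fun x : diag_simple (t k) =>
    [ffun l => if l == k then x else 0] : diag_sum t).
  move=> a x y; apply/ffunP=> l; rewrite !ffunE.
  by case: eqP => // _; rewrite scaler0 addr0.
have ua k a (x : diag_simple (t k)) :
    [ffun l => if l == k then am_act a x else 0] =
    am_act a ([ffun l => if l == k then x else 0] : diag_sum t) :> diag_sum t.
  by apply/ffunP=> l; rewrite !ffunE; case: eqP => [->|_] //; rewrite mulr0.
have vl k : linear (fun x : diag_sum t => x k : diag_simple (t k)).
  by move=> a x y; rewrite !ffunE.
have va k a (x : diag_sum t) :
    (am_act a x : {ffun I -> K^o}) k = am_act a (x k : diag_simple (t k)).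
  by rewrite ffunE.
exists (fun k => AmodHom (ul k) (ua k)), (fun k => AmodHom (vl k) (va k)).
split=> [k x | k l x kl | x] /=; first by rewrite ffunE eqxx.
  by rewrite ffunE eq_sym (negPf kl).
apply/ffunP=> l; rewrite sum_ffunE (bigD1 l) //= ffunE eqxx.
by rewrite big1 ?addr0 // => k kl; rewrite ffunE eq_sym (negPf kl).
Qed.

Lemma diag_simple_hom i (M : amodule B) (b : M) :
  (forall a : B, am_act a b = (a : {ffun _ -> _}) i *: b) ->
  exists u : amod_hom (diag_simple i) M, forall x, u x = (x : K) *: b.
Proof.
move=> ab.
have ul : linear (fun x : diag_simple i => (x : K) *: b).
  by move=> k x y; rewrite scalerDl scalerA.
have ua a (x : diag_simple i) :
    (am_act a x : K) *: b = am_act a ((x : K) *: b).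
  have [_ -> _ _] := Defs.linearE (@am_linear _ _ M a).
  by rewrite ab scalerA mulrC.
by exists (AmodHom ul ua).
Qed.

Let e (i : 'I_n) : B := [ffun j => (j == i)%:R].

Lemma diag_homogeneous i (M : amodule B) (b : M) (a : B) :
  am_act a (am_act (e i) b) = (a : {ffun _ -> _}) i *: am_act (e i) b.
Proof.
rewrite -am_in -!am_mul; congr am_act; apply/ffunP=> j; rewrite !ffunE.
by case: eqP => [->|] //; rewrite !mulr0.
Qed.

Section Decomposition.
Variable M : amodule B.

Let spans d (t : 'I_d -> 'I_n) (b : 'I_d -> M) : Prop :=
  (forall k (a : B), am_act a (b k) = (a : {ffun _ -> _}) (t k) *: b k) /\
  forall m, exists c : 'I_d -> K, m = \sum_k c k *: b k.

(** The idempotents [e i] sum to 1, so the components [e i b] of a spanning family still span. *)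
Lemma homogeneous_spanning_family : finite_dimensional M ->
  exists d (t : 'I_d -> 'I_n) (b : 'I_d -> M), spans t b.
Proof.
case=> I [b bP]; pose J : finType := ('I_n * I)%type.
exists #|J|, (fun k => (enum_val k).1).
exists (fun k => am_act (e (enum_val k).1) (b (enum_val k).2)).
split=> [k a | m]; first exact: diag_homogeneous.
have [c ->] := bP m; exists (fun k => c (enum_val k).2).
pose F (p : J) := c p.2 *: am_act (e p.1) (b p.2).
rewrite -(@big_enum_val _ _ _ J predT F) -(@pair_bigA _ _ _ _ _ (fun i k =>
  F (i, k))).
rewrite exchange_big; apply: eq_bigr => k _; rewrite /F /= -scaler_sumr.
congr (_ *: _); rewrite -[LHS]am_act1.
have -> : 1 = \sum_i e i.
  apply/ffunP=> i; rewrite sum_ffunE ffunE (bigD1 i) //= ffunE eqxx.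
  by rewrite big1 ?addr0 // => j ji; rewrite ffunE eq_sym (negPf ji).
elim/big_rec2: _ => [|i x y _ <-]; last exact: am_addl.
by rewrite -[0](rmorph0 (@alg_in K B)) am_in scale0r.
Qed.

Lemma diag_decomposition : finite_dimensional M ->
  exists (I : finType) (t : I -> 'I_n),
    is_direct_sum (fun k => diag_simple (t k)) M.
Proof.
(* A homogeneous spanning family of minimal size is a basis. *)
move/homogeneous_spanning_family => spanM.
have exP : exists d, `[< exists t b, @spans d t b >].
  by have [d spand] := spanM; exists d; apply/asboolP.
case: (ex_minnP exP) => d /asboolP[t [b [bt bP]]] dmin.
have free (c : 'I_d -> K) : \sum_k c k *: b k = 0 -> forall k, c k = 0.
  move=> c0 l; apply/eqP; apply: contraT => cl.
  case: d t b bt bP dmin c c0 l cl => [|d] t b bt bP dmin c c0 l cl.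
    by case: l cl.
  suff: (d.+1 <= d)%N by rewrite ltnn.
  apply: dmin; apply/asboolP; exists (t \o lift l), (b \o lift l).
  split=> [k|m] /=; first exact: bt.
  (* Subtracting [a l / c l] times the relation eliminates [b l], so the shorter family would still
     span. *)
  have [a ->] := bP m; exists (fun k =>
    a (lift l k) - a l / c l * c (lift l k)).
  transitivity (\sum_k a k *: b k - (a l / c l) *: \sum_k c k *: b k).
    by rewrite c0 scaler0 subr0.
  rewrite scaler_sumr -sumrB (bigD1_ord l) //= scalerA divfK // subrr add0r.
  by apply: eq_bigr => k _; rewrite scalerBl scalerA.
(* The coordinates are merely chosen; their linearity and equivariance follow from their
   uniqueness. *)
have [c cP] := boolp.choice bP.
have c_uniq a m : m = \sum_k a k *: b k -> a = c m.
  move=> ma; apply: funext => k; apply/eqP; rewrite -subr_eq0; apply/eqP.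
  move: k; apply: free; under eq_bigr => k _ do rewrite scalerBl.
  by rewrite sumrB -ma -cP subrr.
pose u k := sval (boolp.cid (diag_simple_hom (bt k))).
have uE k (x : K) : u k x = x *: b k :=
  svalP (boolp.cid (diag_simple_hom (bt k))) x.
have vl k : linear (fun m => c m k : diag_simple (t k)).
  move=> a x y; suff <- : (fun k => a * c x k + c y k) = c (a *: x + y) by [].
  apply: c_uniq; rewrite {1}[x]cP {1}[y]cP scaler_sumr -big_split.
  by apply: eq_bigr => l _; rewrite /= scalerDl scalerA.
have va k a m : c (am_act a m) k = am_act a (c m k : diag_simple (t k)).
  suff <- : (fun k => (a : {ffun _ -> _}) (t k) * c m k) = c (am_act a m) by [].
  apply: c_uniq; rewrite {1}[m]cP.
  have [_ aZ _ ->] := Defs.linearE (@am_linear _ _ M a).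
  by apply: eq_bigr => l _; rewrite aZ bt scalerA mulrC.
have cb k x l : c (x *: b k) l = if l == k then x else 0.
  suff <- : (fun l => if l == k then x else 0) = c (x *: b k) by [].
  apply: c_uniq; rewrite (bigD1 k) //= eqxx big1 ?addr0 // => j /negPf ->.
  by rewrite scale0r.
exists 'I_d, t, u, (fun k => AmodHom (vl k) (va k)).
split=> [k x | k l x kl | m] /=; rewrite ?uE ?cb ?eqxx //.
  by rewrite eq_sym (negPf kl).
by rewrite [RHS]cP; apply: eq_bigr => k _; rewrite uE.
Qed.

End Decomposition.

Lemma diag_simple_endo i (f : amod_hom (diag_simple i) (diag_simple i)) x :
  f x = (f (1 : K^o) : K) *: x.
Proof.
have [_ fZ _ _] := Defs.linearE (ah_linear f).
by rewrite -[x in LHS]mulr1 fZ /GRing.scale /= mulrC.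
Qed.

(** The idempotent [e i] acts as 1 on the source and as 0 on the target. *)
Lemma diag_simple_disjoint i j
    (f : amod_hom (diag_simple i) (diag_simple j)) x :
  i != j -> f x = 0.
Proof.
move=> ij; have := ah_act f (e i) x.
by rewrite /= !ffunE eqxx eq_sym (negPf ij) mul0r mul1r.
Qed.

End DiagonalModules.

(** * Semimatrix algebras *)

Section BlockAlgebra.
Variables (K : fieldType) (n : nat) (S : 'I_n -> lmodType K).

(** The product of the algebras of all linear endomorphisms of the [S i], which may have infinite
    dimension and therefore admit no description by matrices. *)
Record block_end := BlockEnd {
  be_fun :> forall i, S i -> S i;
  be_linear : forall i, linear (@be_fun i) }.

Lemma block_end_eq (a b : block_end) : (forall i x, a i x = b i x) -> a = b.
Proof.
case: a b => [a al] [b bl] /= ab; have {}ab : a = b.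
  by apply: functional_extensionality_dep => i; apply: funext => x; apply: ab.
by subst b; congr BlockEnd; apply: Prop_irrelevance.
Qed.

HB.instance Definition _ := gen_eqMixin block_end.
HB.instance Definition _ := gen_choiceMixin block_end.

Let zero : block_end.
Proof.
by exists (fun i x => 0) => i k x y; rewrite scaler0 addr0.
Defined.
Let opp (a : block_end) : block_end.
Proof.
by exists (fun i x => - a i x) => i k x y; rewrite be_linear opprD scalerN.
Defined.
Let add (a b : block_end) : block_end.
Proof.
exists (fun i x => a i x + b i x) => i k x y.
by rewrite !be_linear scalerDr addrACA.
Defined.
Let one : block_end.
Proof. by exists (fun i x => x) => i k x y. Defined.
Let mul (a b : block_end) : block_end.
Proof.
by exists (fun i x => a i (b i x)) => i k x y; rewrite !be_linear.
Defined.

Let addA : associative add.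
Proof. by move=> a b c; apply: block_end_eq => i x /=; rewrite addrA. Qed.
Let addC : commutative add.
Proof. by move=> a b; apply: block_end_eq => i x /=; rewrite addrC. Qed.
Let add0 : left_id zero add.
Proof. by move=> a; apply: block_end_eq => i x /=; rewrite add0r. Qed.
Let addN : left_inverse zero opp add.
Proof. by move=> a; apply: block_end_eq => i x /=; rewrite addNr. Qed.
Let mulA : associative mul.
Proof. by move=> a b c; apply: block_end_eq. Qed.
Let mul1 : left_id one mul.
Proof. by move=> a; apply: block_end_eq. Qed.
Let mulr_1 : right_id one mul.
Proof. by move=> a; apply: block_end_eq. Qed.
Let mulDl : left_distributive mul add.
Proof. by move=> a b c; apply: block_end_eq. Qed.
Let mulDr : right_distributive mul add.
Proof.
move=> a b c; apply: block_end_eq => i x /=.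
by have [-> _ _ _] := Defs.linearE (be_linear a (i := i)).
Qed.

HB.instance Definition _ := GRing.isPzRing.Build block_end
  addA addC add0 addN mulA mul1 mulr_1 mulDl mulDr.

Definition be_scalar (k : K) : block_end.
Proof.
exists (fun i x => k *: x) => i l x y.
by rewrite scalerDr !scalerA mulrC.
Defined.

Let be_scalar_additive : zmod_morphism be_scalar.
Proof. by move=> k l; apply: block_end_eq => i x; rewrite /= scalerBl. Qed.
Let be_scalar_monoid : GRing.monoid_morphism be_scalar.
Proof.
by split=> [|k l]; apply: block_end_eq => i x; rewrite /= ?scale1r ?scalerA.
Qed.

Let be_in : {rmorphism K -> block_end} := HB.pack be_scalar
  (GRing.isZmodMorphism.Build _ _ _ be_scalar_additive)
  (GRing.isMonoidMorphism.Build _ _ _ be_scalar_monoid).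

Let be_central k (a : block_end) : be_in k * a = a * be_in k.
Proof.
apply: block_end_eq => i x /=.
by have [_ -> _ _] := Defs.linearE (be_linear a (i := i)).
Qed.

Definition block_algebra : algebra K := Algebra be_central.

Definition block_module (i : 'I_n) : amodule block_algebra.
Proof.
refine (@AModule K block_algebra (S i) (fun a => (a : block_end) i)
  _ _ _ _) => //.
by move=> a x y; have [-> _ _ _] := Defs.linearE (be_linear a (i := i)).
Defined.

Lemma block_algebra_bij
    (f : forall i, {linear block_module i -> block_module i}) :
  exists! a : block_algebra, forall i (m : block_module i), am_act a m = f i m.
Proof.
have fl i : linear (f i) by move=> k x y; rewrite linearP.
exists (BlockEnd fl : block_algebra); split=> // a af;
  apply: block_end_eq => i x.
exact: esym (af i x).
Qed.

Definition block_semimatrix : semimatrix_algebra K :=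
  SemimatrixAlgebra block_algebra_bij.

Lemma be_block (i : 'I_n) (f : S i -> S i) : linear f ->
  exists a : block_algebra, (forall x, (a : block_end) i x = f x) /\
    forall j x, j != i -> (a : block_end) j x = 0.
Proof.
move=> fl; pose g := dfwith (fun k _ => 0 : S k) f.
have gi : g i = f by rewrite /g dfwith_in.
have gj j x : j != i -> g j x = 0 by move=> ji; rewrite /g dfwith_out // eq_sym.
have gl j : linear (g j).
  have [->|ji] := eqVneq j i; first by rewrite gi.
  by move=> k x y; rewrite !gj // scaler0 addr0.
by exists (BlockEnd gl); split=> [x|//] /=; rewrite gi.
Qed.

(** Supplies the functionals of rank-one operators. In a product of finite-dimensional spaces a
    coordinate serves, so no basis of [S i] has to be chosen. *)
Hypothesis S_separated : forall i (x : S i), x != 0 ->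
  exists l : S i -> K^o, linear l /\ l x = 1.

(* The twisted module contains a vector [s] fixed by a minimal idempotent [e];
   the idempotent [g^-1 e] fixes some vector [x0] of some [S i], and
   [g a s |-> a x0] is the isomorphism. *)
Lemma block_module_twist (g : alg_aut block_algebra) (j : 'I_n) (s : S j) :
  s != 0 -> exists i, amod_iso (am_twist g (block_module j)) (block_module i).
Proof.
move=> s_neq0; pose is_rank1 i (l : S i -> K^o) (r : S i -> block_algebra) :=
  forall y, (forall x, (r y : block_end) i x = l x *: y) /\
    forall k x, k != i -> (r y : block_end) k x = 0.
have rank1 i (l : S i -> K^o) : linear l ->
    exists r, is_rank1 i l r.
  move=> ll; suff /boolp.choice[r rP] : forall y, exists a : block_algebra,
      (forall x, (a : block_end) i x = l x *: y) /\
      forall k x, k != i -> (a : block_end) k x = 0 by exists r.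
  by move=> y; apply: be_block => k x z; rewrite ll scalerDl scalerA.
(* By this equivariance [r] maps the module [S i] onto a left ideal of the algebra, which the
   automorphism [g] can act on. *)
have rank1_mul i (l : S i -> K^o) (r : S i -> block_algebra) :
    is_rank1 i l r ->
    forall a y, r ((a : block_end) i y) = a * r y.
  move=> rP a y; apply: block_end_eq => k.
  have [_ aZ a0 _] := Defs.linearE (be_linear a (i := k)).
  have [ki|ki] := eqVneq k i => x /=; last by rewrite !(rP _).2 // a0.
  by subst k; rewrite !(rP _).1 aZ.
have rank1_lin i (l : S i -> K^o) (r : S i -> block_algebra) :
    is_rank1 i l r ->
    forall a y z, r (a *: y + z) = (alg_in a : block_algebra) * r y + r z.
  move=> rP a y z; apply: block_end_eq => k.
  have [->|ki] := eqVneq k i => x /=; last by rewrite !(rP _).2 // scaler0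
    addr0.
  by rewrite !(rP _).1 scalerDr !scalerA mulrC.
have [l [ll ls]] := S_separated s_neq0.
have [r rP] := rank1 j l ll.
have rs y : (r y : block_end) j s = y by rewrite (rP y).1 ls scale1r.
have g_inj : injective g := can_inj (aut_funK g).
have g0 : g 0 = 0 by apply: (@addrI _ (g 0)); rewrite -aut_add !addr0.
(* As [r s] fixes [s], one has [r s * r s = r s], and [e'] inherits idempotency. *)
pose e' := aut_inv g (r s).
have ge' : g e' = r s by rewrite /e' aut_invK.
have e'e' : e' * e' = e'.
  by apply: g_inj; rewrite aut_mul !ge' -(rank1_mul _ _ _ rP) rs.
have [i [x0 [x0_neq0 e'x0]]] :
    exists i (x0 : S i), x0 != 0 /\ (e' : block_end) i x0 = x0.
  have [[i [x xP]]|no] := pselect (exists i (x : S i),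
    (e' : block_end) i x != 0).
    exists i, ((e' : block_end) i x); split=> //.
    by rewrite -[in RHS]e'e'.
  case/eqP: s_neq0; rewrite -(rs s) -ge'.
  suff -> : e' = 0 by rewrite g0.
  apply: block_end_eq => i x; apply: contrapT => /eqP ex; apply: no.
  by exists i, x.
have [m [ml mx0]] := S_separated x0_neq0.
have [t tP] := rank1 i m ml.
have tx x : (t x : block_end) i x0 = x by rewrite (tP x).1 mx0 scale1r.
have f_lin : linear (fun y : am_twist g (block_module j) =>
    (aut_inv g (r y) : block_end) i x0 : block_module i).
  move=> a y z; have -> : aut_inv g (r (a *: y + z))
      = alg_in a * aut_inv g (r y) + aut_inv g (r z).
    apply: g_inj; rewrite aut_invK aut_add aut_mul aut_in !aut_invK.
    exact: rank1_lin.
  by [].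
have f_act a (y : am_twist g (block_module j)) :
    (aut_inv g (r (am_act a y)) : block_end) i x0 =
    am_act a ((aut_inv g (r y) : block_end) i x0 : block_module i).
  have -> : aut_inv g (r (am_act a y)) = a * aut_inv g (r y).
    apply: g_inj; rewrite aut_mul !aut_invK.
    exact: rank1_mul.
  by [].
have h_lin : linear (fun x : block_module i =>
    (g (t x) : block_end) j s : am_twist g (block_module j)).
  move=> a x z; rewrite (rank1_lin _ _ _ tP) aut_add aut_mul aut_in.
  by [].
have h_act a (x : block_module i) : (g (t (am_act a x)) : block_end) j s =
    am_act a ((g (t x) : block_end) j s : am_twist g (block_module j)).
  by rewrite (rank1_mul _ _ _ tP) aut_mul.
have fh (x : S i) : (aut_inv g (r ((g (t x) : block_end) j s)) :
  block_end) i x0 = x.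
  have -> : aut_inv g (r ((g (t x) : block_end) j s)) = t x * e'.
    by apply: g_inj; rewrite aut_invK aut_mul ge' -(rank1_mul _ _ _ rP).
  by rewrite /= e'x0 tx.
(* The composite sends [y] to [r y] applied to a fixed vector, and [r y] has rank one with image
   spanned by [y]; hence it is a scalar independent of [y]. *)
have hf0 : exists c : K, forall y,
    (g (t ((aut_inv g (r y) : block_end) i x0)) : block_end) j s = c *: y.
  exists (l ((g (t x0) : block_end) j s)) => y.
  rewrite (rank1_mul _ _ _ tP) aut_mul aut_invK.
  exact: (rP y).1.
exists i, (AmodHom f_lin f_act), (AmodHom h_lin h_act); split=> [y|x] /=;
  last exact: fh.
(* Write [f] and [h] for the two maps. Since [f s = e' x0 = x0], the identity [f (h x0) = x0] reads
   [f (c s) = x0], that is [c x0 = x0]. *)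
have [c hf] := hf0; suff c1 : c = 1 by rewrite hf c1 scale1r.
have := fh x0; rewrite -{1}e'x0 -/e' hf => cs.
have [_ fZ _ _] := Defs.linearE f_lin.
have /eqP := cs; rewrite fZ -/e' e'x0 -{2}[x0]scale1r -subr_eq0 -scalerBl.
by rewrite scaler_eq0 (negPf x0_neq0) orbF subr_eq0 => /eqP.
Qed.

End BlockAlgebra.

(** * The fibre functor of a family of module functors *)

Section FibreFunctor.
Variables (K : fieldType) (n : nat) (C : module_category K) (I : Type).
Let D : module_category K := diag_modules K n.
Variable T : I -> module_functor C D.
Hypothesis T_faithful :
  exists i, forall M N : C, injective (@mf_hom _ _ _ (T i) M N).
(** Here [E] goes from [K^n]-modules to [C]: it will be the quasi-inverse of the equivalence that
    enters the family [T], where [T g] is [R g] followed by that equivalence. *)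
Variable E : module_functor D C.
Hypothesis E_equiv : @equivalence1 (module_categories K) D C E.

Definition fib (M : C) : lmodType K :=
  dprod (fun i => am_space (sval (T i M))).

Definition fib_map (M N : C) (f : chom M N) (x : fib M) : fib N :=
  fun i => (mf_hom (T i) f : amod_hom _ _) (x i).

Lemma fib_map_linear M N (f : chom M N) : linear (fib_map f).
Proof. by move=> k x y; apply: dprodP => i; apply: ah_linear. Qed.

Lemma fib_map1 M x : fib_map (cid M) x = x.
Proof. by apply: dprodP => i; rewrite /fib_map mf_hom1. Qed.

Lemma fib_mapM M N L (g : chom N L) (f : chom M N) x :
  fib_map (g \c f) x = fib_map g (fib_map f x).
Proof. by apply: dprodP => i; rewrite /fib_map mf_homM. Qed.

(** Although [C] has no sums of morphisms, [E] followed by [T i] goes between categories of modules,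
    where module functors are linear. *)
Lemma fib_map_lincomb (M N : D) (J : finType) (c : J -> K)
    (f : J -> amod_hom (sval M) (sval N)) x :
  fib_map (mf_hom E (ah_lincomb c f : chom M N)) x
  = \sum_j c j *: fib_map (mf_hom E (f j : chom M N)) x.
Proof.
apply: dprodP => i; rewrite dprod_sum.
exact: (mf_hom_lincomb (S := mf_comp E (T i)) f c (x i)).
Qed.

(** * Simple objects and the action of the algebra on fibres *)

Definition simple_ob (j : 'I_n) : D :=
  exist _ (diag_simple K j) (diag_simple_finite K j).

Let L (j : 'I_n) : C := E (simple_ob j).

(* The natural endomorphisms of [fib], which range over all the objects of [C],
   would not fit in the universe of the modules; restricting them to the simple
   objects loses nothing, by [fib_act_extend] and [fib_act_inj]. *)
Definition fib_algebra : semimatrix_algebra K :=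
  block_semimatrix (fun j => fib (L j)).

Let A := fib_algebra.
Let block (a : A) (j : 'I_n) : fib (L j) -> fib (L j) :=
  be_fun (a : block_end _) (i := j).

Let block_linear a j : linear (@block a j).
Proof. exact: be_linear. Qed.

Lemma fib_map_disjoint j k (w : chom (L j) (L k)) x : j != k -> fib_map w x = 0.
Proof.
move=> jk; have [w' <-] := equivalence1_full E_equiv w.
have -> : w' = ah_lincomb (fun _ : void => 0) (fun _ => w').
  apply: amod_hom_eq => y; rewrite [LHS](diag_simple_disjoint w' y jk) /=.
  by rewrite big1 // => - [].
by rewrite fib_map_lincomb big1 // => - [].
Qed.

Lemma fib_map_endo j (w : chom (L j) (L j)) :
  exists c : K, forall x, fib_map w x = c *: x.
Proof.
have [w' <-] := equivalence1_full E_equiv w.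
pose c : K := (w' : amod_hom (diag_simple K j) (diag_simple K j)) (1 : K^o).
exists c => x.
have -> : w' = ah_lincomb (fun _ : unit => c) (fun _ =>
  ah_id (diag_simple K j)).
  apply: amod_hom_eq => y; rewrite [LHS](diag_simple_endo w' y) /=.
  by rewrite big_const card_unit /= addr0.
rewrite fib_map_lincomb big_const card_unit /= addr0; congr (_ *: _).
by rewrite -[ah_id _]/(cid (simple_ob j)) mf_hom1 fib_map1.
Qed.

(** Schur's lemma: morphisms between simple objects act on fibres as zero or as scalars. So an
    arbitrary family of linear endomorphisms of the simple fibres is already natural. *)
Lemma fib_map_block a j k (w : chom (L j) (L k)) x :
  fib_map w (block a x) = block a (fib_map w x).
Proof.
have [_ aZ a0 _] := Defs.linearE (block_linear a (j := k)).
have [jk|jk] := eqVneq j k; last by rewrite !fib_map_disjoint ?a0.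
by subst k; have [c cw] := fib_map_endo w; rewrite !cw aZ.
Qed.

(** Orthogonality and completeness involve zero morphisms and sums, so they are required on the
    fibres only. *)
Record decomposition (M : C) := Decomposition {
  dec_I : finType;
  dec_t : dec_I -> 'I_n;
  dec_u : forall k, chom (L (dec_t k)) M;
  dec_v : forall k, chom M (L (dec_t k));
  dec_vu : forall k, dec_v k \c dec_u k = cid _;
  dec_vu0 : forall k l, k != l -> forall x, fib_map (dec_v l \c dec_u k) x = 0;
  dec_uv : forall x, \sum_k fib_map (dec_u k \c dec_v k) x = x }.

Arguments dec_u {M} d k : rename.
Arguments dec_v {M} d k : rename.

Lemma simple_decomposition (N : D) (J : finType) (t : J -> 'I_n) :
  is_direct_sum (fun k => diag_simple K (t k)) (sval N) ->
  exists (u : forall k, chom (simple_ob (t k)) N)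
    (v : forall k, chom N (simple_ob (t k))),
    [/\ forall k, mf_hom E (v k) \c mf_hom E (u k) = cid _,
      forall k l, k != l ->
        forall x, fib_map (mf_hom E (v l) \c mf_hom E (u k)) x = 0
    & forall x, \sum_k fib_map (mf_hom E (u k) \c mf_hom E (v k)) x = x].
Proof.
case=> u [v [uK uv0 uv]]; exists u, v; split.
- move=> k; rewrite -mf_homM -mf_hom1; congr (mf_hom E _).
  by apply: amod_hom_eq => x; apply: uK.
- move=> k l kl x; rewrite -mf_homM.
  have -> :
      (v l : chom N (simple_ob (t l))) \c (u k : chom (simple_ob (t k)) N)
      = ah_lincomb (fun _ : void => 0) (fun _ => ah_comp (v l) (u k)).
    apply: amod_hom_eq => y; rewrite [RHS]big1; last by case.
    exact: uv0.
  by rewrite fib_map_lincomb big1 // => - [].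
- move=> x; rewrite -[RHS]fib_map1 -(mf_hom1 E).
  have -> : cid N = ah_lincomb (fun _ => 1) (fun k => ah_comp (u k) (v k)).
    apply: amod_hom_eq => y /=; rewrite -[LHS]uv.
    by apply: eq_bigr => k _; rewrite scale1r.
  rewrite fib_map_lincomb; apply: eq_bigr => k _; rewrite scale1r.
  by rewrite -mf_homM.
Qed.

Lemma decomposition_exists (M : C) : exists d : decomposition M, True.
Proof.
have [N [f [f' [f'f ff']]]] := equivalence1_surj E_equiv M.
have [J [t /simple_decomposition[u [v [vu vu0 uv]]]]] :=
  diag_decomposition (svalP N).
unshelve eexists; last exact.
refine (@Decomposition M J t (fun k => f \c mf_hom E (u k))
  (fun k => mf_hom E (v k) \c f') _ _ _).
- by move=> k; rewrite -ccompA (ccompA f') f'f ccomp1l; apply: vu.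
- by move=> k l kl x; rewrite -ccompA (ccompA f') f'f ccomp1l; apply: vu0.
- move=> x; rewrite -[RHS]fib_map1 -ff' fib_mapM.
  rewrite -[in RHS](uv (fib_map f' x)).
  have [_ _ _ ->] := Defs.linearE (fib_map_linear f).
  by apply: eq_bigr => k _; rewrite -!fib_mapM !ccompA.
Qed.

Definition dec (M : C) : decomposition M :=
  sval (boolp.cid (decomposition_exists M)).

Definition fib_act (a : A) (M : C) (x : fib M) : fib M :=
  \sum_k fib_map (dec_u (dec M) k) (block a (fib_map (dec_v (dec M) k) x)).

Lemma fib_act_linear a M : linear (@fib_act a M).
Proof.
move=> k x y; rewrite scaler_sumr -big_split; apply: eq_bigr => l _.
by rewrite fib_map_linear block_linear fib_map_linear.
Qed.

Lemma fib_act_nat a M N (f : chom M N) x :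
  fib_map f (fib_act a x) = fib_act a (fib_map f x).
Proof.
rewrite /fib_act; have [_ _ _ ->] := Defs.linearE (fib_map_linear f).
(* Decomposing both objects turns [f] into a matrix of morphisms between simple objects, and these
   commute with the blocks. *)
transitivity (\sum_k \sum_l fib_map (dec_u (dec N) l)
  (fib_map (dec_v (dec N) l \c f \c dec_u (dec M) k)
    (block a (fib_map (dec_v (dec M) k) x)))).
  apply: eq_bigr => k _; rewrite -[LHS](dec_uv (dec N)).
  by apply: eq_bigr => l _; rewrite !fib_mapM.
rewrite exchange_big; apply: eq_bigr => l _.
rewrite -[x in RHS](dec_uv (dec M)).
have [_ _ _ ->] := Defs.linearE (fib_map_linear f).
have [_ _ _ ->] := Defs.linearE (fib_map_linear (dec_v (dec N) l)).
have [_ _ _ ->] := Defs.linearE (block_linear a (j := dec_t l)).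
have [_ _ _ ->] := Defs.linearE (fib_map_linear (dec_u (dec N) l)).
by apply: eq_bigr => k _; rewrite fib_map_block -!fib_mapM -!ccompA.
Qed.

(** The chosen decomposition of [L j] need not be the identity, so this again rests on
    [fib_map_block]. *)
Lemma fib_act_simple a j (x : fib (L j)) : fib_act a x = block a x.
Proof.
rewrite -[x in RHS](dec_uv (dec (L j))).
have [_ _ _ ->] := Defs.linearE (block_linear a (j := j)).
by apply: eq_bigr => k _; rewrite fib_mapM fib_map_block.
Qed.

Definition fib_module (M : C) : amodule A.
Proof.
refine (@AModule K A (fib M) (fun a => @fib_act a M) _ _ _ _).
- move=> a b x; rewrite /fib_act -big_split; apply: eq_bigr => k _ /=.
  by have [<- _ _ _] := Defs.linearE (fib_map_linear (dec_u (dec M) k)).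
- by move=> a x y; have [-> _ _ _] := Defs.linearE (@fib_act_linear a M).
- move=> a b x; rewrite [fib_act b x]/fib_act.
  have [_ _ _ ->] := Defs.linearE (@fib_act_linear a M).
  by apply: eq_bigr => k _; rewrite -fib_act_nat fib_act_simple.
- move=> k x; rewrite -[x in RHS](dec_uv (dec M)) scaler_sumr.
  apply: eq_bigr => l _; rewrite fib_mapM.
  by have [_ <- _ _] := Defs.linearE (fib_map_linear (dec_u (dec M) l)).
Defined.

Lemma fib_act_extend (b : forall M, fib M -> fib M) :
  (forall M, linear (@b M)) ->
  (forall M N (f : chom M N) x, fib_map f (b M x) = b N (fib_map f x)) ->
  exists a : A, forall M x, fib_act a x = b M x.
Proof.
move=> bl bn; exists (BlockEnd (fun j => bl (L j))) => M x.
rewrite -[x in RHS](dec_uv (dec M)); have [_ _ _ ->] := Defs.linearE (bl M).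
by apply: eq_bigr => k _; rewrite fib_mapM -bn.
Qed.

Lemma fib_act_inj (a b : A) :
  (forall M (x : fib M), fib_act a x = fib_act b x) -> a = b.
Proof.
by move=> ab; apply: block_end_eq => j x; have := ab _ x;
  rewrite !fib_act_simple.
Qed.

Lemma fib_map_act M N (f : chom M N) a (x : fib_module M) :
  fib_map f (am_act a x) = am_act a (fib_map f x : fib_module N).
Proof. exact: fib_act_nat. Qed.

Definition fib_hom M N (f : chom M N) :
  amod_hom (fib_module M) (fib_module N) :=
  @AmodHom _ _ (fib_module M) (fib_module N) (fib_map f) (fib_map_linear f)
    (fib_map_act f).

Definition fib_simple_in M j (w : chom (L j) M) :
  amod_hom (block_module (fun j => fib (L j)) j : amodule A) (fib_module M).
Proof.
exists (fib_map w : block_module _ j -> fib_module M);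
  first exact: fib_map_linear.
by move=> a x; rewrite -fib_map_act /= fib_act_simple.
Defined.

Definition fib_simple_out M j (w : chom M (L j)) :
  amod_hom (fib_module M) (block_module (fun j => fib (L j)) j : amodule A).
Proof.
exists (fib_map w : fib_module M -> block_module _ j);
  first exact: fib_map_linear.
by move=> a x; rewrite fib_map_act /= fib_act_simple.
Defined.

Lemma fib_sm_module M : sm_module (fib_module M).
Proof.
exists (dec_I (dec M)), (fun k => sm_S (s := A) (dec_t (d := dec M) k)); split.
  move=> k; exists (dec_t k), 1%g.
  pose N : amodule A := sm_S (s := A) (dec_t k).
  exists (@AmodHom _ _ N (am_twist 1%g N) id (@id_linear _ _) (fun _ _ =>
    erefl)).
  by exists (@AmodHom _ _ (am_twist 1%g N) N id (@id_linear _ _) (fun _ _ =>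
    erefl)).
exists (fun k => fib_simple_in (dec_u (dec M) k)).
exists (fun k => fib_simple_out (dec_v (dec M) k)).
split=> [k x | k l x kl | x] /=.
- by rewrite -fib_mapM dec_vu fib_map1.
- by rewrite -fib_mapM dec_vu0.
- by rewrite -[RHS](dec_uv (dec M)); apply: eq_bigr => k _; rewrite fib_mapM.
Qed.

(** * Compatibility of the fibres with tensor products *)

Let ev (M : C) i (x : fib M) : sval (T i M) := x i.
Let ev_linear M i : linear (@ev M i). Proof. by []. Qed.

(** Reduces the axioms of the tensor constraint to a single index [i], where they are those of
    [T i]. *)
Lemma tensor_ev_inj V M (x y : tensor V (fib M)) :
  (forall i, tensor_map (@ev M i) x = tensor_map (@ev M i) y) -> x = y.
Proof.
move=> xy; apply/ffunP=> d; apply: dprodP => i.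
by have /ffunP/(_ d) := xy i; rewrite !ffunE.
Qed.

Definition fib_str V M (x : fib (mc_act V M)) : tensor V (fib M) :=
  [ffun d => (fun i =>
    ((mf_str (T i) V M : amod_hom _ _) (x i) : tensor V (sval (T i M))) d) :
      fib M].

Lemma fib_strE V M (x : fib (mc_act V M)) i :
  tensor_map (@ev M i) (fib_str x) = (mf_str (T i) V M : amod_hom _ _) (x i).
Proof. by apply/ffunP=> d; rewrite !ffunE. Qed.

Lemma fib_str_linear V M : linear (@fib_str V M).
Proof.
move=> k x y; apply/ffunP=> d; rewrite !ffunE; apply: dprodP => i.
by rewrite dprodD dprodZ ah_linear !ffunE.
Qed.

(* The coordinates of the tensor constraint come from morphisms of [C], so they
   commute with the action of the algebra. *)
Lemma fib_str_coord V M (x : fib (mc_act V M)) d :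
  fib_str x d = fib_map (mc_unit M \c mc_map (coord_hom d) (cid M)) x.
Proof.
apply: dprodP => i; rewrite ffunE -tunit_coord fib_mapM /fib_map.
rewrite -(mf_str_unit (T i) M) /=; congr tunit.
have /(congr1 (fun h : amod_hom _ _ => h (x i))) :=
  mf_str_nat (T i) (coord_hom d) (cid M).
by rewrite mf_hom1.
Qed.

Lemma fib_str_act V M a (x : fib_module (mc_act V M)) :
  fib_str (am_act a x) = am_act a (fib_str x : am_tensor V (fib_module M)).
Proof. by apply/ffunP=> d; rewrite [RHS]ffunE !fib_str_coord fib_map_act. Qed.

Lemma fib_str_inj V M : injective (@fib_str V M).
Proof.
move=> x y xy; apply: dprodP => i.
have [s [sK _]] := mf_str_inv (T i) V M.
have {}sK z : (s : amod_hom _ _) ((mf_str (T i) V M : amod_hom _ _) z) = z.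
  by have /(congr1 (fun h : amod_hom _ _ => h z)) := sK.
by rewrite -[x i]sK -fib_strE xy fib_strE sK.
Qed.

Lemma fib_str_surj V M (y : tensor V (fib M)) : exists x, fib_str x = y.
Proof.
pose s i : amod_hom (sval (mc_act V (T i M))) (sval (T i (mc_act V M))) :=
  sval (boolp.cid (mf_str_inv (T i) V M)).
have sK i z : (mf_str (T i) V M : amod_hom _ _) (s i z) = z.
  have [_ /(congr1 (fun h : amod_hom _ _ => h z))] :=
    svalP (boolp.cid (mf_str_inv (T i) V M)).
  by [].
exists (fun i => s i (tensor_map (@ev M i) y)).
by apply: tensor_ev_inj => i; rewrite fib_strE sK.
Qed.

Definition fib_functor : module_functor C (sm_modules A).
Proof.
refine (@ModuleFunctor K C (sm_modules A)
  (fun M => exist (@sm_module K A) (fib_module M) (fib_sm_module M))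
  (fun M N f => fib_hom f)
  (fun V M => @AmodHom _ _
     (fib_module (mc_act V M)) (am_tensor V (fib_module M))
     (@fib_str V M) (@fib_str_linear V M) (@fib_str_act V M))
  _ _ _ _ _ _).
- by move=> M; apply: amod_hom_eq => x; apply: fib_map1.
- by move=> M N P g f; apply: amod_hom_eq => x; apply: fib_mapM.
- move=> V M; pose s y := sval (boolp.cid (@fib_str_surj V M y)).
  have sK y : fib_str (s y) = y := svalP (boolp.cid (@fib_str_surj V M y)).
  apply: (@amod_hom_invertible K A (@sm_module K A)
    (exist _ (fib_module (mc_act V M)) (fib_sm_module (mc_act V M)))
    (exist _ (am_tensor V (fib_module M))
       (sm_module_tensor V (fib_sm_module M)))
    _ s) => // x /=.
  by apply: fib_str_inj; rewrite sK.
- move=> V W M N f g; apply: amod_hom_eq => x /=.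
  apply: tensor_ev_inj => i; rewrite fib_strE.
  rewrite (@tensor_map_tmap _ _ _ _ _ (@ev M i) (@ev N i) _ _ f (fib_map g)
    (mf_hom (T i) g : amod_hom _ _)) // ?fib_strE;
      [|exact: fib_map_linear|exact: ah_linear].
  by have /(congr1 (fun h : amod_hom _ _ => h (x i))) := mf_str_nat (T i) f g.
- move=> V W M; apply: amod_hom_eq => x /=.
  have ee (y z : tensor V (tensor W (fib M))) : (forall i,
     tensor_map (tensor_map (@ev M i) (V := W)) y
     = tensor_map (tensor_map (@ev M i) (V := W)) z) -> y = z.
    move=> yz; apply/ffunP=> d; apply: tensor_ev_inj => i.
    by have /ffunP/(_ d) := yz i; rewrite !ffunE.
  apply: ee => i; have le := tensor_map_linear (@ev_linear M i) (V := W).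
  rewrite tensor_map_tassoc // fib_strE.
  rewrite (@tensor_map_tmap _ _ _ _ _ (@ev (mc_act W M) i) _ _ _ _
    (@fib_str W M)
    (mf_str (T i) W M : amod_hom _ _)) // ?fib_strE.
  + by have /(congr1 (fun h : amod_hom _ _ => h (x i))) :=
      mf_str_assoc (T i) V W M.
  + exact: fib_str_linear.
  + exact: ah_linear.
  + by move=> z; exact: (fib_strE z i).
- move=> M; apply: amod_hom_eq => x /=; apply: dprodP => i.
  rewrite -[LHS]/(@ev M i _) tensor_map_tunit // fib_strE.
  by have /(congr1 (fun h : amod_hom _ _ => h (x i))) := mf_str_unit (T i) M.
Defined.

(** * The fibre functor is an equivalence *)

Lemma fib_map_inj M N (f g : chom M N) :
  (forall x, fib_map f x = fib_map g x) -> f = g.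
Proof.
case: T_faithful => i Ti fg; apply: Ti; apply: amod_hom_eq => y.
(* The vector [y] of the faithful factor [i], extended by 0; equality of indices is decided
   classically, hence the cast. *)
pose x : fib M := fun j => if pselect (i = j) is left e then
  ecast k (sval (T k M)) e y else 0.
have -> : y = x i.
  by rewrite /x; case: pselect => // e; rewrite (Prop_irrelevance e erefl).
exact: (congr1 (fun z : fib N => z i) (fg x)).
Qed.

(** With zero fibre, the identity of the simple module and the zero morphism would have the same
    image under a faithful functor. *)
Lemma fib_simple_neq0 j : exists s : fib (L j), s != 0.
Proof.
apply: contrapT => no; have E_inj := equivalence1_faithful E_equiv.
suff : cid (simple_ob j)
    = ah_lincomb (fun _ : void => 0) (fun _ => ah_id (diag_simple K j)).
  move/(congr1 (fun f : amod_hom (diag_simple K j) (diag_simple K j) =>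
    f (1 : K^o))); rewrite /= big1 => [|[]].
  by move/eqP; rewrite oner_eq0.
apply: E_inj; apply: fib_map_inj => x.
rewrite mf_hom1 fib_map1 fib_map_lincomb big1 => [|[]//].
by apply: contrapT => /eqP ?; apply: no; exists x.
Qed.

Lemma fib_separated M (x : fib M) : x != 0 ->
  exists l : fib M -> K^o, linear l /\ l x = 1.
Proof.
move=> x_neq0.
have [i xi] : exists i, x i != 0.
  apply: contrapT => no; case/eqP: x_neq0; apply: dprodP => i.
  by apply: contrapT => /eqP xi; apply: no; exists i.
have [J [t [u [v [_ _ uv]]]]] := diag_decomposition (svalP (T i M)).
have [k vk] : exists k, v k (x i) != 0.
  apply: contrapT => no; case/eqP: xi; rewrite -(uv (x i)) big1 // => k _.
  have [_ _ u0 _] := Defs.linearE (ah_linear (u k)).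
  rewrite (_ : v k (x i) = 0) //; apply: contrapT => /eqP vk; apply: no.
  by exists k.
exists (fun y => (v k (x i) : K)^-1 *: v k (y i)); split.
  move=> a y z; rewrite ah_linear scalerDr !scalerA mulrC.
  by [].
by rewrite /GRing.scale /= mulVf.
Qed.

(** For distinct blocks, the unit of block [j] acts as 1 on the source and 0 on the target, so [h]
    vanishes. On one block [h] commutes with all rank-one operators, hence is a scalar. *)
Lemma fib_block_hom j k (h : fib (L j) -> fib (L k)) : linear h ->
  (forall a x, h (block a x) = block a (h x)) ->
  exists w : chom (simple_ob j) (simple_ob k), forall x,
    h x = fib_map (mf_hom E w) x.
Proof.
move=> lh ha; have [_ hZ h0 _] := Defs.linearE lh.
have zero_hom : (forall x, h x = 0) ->
    exists w : chom (simple_ob j) (simple_ob k), forall x,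
      h x = fib_map (mf_hom E w) x.
  move=> {}h0; have zl : linear (fun x : diag_simple K j =>
    0 : diag_simple K k).
    by move=> c x y; rewrite scaler0 addr0.
  have za a (x : diag_simple K j) : 0 = am_act a (0 : diag_simple K k).
    by have [_ _ -> _] := Defs.linearE (@am_linear _ _ (diag_simple K k) a).
  pose z := AmodHom zl za; exists (ah_lincomb (fun _ : void => 0) (fun _ =>
    z)) => x.
  by rewrite fib_map_lincomb big1 ?h0 // => - [].
have [jk|jk] := eqVneq j k; last first.
  apply: zero_hom => x.
  have [a [aj ak]] :=
    be_block (S := fun j => fib (L j)) (@id_linear _ (fib (L j))).
  by rewrite -[x]aj [LHS]ha [LHS]ak // eq_sym.
subst k; have [s s_neq0] := fib_simple_neq0 j.
have [l [ll ls]] := fib_separated s_neq0.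
(* The scalar is found from the operator that sends [z] to [l z *: x]: applied at [s], where
   [l s = 1], it gives [h x = l (h s) *: x]. *)
exists (ah_lincomb (fun _ : unit => l (h s) : K) (fun _ =>
  ah_id (diag_simple K j))).
move=> x; rewrite fib_map_lincomb big_const card_unit /= addr0.
rewrite -[ah_id _]/(cid (simple_ob j)) mf_hom1 fib_map1.
have rl (y : fib (L j)) : linear (fun z : fib (L j) => (l z : K) *: y).
  by move=> c z z'; rewrite ll scalerDl scalerA.
have hr (y z : fib (L j)) : h ((l z : K) *: y) = (l (h z) : K) *: y.
  have [a [aj _]] := be_block (S := fun j => fib (L j)) (rl y).
  by rewrite -aj [LHS]ha [LHS]aj.
by rewrite -[x in LHS]scale1r -ls hr.
Qed.

(** The matrix entries of [b] between simple fibres come from morphisms of [D]. They are reassembled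
    in [D], where they can be added, and only then carried to [C]; this is why [M] and [N] are first
    replaced by images of objects of [D]. *)
Lemma fib_full M N (b : amod_hom (fib_module M) (fib_module N)) :
  exists f : chom M N, fib_hom f = b.
Proof.
have [M' [f [f' [f'f ff']]]] := equivalence1_surj E_equiv M.
have [N' [g [g' [g'g gg']]]] := equivalence1_surj E_equiv N.
have [I1 [t1 /simple_decomposition[u1 [v1 [_ _ uv1]]]]] :=
  diag_decomposition (svalP M').
have [I2 [t2 /simple_decomposition[u2 [v2 [_ _ uv2]]]]] :=
  diag_decomposition (svalP N').
pose h k l (x : fib (L (t1 k))) : fib (L (t2 l)) :=
  fib_map (mf_hom E (v2 l) \c g') (b (fib_map (f \c mf_hom E (u1 k)) x)).
have lh k l : linear (h k l).
  by move=> c x y; rewrite /h fib_map_linear ah_linear fib_map_linear.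
have ha k l a x : h k l (block a x) = block a (h k l x).
  have bA y : b (fib_act a y) = fib_act a (b y) := ah_act b a y.
  by rewrite /h -!fib_act_simple fib_act_nat bA fib_act_nat.
pose w k l := sval (boolp.cid (fib_block_hom (@lh k l) (@ha k l))).
have wE k l x : h k l x = fib_map (mf_hom E (w k l)) x :=
  svalP (boolp.cid (fib_block_hom (@lh k l) (@ha k l))) x.
pose F : chom M' N' := ah_lincomb (fun _ : I1 * I2 => 1)
  (fun p => ah_comp (u2 p.2) (ah_comp (w p.1 p.2) (v1 p.1))).
exists (g \c mf_hom E F \c f'); apply: amod_hom_eq => x /=.
rewrite !fib_mapM fib_map_lincomb.
rewrite -(pair_bigA _ (fun k l => 1 *: fib_map (mf_hom E (ah_comp (u2 l)
  (ah_comp (w k l) (v1 k)) : chom M' N')) (fib_map f' x))) /=.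
rewrite -[RHS]fib_map1 -gg' fib_mapM; congr fib_map.
rewrite -[RHS]uv2 exchange_big; apply: eq_bigr => l _ /=.
rewrite -[x in RHS]fib_map1 -ff' (fib_mapM f f').
rewrite -[fib_map f' x in RHS]uv1.
have [_ _ _ ->] := Defs.linearE (fib_map_linear f).
have [_ _ _ ->] := Defs.linearE (ah_linear b).
have [_ _ _ ->] := Defs.linearE (fib_map_linear g').
have [_ _ _ ->] :=
  Defs.linearE (fib_map_linear (mf_hom E (u2 l) \c mf_hom E (v2 l))).
apply: eq_bigr => k _; rewrite scale1r.
rewrite -[ah_comp _ _]/((u2 l : chom (simple_ob (t2 l)) N') \c
  (w k l : chom (simple_ob (t1 k)) (simple_ob (t2 l))) \c (v1 k : chom M' _)).
rewrite !mf_homM !fib_mapM -wE /h; congr fib_map.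
by rewrite !fib_mapM.
Qed.

(** By [block_module_twist] each summand of [N] is isomorphic to an untwisted block, say [t k]; the
    preimage is the image under [E] of the sum of the simple modules of types [t k]. *)
Lemma fib_surj (N : sm_modules A) : exists (M : C) (f : chom (fib_functor M) N),
  invertible f.
Proof.
case: N => N N_sm; have [J [N_ [Nstd [inj [prj [injK inj0 injprj]]]]]] := N_sm.
pose S j : amodule A := block_module (fun j => fib (L j)) j.
have std k : exists j (p : amod_hom (N_ k) (S j)) (p' : amod_hom (S j) (N_ k)),
   cancel p p' /\ cancel p' p.
  have [j [g [p [p' [pp' p'p]]]]] := Nstd k.
  have [s s_neq0] := fib_simple_neq0 j.
  have [i [q [q' [qq' q'q]]]] :=
    block_module_twist (fun i (x : fib (L i)) =>
      @fib_separated (L i) x) g s_neq0.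
  exists i, (ah_comp q p), (ah_comp p' q').
  by split=> x /=; rewrite ?qq' ?pp' ?p'p ?q'q.
pose t k := sval (boolp.cid (std k)).
pose p k : amod_hom (N_ k) (S (t k)) :=
  sval (boolp.cid (svalP (boolp.cid (std k)))).
pose p' k : amod_hom (S (t k)) (N_ k) :=
  sval (boolp.cid (svalP (boolp.cid (svalP (boolp.cid (std k)))))).
have pK k : cancel (p k) (p' k) /\ cancel (p' k) (p k).
  exact: svalP (boolp.cid (svalP (boolp.cid (svalP (boolp.cid (std k)))))).
have pp' k := (pK k).1; have p'p k := (pK k).2.
pose M : D := exist _ (diag_sum K t) (diag_sum_finite K t).
have [u [v [vu vu0 uv]]] := @simple_decomposition M J t (diag_sum_direct K t).
exists (E M); pose f := ah_lincomb (fun _ : J => 1) (fun k =>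
  ah_comp (inj k) (ah_comp (p' k) (fib_simple_out (mf_hom E (v k))))).
exists f; pose g (y : N) : fib (E M) :=
  \sum_k fib_map (mf_hom E (u k)) (p k (prj k y)).
apply: (@amod_hom_invertible K A (@sm_module K A)
  (exist _ (fib_module (E M)) (fib_sm_module (E M))) (exist _ N N_sm) f g).
- move=> x /=; rewrite -[RHS]uv; apply: eq_bigr => k _.
  have [_ _ _ ->] := Defs.linearE (ah_linear (prj k)).
  rewrite (bigD1 k) //= scale1r injK big1 ?addr0 => [|l lk].
    by rewrite p'p fib_mapM.
  by rewrite scale1r inj0.
- move=> y /=; rewrite -[RHS]injprj; apply: eq_bigr => k _.
  rewrite scale1r; congr (inj k _); rewrite -[RHS]pp'; congr (p' k _).
  have [_ _ _ ->] := Defs.linearE (fib_map_linear (mf_hom E (v k))).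
  rewrite (bigD1 k) //= -fib_mapM vu fib_map1 big1 ?addr0 // => l lk.
  by rewrite -fib_mapM vu0.
Qed.

Lemma fib_functor_equivalence :
  @equivalence1 (module_categories K) C (sm_modules A) fib_functor.
Proof.
apply: fully_faithful_equivalence.
- move=> M N f g.
  move/(congr1 (fun h : amod_hom (fib_module M) (fib_module N) => ah_fun h)) =>
    fg.
  by apply: fib_map_inj => x; exact: (congr1 (fun h => h x) fg).
- exact: fib_full.
- exact: fib_surj.
Qed.

End FibreFunctor.

(** * Equivalences to the strict 2-representation of an algebra *)

Section Squares.
Variables (K : fieldType) (C D : module_category K) (Psi : module_functor C D).

(** This and the next two lemmas reduce the axioms of a pseudonatural transformation to single
    objects, where associators, unitors and whiskered identities disappear. *)
Lemma mt_comp_square (F1 F2 F12 : module_functor C C)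
    (T1 T2 T12 : module_functor D D)
    (m : module_transformation (mf_comp F1 F2) F12)
    (t : module_transformation (mf_comp T1 T2) T12)
    (phi1 : module_transformation (mf_comp F1 Psi) (mf_comp Psi T1))
    (phi2 : module_transformation (mf_comp F2 Psi) (mf_comp Psi T2))
    (phi12 : module_transformation (mf_comp F12 Psi) (mf_comp Psi T12)) :
  (forall M, phi12 M \c mf_hom Psi (m M)
    = t (Psi M) \c mf_hom T2 (phi1 M) \c phi2 (F1 M)) ->
  mt_v phi12 (mt_h m (mt_id Psi))
  = mt_v (mt_h (mt_id Psi) t) (mt_v (mt_assoc Psi T1 T2)
      (mt_v (mt_h phi1 (mt_id T2)) (mt_v (mt_associ F1 Psi T2)
        (mt_v (mt_h (mt_id F1) phi2) (mt_assoc F1 F2 Psi))))).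
Proof.
move=> sq; apply: module_transformation_eq => M /=.
by rewrite !mf_hom1 ?ccomp1l ?ccomp1r; apply: sq.
Qed.

Lemma mt_unit_square (F1 : module_functor C C) (T1 : module_functor D D)
    (e : module_transformation (mf_id C) F1)
    (t : module_transformation (mf_id D) T1)
    (phi1 : module_transformation (mf_comp F1 Psi) (mf_comp Psi T1)) :
  (forall M, phi1 M \c mf_hom Psi (e M) = t (Psi M)) ->
  mt_v phi1 (mt_h e (mt_id Psi))
  = mt_v (mt_h (mt_id Psi) t) (mt_v (mt_runiti Psi) (mt_lunit Psi)).
Proof.
move=> sq; apply: module_transformation_eq => M /=.
by rewrite !mf_hom1 ?ccomp1l ?ccomp1r; apply: sq.
Qed.

Lemma mt_nat_square (F1 F2 : module_functor C C) (T1 T2 : module_functor D D)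
    (a : module_transformation F1 F2) (t : module_transformation T1 T2)
    (phi1 : module_transformation (mf_comp F1 Psi) (mf_comp Psi T1))
    (phi2 : module_transformation (mf_comp F2 Psi) (mf_comp Psi T2)) :
  (forall M, phi2 M \c mf_hom Psi (a M) = t (Psi M) \c phi1 M) ->
  mt_v phi2 (mt_h a (mt_id Psi)) = mt_v (mt_h (mt_id Psi) t) phi1.
Proof.
move=> sq; apply: module_transformation_eq => M /=.
by rewrite !mf_hom1 ?ccomp1l ?ccomp1r; apply: sq.
Qed.

End Squares.

Section ThetaEquivalence.
Variables (K : fieldType) (X : crossed_module)
  (R : two_functor (two_group X) (module_categories K)).
Variables (A : semimatrix_algebra K)
  (omega : xm_morphism X (algebra_crossed_module A))
  (A_2vect : is_two_vector_space (sm_modules A)).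
Local Notation G := (xm_G X).
Let C : module_category K := R tt.
Let F (g : G) : module_functor C C := tf_hom R (x := tt) (y := tt) g.
Let rho (g g' : G) (c : tg_cell g g') : module_transformation (F g) (F g') :=
  tf_cell R (x := tt) (y := tt) c.
Let mu (f g : G) : module_transformation (mf_comp (F f) (F g)) (F (f * g)%g) :=
  tf_comp R (x := tt) (y := tt) (z := tt) f g.
Let eta : module_transformation (mf_id C) (F 1%g) := tf_unit R tt.
Let tw (g : G) : module_functor (sm_modules A) (sm_modules A) :=
  twist_functor (xm_mG omega g : alg_aut A).

Variable Psi : module_functor C (sm_modules A).
Variable psi : forall g,
  module_transformation (mf_comp Psi (tw g)) (mf_comp (F g) Psi).

Let psi_fun g M : sval (Psi M) -> sval (Psi (F g M)) := ah_fun (psi g M).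
Let Psi_fun M N (w : chom M N) : sval (Psi M) -> sval (Psi N) :=
  ah_fun (mf_hom Psi w).

Hypothesis psi_inv : forall g M, invertible (psi g M).
Hypothesis psi_nat : forall g g' (c : tg_cell g g') M (y : sval (Psi M)),
  psi_fun g' (@am_act _ _ (sval (Psi M))
    (uval (xm_mH omega (sval c) : alg_unit A)) y)
  = Psi_fun (rho c M) (psi_fun g y).
Hypothesis psi_comp : forall f g M (y : sval (Psi M)),
  Psi_fun (mu f g M) (psi_fun g (psi_fun f y)) = psi_fun (f * g)%g y.
Hypothesis psi_unit : forall M (y : sval (Psi M)),
  psi_fun 1%g y = Psi_fun (eta M) y.

(** The constraint of a pseudonatural transformation points against [psi], which is the direction
    given by an explicit formula; so its inverse is taken. *)
Let phi g : module_transformation (mf_comp (F g) Psi) (mf_comp Psi (tw g)) :=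
  sval (boolp.cid (mt_invertible (psi_inv g))).
Let phi_psi g :
  mt_v (phi g) (psi g) = mt_id _ /\ mt_v (psi g) (phi g) = mt_id _.
Proof. exact: svalP (boolp.cid (mt_invertible (psi_inv g))). Qed.

Let phi_fun g M : sval (Psi (F g M)) -> sval (Psi M) := ah_fun (phi g M).

Let psiK g M : cancel (@psi_fun g M) (@phi_fun g M).
Proof.
move=> y; have /(congr1 (fun t => mt_ob t M)) := (phi_psi g).1.
exact: (congr1 (fun h : amod_hom (sval (tw g (Psi M))) (sval (tw g (Psi M))) =>
  ah_fun h y)).
Qed.

Let phiK g M : cancel (@phi_fun g M) (@psi_fun g M).
Proof.
move=> y; have /(congr1 (fun t => mt_ob t M)) := (phi_psi g).2.
exact: (congr1 (fun h : amod_hom (sval (Psi (F g M))) (sval (Psi (F g M))) =>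
  ah_fun h y)).
Qed.

Let phi_inv g : @invertible2 (module_categories K) _ _ _ _ (phi g).
Proof. by exists (psi g); split; case: (phi_psi g). Qed.

Let phi_nat (g g' : G) (c : tg_cell g g') :
  mt_v (phi g') (mt_h (rho c) (mt_id Psi))
  = mt_v (mt_h (mt_id Psi) (theta_cell omega c)) (phi g).
Proof.
apply: mt_nat_square => M; apply: amod_hom_eq => x.
suff : phi_fun (Psi_fun (rho c M) x) = @am_act _ _ (sval (Psi M))
  (uval (xm_mH omega (sval c) : alg_unit A)) (phi_fun x) by [].
by rewrite -{1}[x]phiK -psi_nat psiK.
Qed.

Let phi_comp f g :
  mt_v (phi (f * g)%g) (mt_h (mu f g) (mt_id Psi))
  = mt_v (mt_h (mt_id Psi) (theta_comp omega f g))
      (mt_v (mt_assoc Psi (tw f) (tw g))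
        (mt_v (mt_h (phi f) (mt_id (tw g)))
          (mt_v (mt_associ (F f) Psi (tw g))
            (mt_v (mt_h (mt_id (F f)) (phi g)) (mt_assoc (F f) (F g) Psi))))).
Proof.
apply: mt_comp_square => M; apply: amod_hom_eq => x.
suff : phi_fun (Psi_fun (mu f g M) x) = phi_fun (phi_fun x) by [].
by rewrite -{1}[x]phiK -{1}[phi_fun x]phiK psi_comp psiK.
Qed.

Let phi_unit :
  mt_v (phi 1%g) (mt_h eta (mt_id Psi))
  = mt_v (mt_h (mt_id Psi) (theta_unit omega))
      (mt_v (mt_runiti Psi) (mt_lunit Psi)).
Proof.
apply: mt_unit_square => M; apply: amod_hom_eq => x.
suff : phi_fun (Psi_fun (eta M) x) = x by [].
by rewrite -psi_unit psiK.
Qed.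

Lemma theta_equivalent :
  @equivalence1 (module_categories K) C (sm_modules A) Psi ->
  equivalent R (forget_full (theta omega A_2vect)).
Proof.
move=> Psi_equiv.
pose s := @Pseudonatural (two_group X) (module_categories K) R
  (forget_full (theta omega A_2vect))
  (fun x => match x with tt => Psi end)
  (fun x y => match x, y with tt, tt => phi end)
  (fun x y => match x, y with tt, tt => phi_inv end)
  (fun x y => match x, y with tt, tt => phi_nat end)
  (fun x y z => match x, y, z with tt, tt, tt => phi_comp end)
  (fun x => match x with tt => phi_unit end).
by exists s => - [].
Qed.
End ThetaEquivalence.

(** * The crossed module action of a 2-representation *)

Section TwoRepresentation.
Variables (K : fieldType) (X : crossed_module)
  (R : two_functor (two_group X) (module_categories K)).
Local Notation G := (xm_G X).
Local Notation H := (xm_H X).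
Let C : module_category K := R tt.
Variable n : nat.
Let D : module_category K := diag_modules K n.
Variables (E : module_functor C D) (E' : module_functor D C).
Hypothesis EE' : @isomorphic1 (module_categories K) C C (mf_comp E E')
  (mf_id C).
Hypothesis E'E : @isomorphic1 (module_categories K) D D (mf_comp E' E)
  (mf_id D).

Let F (g : G) : module_functor C C := tf_hom R (x := tt) (y := tt) g.
Let rho (g g' : G) (c : tg_cell g g') : module_transformation (F g) (F g') :=
  tf_cell R (x := tt) (y := tt) c.
Let mu (f g : G) : module_transformation (mf_comp (F f) (F g)) (F (f * g)%g) :=
  tf_comp R (x := tt) (y := tt) (z := tt) f g.
Let eta : module_transformation (mf_id C) (F 1%g) := tf_unit R tt.

Let mu_inv f g M : invertible (mu f g M) :=
  invertible2_component M (tf_comp_inv R (x := tt) (y := tt) (z := tt) f g).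
Let eta_inv M : invertible (eta M) :=
  invertible2_component M (tf_unit_inv R tt).

Let nu f g M : chom (F (f * g)%g M) (F g (F f M)) :=
  sval (boolp.cid (mu_inv f g M)).
Let nu_mu f g M : nu f g M \c mu f g M = cid _.
Proof. by have [] := svalP (boolp.cid (mu_inv f g M)). Qed.
Let mu_nu f g M : mu f g M \c nu f g M = cid _.
Proof. by have [] := svalP (boolp.cid (mu_inv f g M)). Qed.

Let at_ M (F1 F2 : module_functor C C) (a b : module_transformation F1 F2) :
  a = b -> a M = b M.
Proof. by move->. Qed.

Let rho1 g M : rho (tg_eq (erefl g)) M = cid _.
Proof. exact: (at_ M (tf_cell1 R (x := tt) (y := tt) g)). Qed.

Let rho_v f g k (b : tg_cell g k) (a : tg_cell f g) M :
  rho (tg_v b a) M = rho b M \c rho a M.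
Proof. exact: (at_ M (tf_cellV R (x := tt) (y := tt) b a)). Qed.

Let mu_nat f f' g g' (a : tg_cell f f') (b : tg_cell g g') M :
  mu f' g' M \c mf_hom (F g') (rho a M) \c rho b (F f M)
  = rho (tg_h a b) M \c mu f g M.
Proof.
exact: (at_ M (tf_comp_nat R (x := tt) (y := tt) (z := tt) a b)).
Qed.

Let mu_assoc f g k M :
  rho (tg_eq (esym (mulgA f g k))) M \c mu (f * g)%g k M
    \c mf_hom (F k) (mu f g M)
  = mu f (g * k)%g M \c mu g k (F f M).
Proof.
have /= := at_ M (tf_assoc R (x := tt) (y := tt) (z := tt) (t := tt) f g k).
by rewrite !ccomp1r mf_hom1 ccomp1l.
Qed.

Let mu_lunit f M :
  rho (tg_eq (mul1g f)) M \c mu 1%g f M \c mf_hom (F f) (eta M) = cid _.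
Proof.
have /= := at_ M (tf_lunit R (x := tt) (y := tt) f).
by rewrite !ccomp1r.
Qed.

Let T (g : G) : module_functor C D := mf_comp (F g) E.

Let E'_equiv : @equivalence1 (module_categories K) D C E'.
Proof. exact: equivalence1_sym EE' E'E. Qed.

Let T_faithful : exists g, forall M N : C, injective (@mf_hom _ _ _ (T g) M N).
Proof.
have E_faithful : forall M N, injective (@mf_hom _ _ _ E M N).
  by apply: equivalence1_faithful; exists E'.
(* Through [eta], the factor at 1 is isomorphic to the faithful functor [E]. *)
exists 1%g => M N w w' /E_faithful ww'.
apply: (invertible_mono (eta_inv N)).
by rewrite !(mt_nat eta) /= ww'.
Qed.

Local Notation fib := (fib T).
Local Notation fib_map := (@fib_map K n C G T _ _).
Local Notation A := (fib_algebra T E').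
Let act (a : A) M : fib M -> fib M := fib_act E'_equiv a (M := M).

Let Eh M N (w : chom M N) : amod_hom (sval (E M)) (sval (E N)) := mf_hom E w.
Let EhM M N L (v : chom N L) (w : chom M N) x : Eh (v \c w) x = Eh v (Eh w x).
Proof. by rewrite /Eh mf_homM. Qed.
Let Eh1 M x : Eh (cid M) x = x.
Proof. by rewrite /Eh mf_hom1. Qed.

(** The cells [tg_eq] serve as transport between fibre components whose indices agree only by the
    group laws. *)
Let rho_eq g g' (e : g = g') M (y : fib M) : Eh (rho (tg_eq e) M) (y g) = y g'.
Proof. by case: _ / e; rewrite rho1 Eh1. Qed.

(* In this direction no transport along an equality of group elements is needed,
   unlike for the inverse of [psi f]. *)
Let psi f M (y : fib M) : fib (F f M) := fun g => Eh (nu f g M) (y (f * g)%g).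

Let psi_linear f M : linear (@psi f M).
Proof. by move=> k x y; apply: dprodP => g; apply: ah_linear. Qed.

Let nu_nat f g M N (w : chom M N) :
  nu f g N \c mf_hom (F (f * g)%g) w
  = mf_hom (F g) (mf_hom (F f) w) \c nu f g M.
Proof.
apply: (invertible_mono (mu_inv f g N)).
rewrite !ccompA mu_nu ccomp1l (mt_nat (mu f g) w) -ccompA mu_nu ccomp1r.
by [].
Qed.

Let psi_nat f M N (w : chom M N) (y : fib M) :
  psi f (fib_map w y) = fib_map (mf_hom (F f) w) (psi f y).
Proof.
apply: dprodP => g; rewrite -[LHS]/(Eh (nu f g N) (Eh (mf_hom (F _) w) _)).
by rewrite -EhM nu_nat EhM.
Qed.

Let psi_inj f M : injective (@psi f M).
Proof.
move=> x y xy; apply: dprodP => k.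
have /(congr1 (Eh (mu f (f^-1 * k)%g M))) :=
  congr1 (fun z : fib (F f M) => z (f^-1 * k)%g) xy.
by rewrite /psi -!EhM mu_nu !Eh1 mulgA mulgV mul1g.
Qed.

Let psi_surj f M (z : fib (F f M)) : exists y, psi f y = z.
Proof.
have e k : (f * (f^-1 * k))%g = k by rewrite mulgA mulgV mul1g.
(* The component of the preimage at [k] is determined by that of [z] at [f^-1 k]; [rho] corrects the
   index [f (f^-1 k)]. *)
exists (fun k =>
  Eh (rho (tg_eq (e k)) M \c mu f (f^-1 * k)%g M) (z (f^-1 * k)%g)).
apply: dprodP => g; rewrite /psi -EhM.
have e' : (f^-1 * (f * g))%g = g by rewrite mulgA mulVg mul1g.
(* Replacing [f^-1 (f g)] by [g] everywhere at once makes the correcting cell an identity. *)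
move: (e (f * g)%g); case: _ / (esym e') => ee.
by rewrite (Prop_irrelevance ee (erefl _)) rho1 ccomp1l nu_mu Eh1.
Qed.

(** At index [k] this is the associativity axiom of [R] for [f], [g], [k], with the associator
    absorbed by [rho_eq]. *)
Let psi_mu f g M (y : fib M) :
  fib_map (mu f g M) (psi g (psi f y)) = psi (f * g)%g y.
Proof.
apply: dprodP => k; rewrite -[LHS]/(Eh (mf_hom (F k) (mu f g M))
  (Eh (nu g k (F f M)) (Eh (nu f (g * k)%g M) (y (f * (g * k))%g)))).
rewrite -(rho_eq (esym (mulgA f g k)) y) -!EhM; congr (Eh _ _).
apply: (invertible_epi (mu_inv (f * g)%g k M)).
have Fk_inv := mf_hom_inv (F k) (mu_inv f g M).
apply: (invertible_epi Fk_inv); rewrite nu_mu ccomp1l -!ccompA mu_assoc.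
by rewrite (ccompA (nu f _ M)) nu_mu ccomp1l nu_mu ccomp1r.
Qed.

(** At index [g] this is the left unit axiom of [R]. *)
Let psi_eta M (y : fib M) : psi 1%g y = fib_map (eta M) y.
Proof.
apply: dprodP => g; rewrite -[RHS]/(Eh (mf_hom (F g) (eta M)) (y g)).
rewrite -(rho_eq (mul1g g) y) /psi -EhM; congr (Eh _ _).
apply: (invertible_epi (mu_inv 1%g g M)).
apply: (invertible_epi (mf_hom_inv (F g) (eta_inv M))).
by rewrite nu_mu -!ccompA mu_lunit ccomp1l ccomp1r.
Qed.

(** * The action of 2-morphisms on fibres *)

Let cell_subproof (h : H) (k : G) : (xm_d h * ((xm_d h)^-1 * k) = k)%g.
Proof. by rewrite mulgA mulgV mul1g. Qed.

Let cell_to (h : H) (k : G) : tg_cell ((xm_d h)^-1 * k)%g k :=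
  exist _ h (cell_subproof h k).

Let lam (h : H) M (y : fib M) : fib M :=
  fun k => Eh (rho (cell_to h k) M) (y ((xm_d h)^-1 * k)%g).

(** Allows [lam] to be computed with any cell over [h], whatever form its source takes. *)
Let lamE g g' (c : tg_cell g g') h M (y : fib M) : sval c = h ->
  lam h y g' = Eh (rho c M) (y g).
Proof.
move=> ch; suff gen x (c0 : tg_cell x g') : sval c0 = h -> x = g ->
    Eh (rho c0 M) (y x) = Eh (rho c M) (y g).
  apply: (gen _ (cell_to h g')) => //.
  by rewrite -(svalP c) ch mulgA mulVg mul1g.
move=> c0h xg; subst x.
by rewrite (@tg_cell_eq X _ _ c0 c) // c0h ch.
Qed.

Let lam_linear h M : linear (@lam h M).
Proof. by move=> k x y; apply: dprodP => g; apply: ah_linear. Qed.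

Let lam_nat h M N (w : chom M N) (y : fib M) :
  fib_map w (lam h y) = lam h (fib_map w y).
Proof.
apply: dprodP => g; rewrite -[LHS]/(Eh (mf_hom (F _) w) (Eh (rho _ _) _)).
by rewrite -EhM -mt_nat EhM.
Qed.

Let lam1 M (y : fib M) : lam 1%g y = y.
Proof.
apply: dprodP => g; rewrite (lamE (c := tg_eq (erefl g))) //.
by rewrite rho1 Eh1.
Qed.

Let lamM h h' M (y : fib M) : lam (h * h')%g y = lam h (lam h' y).
Proof.
apply: dprodP => g.
rewrite (lamE (c := tg_v (cell_to h g) (cell_to h' ((xm_d h)^-1 * g)%g))) //.
by rewrite rho_v EhM.
Qed.

(** Naturality of [mu] in its first argument: composing [c] on the right with the identity of [k]
    does not change the underlying element of [H]. *)
Let psi_lam g g' (c : tg_cell g g') M (y : fib M) :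
  psi g' (lam (sval c) y) = fib_map (rho c M) (psi g y).
Proof.
apply: dprodP => k; rewrite -[RHS]/(Eh (mf_hom (F k) (rho c M)) _) /psi.
rewrite (lamE (c := tg_h c (tg_eq (erefl k)))) /= ?xm_actg1 ?mulg1 //.
rewrite -!EhM; congr (Eh _ _); apply: (invertible_epi (mu_inv g k M)).
rewrite -!ccompA -mu_nat rho1 ccomp1r nu_mu ccomp1r.
by rewrite ccompA nu_mu ccomp1l.
Qed.

(** Naturality of [mu] in its second argument: composing on the left with the identity of [g]
    replaces [h] by [xm_act g h]. *)
Let psi_lam_act g h M (y : fib M) :
  psi g (lam (xm_act g h) y) = lam h (psi g y).
Proof.
apply: dprodP => k; pose k' := ((xm_d h)^-1 * k)%g.
rewrite -[RHS]/(Eh (rho (cell_to h k) (F g M)) (Eh (nu g k' M) (y (g * k')%g))).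
rewrite /psi.
rewrite (lamE (c := tg_h (tg_eq (erefl g)) (cell_to h k))) /= ?mul1g //.
rewrite -!EhM; congr (Eh _ _).
apply: (invertible_epi (mu_inv g k' M)).
rewrite -!ccompA -mu_nat rho1 mf_hom1 ccomp1l nu_mu ccomp1r.
by rewrite ccompA nu_mu ccomp1l.
Qed.

Let act_linear a M : linear (@act a M) := fib_act_linear E'_equiv a (M := M).
Let act_nat a M N (w : chom M N) x :
    fib_map w (act a x) = act a (fib_map w x) :=
  fib_act_nat E'_equiv a w x.
Let act_inj (a b : A) : (forall M (x : fib M), act a x = act b x) -> a = b :=
  @fib_act_inj _ _ _ _ _ _ E'_equiv a b.
Let mod_ M : amodule A := fib_module T E'_equiv M.
Let actD a b M (x : fib M) : act (a + b) x = act a x + act b x :=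
  @am_addl _ _ (mod_ M) a b x.
Let act_mul a b M (x : fib M) : act (a * b) x = act a (act b x) :=
  @am_mul _ _ (mod_ M) a b x.
Let act_in k M (x : fib M) : act (alg_in k) x = k *: x :=
  @am_in _ _ (mod_ M) k x.
Let act1 M (x : fib M) : act 1 x = x := am_act1 (M := mod_ M) x.

(** * The morphism of crossed modules *)

Let aut_subproof (f : G) (a : A) : exists a' : A, forall M (y : fib M),
  psi f (act a' y) = act a (psi f y).
Proof.
pose phi M (z : fib (F f M)) := sval (boolp.cid (psi_surj z)).
have phiK M (z : fib (F f M)) : psi f (phi M z) = z :=
  svalP (boolp.cid (psi_surj z)).
have [||a' a'P] := @fib_act_extend _ _ _ _ _ _ E'_equiv
  (fun M y => phi M (act a (psi f y))).
- move=> M k x y; apply: (psi_inj (f := f)).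
  rewrite phiK (psi_linear f k x y) act_linear.
  by rewrite (psi_linear f k (phi M _) (phi M _)) !phiK.
- move=> M N w x; apply: (psi_inj (f := f)).
  by rewrite !psi_nat !phiK act_nat.
by exists a' => M y; rewrite [act a' y]a'P phiK.
Qed.

Let aut_map (f : G) (a : A) : A := sval (boolp.cid (aut_subproof f a)).

Let aut_mapP f a M (y : fib M) : psi f (act (aut_map f a) y) = act a (psi f y).
Proof. exact: (svalP (boolp.cid (aut_subproof f a))). Qed.

(** All properties of conjugation by [psi f] are drawn from this uniqueness, so the inverse of
    [psi f] never has to be computed. *)
Let aut_map_uniq f a a' :
  (forall M (y : fib M), psi f (act a' y) = act a (psi f y)) ->
  a' = aut_map f a.
Proof.
move=> a'P; apply: act_inj => M x; apply: (psi_inj (f := f)).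
by rewrite a'P aut_mapP.
Qed.

Let aut_mapM f g a : aut_map (f * g)%g a = aut_map f (aut_map g a).
Proof.
apply/esym/aut_map_uniq => M y.
by rewrite -!psi_mu aut_mapP aut_mapP act_nat.
Qed.

Let aut_map1 a : aut_map 1%g a = a.
Proof. by apply/esym/aut_map_uniq => M y; rewrite !psi_eta act_nat. Qed.

Let aut_mapK f : cancel (aut_map f) (aut_map f^-1%g).
Proof. by move=> a; rewrite -aut_mapM mulVg aut_map1. Qed.
Let aut_mapVK f : cancel (aut_map f^-1%g) (aut_map f).
Proof. by move=> a; rewrite -aut_mapM mulgV aut_map1. Qed.
Let aut_map_add f : {morph aut_map f : a b / a + b}.
Proof.
move=> a b; apply/esym/aut_map_uniq => M y; rewrite !actD -!aut_mapP.
by have [-> _ _ _] := Defs.linearE (@psi_linear f M).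
Qed.
Let aut_map_mul f : {morph aut_map f : a b / a * b}.
Proof.
by move=> a b; apply/esym/aut_map_uniq => M y; rewrite !act_mul !aut_mapP.
Qed.
Let aut_map_in f k : aut_map f (alg_in k) = alg_in k.
Proof.
apply/esym/aut_map_uniq => M y; rewrite !act_in.
by have [_ -> _ _] := Defs.linearE (@psi_linear f M).
Qed.

Let aut_of (f : G) : alg_aut A := AlgAut (aut_mapK f) (@aut_mapVK f)
  (@aut_map_add f) (@aut_map_mul f) (aut_map_in f).

Let lam_subproof h : exists a : A, forall M (y : fib M), act a y = lam h y.
Proof. by apply: fib_act_extend => *; [apply: lam_linear | apply: lam_nat]. Qed.

Let lam_act h : A := sval (boolp.cid (lam_subproof h)).
Let lam_actE h M (y : fib M) : act (lam_act h) y = lam h y.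
Proof. exact: (svalP (boolp.cid (lam_subproof h))). Qed.

Let lam_actM h h' : lam_act (h * h')%g = lam_act h * lam_act h'.
Proof. by apply: act_inj => M y; rewrite act_mul !lam_actE lamM. Qed.
Let lam_act1 : lam_act 1%g = 1.
Proof. by apply: act_inj => M y; rewrite lam_actE lam1 act1. Qed.
Let lam_actV h : lam_act h * lam_act h^-1%g = 1.
Proof. by rewrite -lam_actM mulgV lam_act1. Qed.
Let lam_Vact h : lam_act h^-1%g * lam_act h = 1.
Proof. by rewrite -lam_actM mulVg lam_act1. Qed.

Let unit_of (h : H) : alg_unit A := AlgUnit (lam_actV h) (lam_Vact h).

Let unit_ofM : {morph unit_of : h h' / (h * h')%g}.
Proof. by move=> h h'; apply: alg_unit_eq; apply: lam_actM. Qed.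

Let aut_ofM : {morph aut_of : f g / (f * g)%g}.
Proof. by move=> f g; apply: alg_aut_eq => a; apply: aut_mapM. Qed.

(** The map [psi (xm_d h)] after [lam h] is the image of a morphism of [C], so it commutes with the
    algebra; hence conjugation by [psi (xm_d h)] is conjugation by [lam h]. *)
Let aut_of_d h : aut_of (xm_d h) = conj_aut (unit_of h).
Proof.
apply: alg_aut_eq => a; apply/esym/aut_map_uniq => M y /=.
pose c := cell_to h (xm_d h).
have psiE z : psi (xm_d h) (lam h z)
    = fib_map (rho c M) (psi ((xm_d h)^-1 * xm_d h)%g z) := psi_lam c z.
have wE : exists w : chom M (F (xm_d h) M), forall z,
    psi (xm_d h) (lam h z) = fib_map w z.
  (* Once the source of [c] is generalized it can be rewritten to 1, where [psi] is given by
     [eta]. *)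
  move: c psiE; rewrite mulVg => c psiE; exists (rho c M \c eta M) => z.
  by rewrite psiE psi_eta fib_mapM.
have [w {}wE] := wE.
rewrite !act_mul !lam_actE wE act_nat -wE -lamM.
by rewrite mulgV lam1.
Qed.

Let unit_of_act g h : unit_of (xm_act g h) = aut_unit (aut_of g) (unit_of h).
Proof.
apply: alg_unit_eq; apply: aut_map_uniq => M y.
by rewrite !lam_actE psi_lam_act.
Qed.

Definition rep_morphism : xm_morphism X (algebra_crossed_module A) :=
  @XmMorphism X (algebra_crossed_module A)
    (HB.pack unit_of (isMultiplicative.Build _ _ unit_of unit_ofM))
    (HB.pack aut_of (isMultiplicative.Build _ _ aut_of aut_ofM))
    aut_of_d unit_of_act.

(** * The constraints of the lifted functor *)

Let Psi : module_functor C (sm_modules A) := fib_functor T E'_equiv.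

Let coord_comp (V : vectType K) (M : C) (d : 'I_(\dim {:V})) :
  chom (mc_act V M) M :=
  mc_unit M \c mc_map (coord_hom d) (cid M).

Let coord_comp_str f (V : vectType K) (M : C) (d : 'I_(\dim {:V})) :
  mf_hom (F f) (@coord_comp V M d) = coord_comp (F f M) d \c mf_str (F f) V M.
Proof.
by rewrite mf_homM -mf_str_unit -!ccompA mf_str_nat mf_hom1.
Qed.

Let psi_act f M a (y : fib M) :
  psi f (act (aut_of f a) y) = act a (psi f y).
Proof. exact: aut_mapP. Qed.

Let psi_hom f M : amod_hom (am_twist (aut_of f) (mod_ M)) (mod_ (F f M)) :=
  @AmodHom _ _ (am_twist (aut_of f) (mod_ M)) (mod_ (F f M)) (@psi f M)
    (@psi_linear f M) (fun a y => psi_act f a y).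

Let psi_trans f :
  module_transformation (mf_comp Psi (twist_functor (aut_of f)))
    (mf_comp (F f) Psi).
Proof.
refine (@ModuleTransformation K C (sm_modules A)
  (mf_comp Psi (twist_functor (aut_of f))) (mf_comp (F f) Psi)
  (fun M => psi_hom f M) _ _).
- by move=> M N w; apply: amod_hom_eq => y; apply: psi_nat.
- move=> V M; apply: amod_hom_eq => y /=; apply/ffunP=> d.
  (* A coordinate of the tensor constraint is a morphism of [C] which [F f] carries to the same
     coordinate, so naturality of [psi] suffices. *)
  rewrite -[RHS]/((fib_str (fib_map (mf_str (F f) V M) (psi f y)) :
    tensor V (fib (F f M))) d) fib_str_coord -fib_mapM -coord_comp_str -psi_nat.
  rewrite -(fib_str_coord y d).
  have -> : tmap (\1 : 'Hom(V, V))%VF (@psi f M) = tensor_map (@psi f M).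
    apply: funext; have l1 := lfun_linear (\1 : 'Hom(V, V))%VF.
    have lp := @psi_linear f M.
    apply: tensor_ext (tmap_linear l1 lp) (tensor_map_linear lp (V := V)) _.
    move=> v m.
    by rewrite tmap_pure // tensor_map_pure // id_lfunE.
  by rewrite ffunE.
Defined.

Let psi_trans_inv f M : invertible (psi_trans f M).
Proof.
pose s z := sval (boolp.cid (@psi_surj f M z)).
have sK z : psi f (s z) = z := svalP (boolp.cid (@psi_surj f M z)).
apply: (@amod_hom_invertible K A (@sm_module K A)
  (mf_comp Psi (twist_functor (aut_of f)) M) (mf_comp (F f) Psi M)
  (psi_trans f M) s) => x; last exact: sK.
by apply: (psi_inj (f := f)); apply: sK.
Qed.

Let Psi_equiv : @equivalence1 (module_categories K) C (sm_modules A) Psi.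
Proof. exact: fib_functor_equivalence. Qed.

Let A_2vect : is_two_vector_space (sm_modules A).
Proof.
have [Q [PsiQ QPsi]] := Psi_equiv; exists n, (mf_comp Q E).
apply: equivalence1_comp; first exact: equivalence1_sym PsiQ QPsi.
by exists E'.
Qed.

Lemma equivalent_theta : exists (A : semimatrix_algebra K)
    (omega : xm_morphism X (algebra_crossed_module A))
    (A_2vect : is_two_vector_space (sm_modules A)),
  equivalent R (forget_full (theta omega A_2vect)).
Proof.
exists A, rep_morphism, A_2vect.
apply: (@theta_equivalent K X R A rep_morphism A_2vect Psi psi_trans
  psi_trans_inv) => //.
move=> g g' c M y; apply: etrans (psi_lam c y); congr (psi g' _).
exact: lam_actE.
Qed.
End TwoRepresentation.

(** * Strictness *)

(** An iterated twist and the twist by the product are equal modules, but not by computation, so an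
    identity between them needs a predicate that allows different endpoints. *)
Inductive is_identity1 (C : category) (x : C) : forall y, chom x y -> Prop :=
  IsIdentity1 : is_identity1 (cid x).

Lemma is_identity1_eq (C : category) (x : C) (f : chom x x) :
  is_identity1 f -> f = cid x.
Proof.
move=> fid; suff gen y (g : chom x y) : is_identity1 g ->
    forall e : x = y, g = ecast z (chom x z) e (cid x).
  exact: (gen x f fid erefl).
by case=> e; rewrite (Prop_irrelevance e erefl).
Qed.

(** Identity components make the functors agree on objects; naturality then equates them on
    morphisms, and compatibility with tensors equates their constraints. *)
Lemma identity_transformation (K : fieldType) (C D : module_category K)
    (F G : module_functor C D) (t : module_transformation F G) :
  (forall M, is_identity1 (t M)) ->
  @is_identity2 (module_categories K) C D F G t.
Proof.
move=> t_id.
have obE : mf_ob F = mf_ob G by apply: funext => M; case: (t_id M).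
case: F G t t_id obE => F hF sF h1 hM si sn sa su.
case=> G hG sG h1' hM' si' sn' sa' su'.
move=> t t_id /= FG; subst G.
have tE M : t M = cid (F M) by apply: is_identity1_eq.
have hE : hF = hG.
  apply: functional_extensionality_dep => M.
  apply: functional_extensionality_dep => N.
  apply: funext => f; have /= := mt_nat t f.
  by rewrite !tE ccomp1l ccomp1r.
subst hG; have sE : sF = sG.
  apply: functional_extensionality_dep => V.
  apply: functional_extensionality_dep => M.
  have /= := mt_str t V M.
  by rewrite !tE mc_map1 ccomp1l ccomp1r.
subst sG.
move: t t_id tE.
rewrite (Prop_irrelevance h1' h1) (Prop_irrelevance hM' hM)
  (Prop_irrelevance si' si)
  (Prop_irrelevance sn' sn) (Prop_irrelevance sa' sa) (Prop_irrelevance su' su).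
move=> t _ tE.
have -> : t = mt_id _ by apply: module_transformation_eq.
exact: IsIdentity2.
Qed.

Lemma full_subbicategory_identity2 (B : bicategory) (P : B -> Prop)
    (x y : full_subbicategory P) (f g : bhom x y) (a : bcell f g) :
  @is_identity2 B (sval x) (sval y) f g a -> is_identity2 a.
Proof.
case; exact: (@IsIdentity2 (full_subbicategory P) x y f).
Qed.

(** Equivariance of a map that is the identity on vectors forces the two actions to coincide. *)
Lemma amod_identity (K : fieldType) (A : algebra K) (P : amodule A -> Prop)
    (P_tensor : forall V M, P M -> P (am_tensor V M)) (V : lmodType K)
    (act act' : A -> V -> V) ad ar am ai ad' ar' am' ai' pM pM'
    (f : amod_hom (@AModule K A V act ad ar am ai)
       (@AModule K A V act' ad' ar' am' ai')) :
  (forall x, f x = x) ->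
  @is_identity1 (amod_module_category P_tensor)
    (exist P _ pM) (exist P _ pM') f.
Proof.
move=> fE; have actE : act = act'.
  apply: funext => a; apply: funext => x.
  by have := ah_act f a x; rewrite !fE.
subst act'; move: f fE pM'.
rewrite (Prop_irrelevance ad' ad) (Prop_irrelevance ar' ar)
  (Prop_irrelevance am' am) (Prop_irrelevance ai' ai) => f fE pM'.
rewrite (Prop_irrelevance pM' pM).
have -> : f = cid (exist P (AModule ad ar am ai) pM :
  amod_module_category P_tensor).
  exact: amod_hom_eq.
exact: IsIdentity1.
Qed.

Lemma theta_strict (K : fieldType) (X : crossed_module)
    (A : semimatrix_algebra K)
    (omega : xm_morphism X (algebra_crossed_module A))
    (A_2vect : is_two_vector_space (sm_modules A)) :
  strict (theta omega A_2vect).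
Proof.
split=> [x | x y z f g]; apply: full_subbicategory_identity2.
  apply: (@identity_transformation K (sm_modules A) (sm_modules A)
    (mf_id (sm_modules A)) (twist_functor _) (theta_unit omega)).
  (* Opening the module shows source and target as two actions on the same space [V]. *)
  by case=> [[V act ad ar am ai] pM]; apply: amod_identity.
apply: (@identity_transformation K (sm_modules A) (sm_modules A) _ _
  (theta_comp omega f g)).
by case=> [[V act ad ar am ai] pM]; apply: amod_identity.
Qed.

Theorem corollary3p5 (K : fieldType) (X : crossed_module) (R : two_rep K X) :
  (exists (A : semimatrix_algebra K)
          (omega : xm_morphism X (algebra_crossed_module A))
          (A_2vect : is_two_vector_space (sm_modules A)),
     equivalent R (theta omega A_2vect)) /\
  (exists R' : two_rep K X, strict R' /\ equivalent R R').
Proof.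
suff [A [omega [A_2vect RA]]] : exists (A : semimatrix_algebra K)
    (omega : xm_morphism X (algebra_crossed_module A))
    (A_2vect : is_two_vector_space (sm_modules A)),
    equivalent R (theta omega A_2vect).
  split; first by exists A, omega, A_2vect.
  by exists (theta omega A_2vect); split=> //; apply: theta_strict.
have [n [E [E' [EE' E'E]]]] := svalP (R tt).
have [A [omega [A_2vect RA]]] := @equivalent_theta K X
  (forget_full R) n E E' EE' E'E.
by exists A, omega, A_2vect; apply: forget_full_equivalent.
Qed.
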